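(* Let $N\ge1$. If $f\in\mathcal{H}^1(\mathbb{R}^N)$, then $\Lambda^{-N}f\in C_0(\mathbb{R}^N)$, and the map $\Lambda^{-N}:\mathcal{H}^1(\mathbb{R}^N)\to C_0(\mathbb{R}^N)$ is bounded.
   Context: $\Lambda=\sqrt{-\Delta}$, i.e. $\Lambda f=\mathcal{F}^{-1}[2\pi|\eta|\mathcal{F}(f)]$. $\Lambda^{-N}f:=G_N*f$, where $G_N(x)=C_N\log|x|$ and $C_N$ is the nonzero real constant for which $\Lambda^N G_N=\delta_0$; the convolution is understood through the duality between $\mathcal{H}^1(\mathbb{R}^N)$ and $\mathrm{BMO}(\mathbb{R}^N)\ni\log|\cdot|$ (functions in $\mathcal{H}^1$ have zero mean, so an additive constant in $G_N$ is immaterial). $\mathcal{H}^1(\mathbb{R}^N)$ is the real Hardy space: $f\in\mathcal{H}^1$ iff $\sup_{s>0}|\Phi_s*f|\in L^1(\mathbb{R}^N)$, where $\Phi$ is Schwartz with $\int\Phi=1$ and $\Phi_s(x)=s^{-N}\Phi(x/s)$; its norm is the $L^1$ norm of this maximal function. $C_0(\mathbb{R}^N)$ is the space of continuous functions vanishing at infinity with the supremum norm. *)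

(* Defs.v *)
From HB Require Import structures.
From mathcomp Require Import all_boot all_order all_algebra.
From mathcomp Require Import complex.
From mathcomp Require Import all_classical all_reals all_analysis.

Set Implicit Arguments.
Unset Strict Implicit.
Unset Printing Implicit Defensive.
Import Order.TTheory GRing.Theory Num.Theory.
Import numFieldNormedType.Exports.

Local Open Scope classical_set_scope.
Local Open Scope ring_scope.
Local Open Scope complex_scope.

Definition rV_display : measure_display. Proof. exact. Qed.

Section rV_measurable.
Context {R : realType} (n : nat).

Let coords : 'I_n -> 'rV[R]_n -> R := fun i x => x ord0 i.

Let rV_set0 : g_sigma_preimage coords set0.
Proof. exact: sigma_algebra0. Qed.

Let rV_setC A : g_sigma_preimage coords A -> g_sigma_preimage coords (~` A).
Proof. exact: sigma_algebraC. Qed.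

Let rV_bigcup (F : (set 'rV[R]_n)^nat) :
  (forall i, g_sigma_preimage coords (F i)) ->
  g_sigma_preimage coords (\bigcup_i (F i)).
Proof. exact: sigma_algebra_bigcup. Qed.

(* Generated by the coordinate maps, hence the Borel sigma-algebra of R^n. *)
HB.instance Definition _ := @isMeasurable.Build rV_display
  'rV[R]_n (g_sigma_preimage coords) rV_set0 rV_setC rV_bigcup.

Lemma measurable_coord (i : 'I_n) :
  measurable_fun [set: 'rV[R]_n] (fun x => x ord0 i).
Proof.
move=> _ Y mY; rewrite setTI; apply: sub_sigma_algebra => /=.
rewrite -bigcup_seq/=; exists i => /=; first by rewrite mem_index_enum.
by exists Y => //; rewrite setTI.
Qed.

Lemma measurable_fun_coordP d (T : measurableType d) (f : T -> 'rV[R]_n) :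
  (forall i, measurable_fun [set: T] (fun t => f t ord0 i)) ->
  measurable_fun [set: T] f.
Proof.
move=> mf _ A mA; rewrite setTI.
suff H : (measurable : set (set 'rV[R]_n)) `<=`
    [set B | d.-measurable (f @^-1` B)] by exact: H.
apply: smallest_sub.
  split=> /=.
  - by rewrite preimage_set0.
  - by move=> B mB; rewrite setTD preimage_setC; exact: measurableC.
  - by move=> F mF; rewrite preimage_bigcup; exact: bigcup_measurable.
rewrite -bigcup_seq/=; apply: bigcup_sub => i _ _ [B mB <-] /=.
by rewrite setTI; have := mf i measurableT B mB; rewrite setTI.
Qed.

End rV_measurable.

Section rV_lebesgue.
Context {R : realType}.

Definition cons_rV n (p : measurableTypeR R * 'rV[R]_n) : 'rV[R]_n.+1 :=
  \row_i oapp (fun j => p.2 ord0 j) p.1 (unlift ord0 i).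

Lemma cons_rV0 n (p : measurableTypeR R * 'rV[R]_n) :
  cons_rV p ord0 ord0 = p.1.
Proof. by rewrite mxE unlift_none. Qed.

Lemma cons_rVS n (p : measurableTypeR R * 'rV[R]_n) (j : 'I_n) :
  cons_rV p ord0 (lift ord0 j) = p.2 ord0 j.
Proof. by rewrite mxE liftK. Qed.

Lemma measurable_cons_rV n : measurable_fun setT (@cons_rV n).
Proof.
apply: measurable_fun_coordP => i.
case: (unliftP ord0 i) => [j ->|->].
- rewrite [X in measurable_fun _ X](_ : _ =
      (fun x : 'rV[R]_n => x ord0 j) \o snd); last first.
    by apply/funext => p; rewrite cons_rVS.
  by apply: measurableT_comp; [exact: measurable_coord|exact: measurable_snd].
- rewrite [X in measurable_fun _ X](_ : _ = fst); last first.
    by apply/funext => p; rewrite cons_rV0.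
  exact: measurable_fst.
Qed.

Section step.
Variables (n : nat) (mu : {sigma_finite_measure set 'rV[R]_n -> \bar R}).

Definition lebesgue_cons : set 'rV[R]_n.+1 -> \bar R :=
  pushforward (@lebesgue_measure R \x mu)%E (@cons_rV n).

Let lebesgue_cons0 : lebesgue_cons set0 = 0%E.
Proof. by rewrite /lebesgue_cons /pushforward preimage_set0 measure0. Qed.

Let lebesgue_cons_ge0 A : (0 <= lebesgue_cons A)%E.
Proof. by rewrite /lebesgue_cons /pushforward; exact: measure_ge0. Qed.

Let lebesgue_cons_sigma_additive : semi_sigma_additive lebesgue_cons.
Proof.
have mc A : measurable A -> measurable (@cons_rV n @^-1` A).
  by move=> mA; rewrite -[X in measurable X]setTI; exact: measurable_cons_rV.
move=> F mF tF mUF; rewrite /lebesgue_cons /pushforward preimage_bigcup.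
apply: measure_semi_sigma_additive => [k| |].
- by apply: mc; exact: mF.
- apply/trivIsetP => /= i j _ _ ij; rewrite -preimage_setI.
  by move/trivIsetP : tF => /(_ _ _ _ _ ij) ->//; rewrite preimage_set0.
- by rewrite -preimage_bigcup; exact: mc.
Qed.

HB.instance Definition _ := isMeasure.Build _ _ _
  lebesgue_cons lebesgue_cons0 lebesgue_cons_ge0 lebesgue_cons_sigma_additive.

Let lebesgue_cons_sigma_finite : sigma_finite setT lebesgue_cons.
Proof.
have [F TF Foo] := sigma_finiteT (@lebesgue_measure R).
have [G TG Goo] := sigma_finiteT mu.
pose H i j := [set x : 'rV[R]_n.+1 |
  F i (x ord0 ord0) /\ G j (\row_k x ord0 (lift ord0 k))].
pose K m := let: (i, j) := odflt (0, 0)%N (pickle_inv m) in H i j.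
exists K.
  apply/esym; rewrite -subTset => x _.
  have [i _ Fi] : (\bigcup_i F i) (x ord0 ord0) by rewrite -TF.
  have [j _ Gj] : (\bigcup_i G i) (\row_k x ord0 (lift ord0 k)) by rewrite -TG.
  by exists (pickle (i, j)) => //; rewrite /K pickleK_inv.
move=> m; rewrite /K; case: (odflt _ _) => i j.
have [mF Fi] := Foo i; have [mG Gj] := Goo j.
have HE : @cons_rV n @^-1` H i j = F i `*` G j.
  apply/seteqP; split => p; rewrite /H /= cons_rV0 => -[? Gp]; split => //;
    move: Gp; congr (G j _); apply/rowP => k; by rewrite mxE cons_rVS.
split.
- have mtail : measurable_fun setT
      (fun x : 'rV[R]_n.+1 => \row_k x ord0 (lift ord0 k) : 'rV[R]_n).
    apply: measurable_fun_coordP => k.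
    under eq_fun do rewrite mxE; exact: measurable_coord.
  have -> : H i j = (fun x : 'rV[R]_n.+1 => x ord0 ord0) @^-1` F i `&`
      (fun x : 'rV[R]_n.+1 => \row_k x ord0 (lift ord0 k)) @^-1` G j by [].
  apply: measurableI; rewrite -[X in measurable X]setTI.
    exact: (measurable_coord ord0).
  exact: mtail.
- rewrite /lebesgue_cons /pushforward HE product_measure1E//.
  by rewrite lte_mul_pinfty// ge0_fin_numE.
Qed.

HB.instance Definition _ := Measure_isSigmaFinite.Build _ _ _
  lebesgue_cons lebesgue_cons_sigma_finite.
End step.

Fixpoint lebesgue_rV n : {sigma_finite_measure set 'rV[R]_n -> \bar R} :=
  match n with
  | 0 => dirac (0 : 'rV[R]_0)
  | n'.+1 => lebesgue_cons (lebesgue_rV n')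
  end.

Lemma lebesgue_rV_box n (A : 'I_n -> set (measurableTypeR R)) :
  (forall i, measurable (A i)) ->
  lebesgue_rV n [set x | forall i, A i (x ord0 i)] =
  (\prod_(i < n) lebesgue_measure (A i))%E.
Proof.
elim: n A => [|n IH] A mA.
  rewrite big_ord0 /= diracE mem_set//.
  by move=> -[].
have mB : measurable [set x : 'rV[R]_n | forall i, A (lift ord0 i) (x ord0 i)].
  rewrite [X in measurable X](_ : _ = \bigcap_(i in [set: 'I_n])
      ((fun x : 'rV[R]_n => x ord0 i) @^-1` A (lift ord0 i))); last first.
    by apply/seteqP; split => x /= H i; [move=> _|]; exact: H.
  apply: fin_bigcap_measurable => // i _; rewrite -[X in measurable X]setTI.
  exact: (measurable_coord i measurableT (mA _)).
rewrite big_ord_recl -(IH (fun i => A (lift ord0 i)))//.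
rewrite -product_measure1E// /= /lebesgue_cons /pushforward.
congr (_ _); apply/seteqP; split => p /=.
- move=> Ap; split; first by have := Ap ord0; rewrite cons_rV0.
  by move=> i; have := Ap (lift ord0 i); rewrite cons_rVS.
- move=> [A0 AS] i; case: (unliftP ord0 i) => [j ->|->].
  + by rewrite cons_rVS.
  + by rewrite cons_rV0.
Qed.

End rV_lebesgue.

Section complex_analysis.
Context {R : realType} {N : nat}.
Notation V := 'rV[R]_N.
Notation leb := (lebesgue_rV (R := R) N).
Implicit Types (x y : V) (f g h u phi : V -> R[i]).

(* The library norm on 'rV is the max norm. *)
Definition enorm x : R := Num.sqrt (\sum_(i < N) x ord0 i ^+ 2).

Definition dotp x y : R := \sum_(i < N) x ord0 i * y ord0 i.

Definition cabs (z : R[i]) : R := ComplexField.Normc.normc z.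

Definition cintegrable f : Prop :=
  leb.-integrable setT (EFin \o (fun x => complex.Re (f x))) /\
  leb.-integrable setT (EFin \o (fun x => complex.Im (f x))).

Definition cint f : R[i] :=
  (\int[leb]_x complex.Re (f x)) +i* (\int[leb]_x complex.Im (f x)).

Definition iter_partial (s : seq 'I_N) (f : V -> R) : V -> R :=
  foldr (fun (i : 'I_N) (F : V -> R) => 'D_(delta_mx ord0 i) F) f s.

Definition real_schwartz (f : V -> R) : Prop :=
  forall s : seq 'I_N,
    (forall (i : 'I_N) x, derivable (iter_partial s f) x (delta_mx ord0 i)) /\
    (forall k : nat, exists M : R,
       forall x, enorm x ^+ k * `|iter_partial s f x| <= M).

Definition schwartz f : Prop :=
  real_schwartz (fun x => complex.Re (f x)) /\
  real_schwartz (fun x => complex.Im (f x)).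

Definition expi (t : R) : R[i] := cos t +i* sin t.

Definition fourier f : V -> R[i] :=
  fun eta => cint (fun x => f x * expi (- (2 * pi * dotp x eta))).

Definition inv_fourier f : V -> R[i] :=
  fun x => cint (fun eta => f eta * expi (2 * pi * dotp x eta)).

(* Lambda^k *)
Definition Lambda_pow (k : nat) phi : V -> R[i] :=
  inv_fourier (fun eta => ((2 * pi * enorm eta) ^+ k)%:C * fourier phi eta).

Definition log_kernel (c : R) : V -> R[i] := fun x => (c * ln (enorm x))%:C.

(* Lambda^N (c log|.|) = delta_0 as tempered distributions; Lambda^N is
   symmetric because its symbol is even. *)
Definition is_log_constant (c : R) : Prop :=
  c != 0 /\
  forall phi, schwartz phi ->
    cint (fun x => log_kernel c x * Lambda_pow N phi x) = phi 0.

Definition convol f g : V -> R[i] := fun x => cint (fun y => f (x - y) * g y).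

Definition dilate (s : R) f : V -> R[i] := fun x => (s ^- N)%:C * f (s^-1 *: x).

Definition maximal_fun Phi f : V -> \bar R := fun x =>
  ereal_sup [set (cabs (convol (dilate s Phi) f x))%:E | s in [set s | 0 < s]].

Definition hardy Phi f : Prop :=
  cintegrable f /\ leb.-integrable setT (maximal_fun Phi f).

Definition hardy_norm Phi f : R := fine (\int[leb]_x maximal_fun Phi f x)%E.

(* Bounded compactly supported functions of mean zero: the dense subspace of
   H^1 on which the pairing with a BMO function g is the integral of f g. *)
Definition hardy_dense f : Prop :=
  [/\ cintegrable f,
      exists M : R, forall x, cabs (f x) <= M,
      exists r : R, forall x, r < enorm x -> f x = 0
    & cint f = 0].

(* ell is the bounded linear functional on H^1 represented by g through the
   duality between H^1 and BMO; its values outside H^1 are irrelevant. *)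
Definition is_dual_functional Phi g (ell : (V -> R[i]) -> R[i]) : Prop :=
  [/\ forall (a : R[i]) f h, hardy Phi f -> hardy Phi h ->
        ell (fun x => a * f x + h x) = a * ell f + ell h,
      exists K : R, forall f, hardy Phi f -> cabs (ell f) <= K * hardy_norm Phi f
    & forall f, hardy_dense f -> ell f = cint (fun x => f x * g x)].

(* By density such a functional is unique on H^1; it exists when g is in BMO,
   the value 0 being used otherwise. *)
Definition dual_functional Phi g : (V -> R[i]) -> R[i] :=
  xget (fun=> 0) [set ell | is_dual_functional Phi g ell].

(* Lambda^{-N} f (x) = (G_N * f)(x) = <f, G_N (x - .)> *)
Definition Lambda_inv Phi (c : R) f : V -> R[i] :=
  fun x => dual_functional Phi (fun y => log_kernel c (x - y)) f.

Definition C0 u : Prop :=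
  [/\ continuous (fun x => complex.Re (u x)),
      continuous (fun x => complex.Im (u x))
    & forall e : R, 0 < e -> exists r : R, forall x, r < enorm x -> cabs (u x) < e].

Definition sup_norm u : R := sup [set cabs (u x) | x in setT].

End complex_analysis.

(* Main.v *)
Require Import Defs.
From mathcomp Require Import all_boot all_order all_algebra.
From mathcomp Require Import complex.
From mathcomp Require Import all_classical all_reals all_analysis.
From mathcomp Require Import measurable_realfun.
From mathcomp Require Import ring lra zify.
Import Order.TTheory GRing.Theory Num.Theory.
Import numFieldNormedType.Exports.
Local Open Scope classical_set_scope.
Local Open Scope ring_scope.

Set Implicit Arguments.
Unset Strict Implicit.
Unset Printing Implicit Defensive.

(** The maximal function of [f] is [M f = sup_s |Phi_s * f|] and all pairings are with the
    translates of a multiple of [log |.|].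

    The heart of the matter is the estimate
      [|int f(z) log |x - z| dz| <= K * hardy_norm f]
    for [f] bounded with compact support and mean zero, with [K] independent of [x]. Pick
    an annulus [A = {a <= |w| < 2a}] on which [Phi] has mass [kappa <> 0]. Integrate
    [Phi_s * f] over [x + s A] for [s = D 2^i], [0 <= i < n]. The annuli are disjoint, so
    the sum of these integrals is at most the integral of [M f]. On the other hand it is
    the integral of [f] against [z |-> sum_i psi ((z - x) / (D 2^i))], where
    [psi z = int_A Phi (w - z) dw] satisfies [|psi z - kappa| <= C |z|] and
    [|psi z| <= C / |z|]. Such a sum counts the scales above [|z - x|]: it is [kappa / ln 2]
    times a logarithm of [|z - x|] truncated at [D] and [D 2^n], up to a bounded error,
    which costs a multiple of the [L^1] norm of [f] ([log_trunc_pairing_le]). Mean zero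
    removes the upper truncation, and [D] tends to zero ([log_kernel_bound]). For general
    [f] in the Hardy space, division by [n] shows that [f] has mean zero ([hardy_mean0]).

    The functional that defines [Lambda_inv] is determined only because the functions
    above are dense in the Hardy space. The density is proved with approximants
    that are also Lipschitz ([hardy_density]). Let [eta] be a Lipschitz bump of mass one;
    then [f] is approximated by [(eta_s - eta_t) * (f 1_B)] with [s] small, [t] large and
    [B] a large ball. Three errors appear. First, [eta_t * f] tends to zero by
    cancellation and the tail of [M f]. Second, the part of [f] outside [B] is small in
    [L^1] and is convolved with a fixed element of the Hardy space. Third, [f - eta_s * f]
    is controlled by equicontinuity for the scales above some [d] and by the oscillation
    of the averages for the scales below. The oscillation is at most [2 M f] and tends to
    zero almost everywhere with [d], because [Phi_s * f] converges almost everywhere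
    ([conv_ae_L1]), which rests on a dyadic weak-type inequality ([weak_type]). The same
    convergence bounds the [L^1] norm by the Hardy norm.

    The pairing therefore extends to the Hardy space with a bound uniform in [x], the
    extension is the only functional allowed by the definition ([Lambda_inv_pot_ext]), and
    [Lambda_inv f] is a uniform limit of logarithmic potentials of Lipschitz functions with
    compact support and mean zero. These potentials are continuous because the logarithm
    is locally integrable, and vanish at infinity by cancellation. *)

(** * Lebesgue measure on R^N *)

Lemma measurable_bigcup_countable d (T : measurableType d) (I : countType)
    (F : I -> set T) :
  (forall i, measurable (F i)) -> measurable (\bigcup_i F i).
Proof.
move=> mF; rewrite [X in measurable X](_ : _ =
    \bigcup_n (if pickle_inv n is Some i then F i else set0)).
  by apply: bigcupT_measurable => n; case: pickle_inv.
apply/seteqP; split => x /= [].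
  by move=> i _ Fx; exists (pickle i) => //; rewrite pickleK_inv.
by move=> n _; case: pickle_inv => // i Fx; exists i.
Qed.

Section rV_measure.
Context {R : realType} {N : nat}.
Notation V := 'rV[R]_N.
Notation leb := (lebesgue_rV (R := R) N).
Implicit Types (a b x y : V).

(** Half-open boxes, a pi-system that generates the sigma-algebra. *)
Definition box a b : set V :=
  [set x | forall i, `]a ord0 i, b ord0 i]%classic (x ord0 i)].

Lemma leb_box a b : leb (box a b) =
  (\prod_(i < N) lebesgue_measure (`]a ord0 i, b ord0 i]%classic : set R))%E.
Proof.
by rewrite -(@lebesgue_rV_box R N (fun i => `]a ord0 i, b ord0 i]%classic)).
Qed.

Lemma measurable_forall_coord (A : 'I_N -> set (measurableTypeR R)) :
  (forall i, measurable (A i)) -> measurable [set x : V | forall i, A i (x ord0 i)].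
Proof.
move=> mA; rewrite [X in measurable X](_ : _ = \bigcap_(i in [set: 'I_N])
      ((fun x : V => x ord0 i) @^-1` A i)); last first.
  by apply/seteqP; split => x /= H i; [move=> _|]; exact: H.
apply: fin_bigcap_measurable => // i _; rewrite -[X in measurable X]setTI.
exact: (measurable_coord i measurableT (mA _)).
Qed.

Lemma measurable_box a b : measurable (box a b).
Proof.
exact: (@measurable_forall_coord (fun i => `]a ord0 i, b ord0 i]%classic)).
Qed.

Definition boxes : set (set V) := [set box p.1 p.2 | p in [set: V * V]].

Lemma boxes_box a b : boxes (box a b).
Proof. by exists (a, b). Qed.

Lemma boxes_setI : setI_closed boxes.
Proof.
move=> _ _ [[a b] _ <-] [[c d] _ <-] /=.
exists (\row_i Num.max (a ord0 i) (c ord0 i), \row_i Num.min (b ord0 i) (d ord0 i)) => //=.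
apply/seteqP; split => x /=.
  move=> H; split=> i; have := H i; rewrite /= !mxE !in_itv/= gt_max le_min.
    by move=> /andP[/andP[-> _] /andP[-> _]].
  by move=> /andP[/andP[_ ->] /andP[_ ->]].
by move=> [H1 H2] i; have := H1 i; have := H2 i; rewrite /= !mxE !in_itv/= gt_max le_min =>
  /andP[-> ->] /andP[-> ->].
Qed.

Lemma rV_bounded_nat x : exists n : nat, forall i, `|x ord0 i| < n%:R.
Proof.
exists (\max_i (Num.truncn `|x ord0 i|).+1)%N => i.
apply: (lt_le_trans (truncnS_gt _)); rewrite ler_nat.
exact: (leq_bigmax (F := fun i => (Num.truncn `|x ord0 i|).+1)).
Qed.

Lemma measurable_boxes : measurable = <<s boxes >> :> set (set V).
Proof.
apply/seteqP; split; last first.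
  apply: smallest_sub; first exact: sigma_algebra_measurable.
  by move=> _ [[a b] _ <-]; exact: measurable_box.
move=> A mA.
pose T := g_sigma_algebraType boxes.
suff mid : measurable_fun [set: T] (id : T -> V).
  by have := mid measurableT A mA; rewrite setTI preimage_id.
apply: measurable_fun_coordP => i.
apply: (measurability _ (RGenOInfty.measurableE R)) => _ [_ [c ->] <-].
rewrite setTI /=.
rewrite [X in measurable X](_ : _ = \bigcup_n box
   (\row_j if j == i then c else - n%:R) (\row_j n%:R)); last first.
  apply/seteqP; split => x /=.
    rewrite in_itv/= andbT => cx.
    have [n nx] := rV_bounded_nat x; exists n => // j /=.
    rewrite !mxE in_itv/=; have := nx j; rewrite ltr_norml => /andP[h1 /ltW ->].
    by case: eqP => [->|_]; rewrite ?cx ?h1.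
  by move=> [n _ /(_ i)] /=; rewrite !mxE eqxx !in_itv/= => /andP[-> _].
by apply: bigcupT_measurable => n; apply: sub_sigma_algebra; exact: boxes_box.
Qed.

Lemma prod_fin_num (I : Type) (r : seq I) (P : pred I) (F : I -> \bar R) :
  (forall i, P i -> F i \is a fin_num) ->
  (\prod_(i <- r | P i) F i)%E \is a fin_num.
Proof. by move=> FP; elim/big_ind : _ => // x y; exact: fin_numM. Qed.

Lemma box_lty a b : (leb (box a b) < +oo)%E.
Proof.
rewrite leb_box ltey_eq; apply/orP; left; apply: prod_fin_num => i _.
by rewrite lebesgue_measure_itv/=; case: ifP.
Qed.

Lemma bigcup_box : \bigcup_n box (- const_mx n%:R) (const_mx n%:R) = [set: V].
Proof.
rewrite -subTset => x _; have [n nx] := rV_bounded_nat x.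
exists n => // i /=; rewrite !mxE in_itv/=; have := nx i.
by rewrite ltr_norml => /andP[-> /ltW ->].
Qed.

(** A measure that gives every half-open box its volume is Lebesgue measure. *)
Lemma leb_unique (m : {measure set V -> \bar R}) :
  (forall a b, leb (box a b) = m (box a b)) ->
  forall A, measurable A -> leb A = m A.
Proof.
move=> lm A mA.
apply: (measure_unique boxes (fun n => box (- const_mx n%:R) (const_mx n%:R))) => //.
- exact: measurable_boxes.
- exact: boxes_setI.
- by move=> i; exact: boxes_box.
- exact: bigcup_box.
- by move=> _ [[a b] _ <-]; exact: lm.
- by move=> k; exact: box_lty.
Qed.

(** Dilation by [s] followed by translation by [b]. *)
Definition affine (s : R) b : V -> V := fun x => s *: x + b.

Lemma measurable_affine s b : measurable_fun setT (affine s b).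
Proof.
apply: measurable_fun_coordP => i; rewrite /affine.
under eq_fun do rewrite !mxE.
by apply: measurable_funD => //; apply: measurable_funM => //; exact: measurable_coord.
Qed.

Lemma affine_preimage_box s b c d : 0 < s ->
  affine s b @^-1` box c d = box (s^-1 *: (c - b)) (s^-1 *: (d - b)).
Proof.
move=> s0; apply/seteqP; split => x /= + i => /(_ i); rewrite /= !mxE !in_itv/=.
  by rewrite ltr_pdivrMl// ler_pdivlMl// ltrBlDr lerBrDr.
by rewrite ltr_pdivrMl// ler_pdivlMl// ltrBlDr lerBrDr.
Qed.

Lemma lebesgue_measure_itv_scale (s c d e : R) : 0 < s ->
  lebesgue_measure (`]c, d]%classic : set R) =
  (s%:E * lebesgue_measure (`](s^-1 * (c - e))%R, (s^-1 * (d - e))%R]%classic : set R))%E.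
Proof.
move=> s0; rewrite !lebesgue_measure_itv/= !lte_fin ltr_pM2l ?invr_gt0// ltrD2r.
case: ifP => _; last by rewrite mule0.
by rewrite -!EFinB -EFinM; congr EFin; field; rewrite gt_eqF.
Qed.

Lemma leb_affine s b : 0 < s -> forall A, measurable A ->
  leb A = ((s ^+ N)%:E * leb (affine s b @^-1` A))%E.
Proof.
move=> s0 A mA; have sN0 : 0 <= s ^+ N by rewrite exprn_ge0// ltW.
have := @leb_unique (mscale (NngNum sN0)
  (pushforward leb (affine s b))).
rewrite /mscale/= /pushforward => -> //; first exact: measurable_affine.
move=> mas c d; rewrite /mscale/= /pushforward.
rewrite affine_preimage_box// !leb_box.
have -> : (s ^+ N)%:E = (\prod_(i < N) s%:E)%E :> \bar R.
  by rewrite prodEFin prodr_const card_ord.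
rewrite -big_split/=; apply: eq_bigr => i _.
by rewrite !mxE; exact: lebesgue_measure_itv_scale.
Qed.

Lemma ge0_integral_affine s b (f : V -> \bar R) : 0 < s ->
  measurable_fun setT f -> (forall x, 0 <= f x)%E ->
  (\int[leb]_x f (affine s b x) = (s ^- N)%:E * \int[leb]_x f x)%E.
Proof.
move=> s0 mf f0; have sN0 : 0 <= s ^+ N by rewrite exprn_ge0// ltW.
have -> : (\int[leb]_x f x =
    \int[mscale (NngNum sN0) (pushforward leb (affine s b))]_x f x)%E.
- move=> mas; apply: eq_measure_integral => A mA _.
  exact: leb_affine.
- exact: measurable_affine.
move=> mas; rewrite ge0_integral_mscale//.
rewrite ge0_integral_pushforward//=.
by rewrite muleA -EFinM mulVf ?mul1e// expf_neq0// gt_eqF.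
Qed.

Lemma lebesgue_measure_itv_opp (c d e : R) :
  lebesgue_measure (`]c, d]%classic : set R) =
  lebesgue_measure (`[(e - d)%R, (e - c)%R[%classic : set R).
Proof.
rewrite !lebesgue_measure_itv/= !lte_fin ltrD2l ltrN2; case: ifP => // _.
by rewrite -!EFinB; congr EFin; ring.
Qed.

(** The reflection used in convolutions. *)
Definition reflect_at b : V -> V := fun x => b - x.

Lemma measurable_reflect b : measurable_fun setT (reflect_at b).
Proof.
apply: measurable_fun_coordP => i.
rewrite /reflect_at; under eq_fun do rewrite !mxE.
by apply: measurable_funB => //; exact: measurable_coord.
Qed.

Lemma leb_reflect b A : measurable A -> leb A = leb (reflect_at b @^-1` A).
Proof.
move=> mA; have := @leb_unique (pushforward leb (reflect_at b)).
rewrite /pushforward => -> //; first exact: measurable_reflect.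
move=> mas c d; rewrite /= /pushforward leb_box.
transitivity (leb [set x : V | forall i,
   `[b ord0 i - d ord0 i, b ord0 i - c ord0 i[%classic (x ord0 i)]).
  rewrite (@lebesgue_rV_box R N (fun i =>
   `[b ord0 i - d ord0 i, b ord0 i - c ord0 i[%classic)).
    by apply: eq_bigr => i _; exact: lebesgue_measure_itv_opp.
  by move=> i; exact: measurable_itv.
congr (leb _); apply/seteqP; split => x /= + i => /(_ i); rewrite /= !mxE !in_itv/=.
  by rewrite lerBlDr ltrBrDr -lerBlDl => /andP[? ?]; apply/andP; split; lra.
by move=> /andP[? ?]; apply/andP; split; lra.
Qed.

Lemma ge0_integral_reflect b (f : V -> \bar R) :
  measurable_fun setT f -> (forall x, 0 <= f x)%E ->
  (\int[leb]_x f (reflect_at b x) = \int[leb]_x f x)%E.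
Proof.
move=> mf f0; have mre := measurable_reflect b.
pose m : {measure set V -> \bar R} :=
  measure_function_pushforward__canonical__measure_function_Measure leb mre.
transitivity (\int[m]_x f x)%E.
  by rewrite /m/= ge0_integral_pushforward.
by apply: eq_measure_integral => A mA _; exact/esym/leb_reflect.
Qed.

(** A map that transports Lebesgue measure to a multiple of itself has the same
    effect on integrals of signed functions as on those of nonnegative ones. *)
Lemma integral_comp_scaled (T : V -> V) (k : R) (f : V -> \bar R) :
  0 <= k -> measurable_fun setT T ->
  (forall g : V -> \bar R, measurable_fun setT g -> (forall x, 0 <= g x)%E ->
    (\int[leb]_x g (T x) = k%:E * \int[leb]_x g x)%E) ->
  leb.-integrable setT f ->
  leb.-integrable setT (f \o T) /\
  (\int[leb]_x f (T x) = k%:E * \int[leb]_x f x)%E.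
Proof.
move=> k0 mT Tg /[dup] fi /integrableP[mf fy]; split.
  apply/integrableP; split; first exact: measurableT_comp.
  rewrite (Tg (fun x => `|f x|%E))//; last exact: measurableT_comp.
  exact: lte_mul_pinfty.
rewrite [LHS]integralE [in RHS]integralE.
have h1 : (\int[leb]_x (fun x => f (T x))^\+ x = k%:E * \int[leb]_x f^\+ x)%E.
  by rewrite -(Tg f^\+%E) ?(funepos_comp f T)//; exact: measurable_funepos.
have h2 : (\int[leb]_x (fun x => f (T x))^\- x = k%:E * \int[leb]_x f^\- x)%E.
  by rewrite -(Tg f^\-%E) ?(funeneg_comp f T)//; exact: measurable_funeneg.
rewrite h1 h2 [RHS]muleBr//.
by apply: fin_num_adde_defl; rewrite fin_numN; exact: integrable_neg_fin_num.
Qed.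

Lemma rV_norm_ltP x (r : R) : 0 < r ->
  `|x| < r <-> forall i, `|x ord0 i| < r.
Proof.
move=> r0; rewrite [`|x|]/Num.norm/= mx_normrE; split.
  move=> /bigmax_ltP[_ H] i; exact: (H (ord0, i)).
by move=> H; apply/bigmax_ltP; split => // -[i j] _ /=; rewrite ord1.
Qed.

Lemma rV_coord_le x i : `|x ord0 i| <= `|x|.
Proof.
rewrite [`|x|]/Num.norm/= mx_normrE; apply/bigmax_geP; right => /=.
by exists (ord0, i).
Qed.

Lemma rV_ballE x (r : R) : 0 < r ->
  ball x r = [set y | forall i, `]x ord0 i - r, x ord0 i + r[%classic (y ord0 i)].
Proof.
move=> r0; apply/seteqP; split => y /=.
  rewrite -ball_normE /= rV_norm_ltP// => H i; have := H i.
  by rewrite !mxE /= in_itv/= ltr_norml => /andP[? ?]; apply/andP; split; lra.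
rewrite -ball_normE /= rV_norm_ltP// => H i; have := H i.
by rewrite !mxE /= in_itv/= ltr_norml => /andP[? ?]; apply/andP; split; lra.
Qed.

Lemma measurable_rV_ball x (r : R) : measurable (ball x r).
Proof.
have [r0|r0] := ltP 0 r; last first.
  rewrite (_ : ball x r = set0)//; apply/seteqP; split => y //=.
  by rewrite -ball_normE /= => /(le_lt_trans (normr_ge0 _)); rewrite ltNge r0.
rewrite rV_ballE//.
exact: (@measurable_forall_coord (fun i => `]x ord0 i - r, x ord0 i + r[%classic)).
Qed.

Lemma leb_ball x (r : R) : 0 < r -> leb (ball x r) = ((r *+ 2) ^+ N)%:E.
Proof.
move=> r0; rewrite rV_ballE//.
rewrite (@lebesgue_rV_box R N (fun i => `]x ord0 i - r, x ord0 i + r[%classic)).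
  rewrite (eq_bigr (fun=> (r *+ 2)%:E)) => [|i _].
    by rewrite prodEFin prodr_const card_ord.
  rewrite lebesgue_measure_itv/= lte_fin ifT; last lra.
  by rewrite -EFinB; congr EFin; rewrite mulr2n; ring.
by move=> i; exact: measurable_itv.
Qed.

Lemma open_measurable_rV (A : set V) : open A -> measurable A.
Proof.
move=> oA.
pose B (p : 'rV[rat]_N * nat) : set V := ball (map_mx ratr p.1 : V) (p.2.+1%:R^-1).
rewrite (_ : A = \bigcup_(p in [set: 'rV[rat]_N * nat])
    (if `[< B p `<=` A >] then B p else set0)).
  apply: measurable_bigcup_countable => p; case: asboolP => // _.
  exact: measurable_rV_ball.
apply/seteqP; split => x; last first.
  by move=> [p _]; case: asboolP => // + Bx; exact.
move=> Ax; have /nbhs_ballP[e /= e0 eA] : nbhs x A.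
  by rewrite openE in oA; exact: oA.
have [n ne] : exists n : nat, n.+1%:R^-1 < e / 2.
  exists (Num.truncn (e / 2)^-1).
  by rewrite -[ltRHS]invrK ltf_pV2 ?posrE ?invr_gt0 ?divr_gt0// truncnS_gt.
pose q := \row_i xget 0 [set q : rat | x ord0 i < ratr q < x ord0 i + n.+1%:R^-1].
have Bx : B (q, n) x.
  rewrite /B /= rV_ballE// => i /=; rewrite !mxE in_itv/=.
  have [q0 q0x] : exists q : rat, x ord0 i < ratr q < x ord0 i + n.+1%:R^-1.
    have /rat_in_itvoo[q0] : x ord0 i < x ord0 i + n.+1%:R^-1 by rewrite ltrDl.
    by rewrite in_itv/= => ?; exists q0.
  have n0 : 0 < n.+1%:R^-1 :> R by rewrite invr_gt0.
  case: xgetP => [q1 _ /=|/(_ q0)//].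
  move: n0; move: (n.+1%:R^-1) (ratr q1) => u v u0 /andP[h1 h2].
  by apply/andP; split; lra.
exists (q, n) => //; rewrite asboolT// => y By; apply: eA.
have -> : e = e / 2 + e / 2 by field.
apply: (ball_triangle (y := map_mx ratr q : V)).
  by apply/ball_sym/(le_ball (ltW ne)).
exact: (le_ball (ltW ne)) By.
Qed.

Lemma continuous_measurable_rV (f : V -> R) : continuous f -> measurable_fun setT f.
Proof.
move=> /continuousP cf; apply: (measurability _ (RGenOpens.measurableE R)).
move=> _ [_ [a [b ->] <-]]; rewrite setTI; apply: open_measurable_rV.
by apply: cf; exact: interval_open.
Qed.

Lemma measurable_rV_norm : measurable_fun setT (fun x : V => `|x|).
Proof. by apply: continuous_measurable_rV; exact: norm_continuous. Qed.

End rV_measure.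

(** * Integrals of complex-valued functions *)

Section cabs_theory.
Context {R : realType}.
Implicit Types (z w : R[i]) (r : R).

Lemma cabs_def z : cabs z = Num.sqrt (complex.Re z ^+ 2 + complex.Im z ^+ 2).
Proof. by case: z. Qed.

Lemma cabs_ge0 z : 0 <= cabs z.
Proof. by rewrite cabs_def sqrtr_ge0. Qed.

Lemma cabs0 : cabs (0 : R[i]) = 0.
Proof. exact: ComplexField.Normc.normc0. Qed.

Lemma cabs0_eq0 z : cabs z = 0 -> z = 0.
Proof. exact: ComplexField.Normc.eq0_normc. Qed.

Lemma cabsM z w : cabs (z * w) = cabs z * cabs w.
Proof. exact: ComplexField.Normc.normcM. Qed.

Lemma cabsD z w : cabs (z + w) <= cabs z + cabs w.
Proof. exact: le_normcD. Qed.

Lemma cabsN z : cabs (- z) = cabs z.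
Proof. exact: normcN. Qed.

Lemma cabsB z w : cabs (z - w) <= cabs z + cabs w.
Proof. by rewrite -(cabsN w) cabsD. Qed.

Lemma cabsBC z w : cabs (z - w) = cabs (w - z).
Proof. by rewrite -cabsN opprB. Qed.

Lemma cabs_triangle u z w : cabs (z - w) <= cabs (z - u) + cabs (u - w).
Proof. by rewrite -[z - w](subrKA u) cabsD. Qed.

Lemma cabs_real r : cabs (r%:C)%C = `|r|.
Proof. by rewrite cabs_def /= expr0n/= addr0 sqrtr_sqr. Qed.

Lemma Re_le_cabs z : `|complex.Re z| <= cabs z.
Proof. by rewrite cabs_def -sqrtr_sqr ler_wsqrtr// lerDl sqr_ge0. Qed.

Lemma Im_le_cabs z : `|complex.Im z| <= cabs z.
Proof. by rewrite cabs_def -sqrtr_sqr ler_wsqrtr// lerDr sqr_ge0. Qed.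

Lemma cabs_le_ReIm z : cabs z <= `|complex.Re z| + `|complex.Im z|.
Proof.
rewrite cabs_def -[leRHS]ger0_norm ?addr_ge0// -sqrtr_sqr ler_wsqrtr//.
by rewrite sqrrD !real_normK ?num_real// addrAC lerDl mulrn_wge0// mulr_ge0.
Qed.

Lemma cabs_sum (I : Type) (s : seq I) (P : pred I) (F : I -> R[i]) :
  cabs (\sum_(i <- s | P i) F i) <= \sum_(i <- s | P i) cabs (F i).
Proof.
elim/big_ind2 : _ => [|x x' y y' h1 h2|//]; first by rewrite cabs0.
by rewrite (le_trans (cabsD _ _))// lerD.
Qed.

Lemma ReD z w : complex.Re (z + w) = complex.Re z + complex.Re w.
Proof. by case: z w => [? ?] []. Qed.

Lemma ImD z w : complex.Im (z + w) = complex.Im z + complex.Im w.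
Proof. by case: z w => [? ?] []. Qed.

Lemma ReN z : complex.Re (- z) = - complex.Re z.
Proof. by case: z. Qed.

Lemma ImN z : complex.Im (- z) = - complex.Im z.
Proof. by case: z. Qed.

Lemma ReM z w : complex.Re (z * w) =
  complex.Re z * complex.Re w - complex.Im z * complex.Im w.
Proof. by case: z w => [? ?] []. Qed.

Lemma ImM z w : complex.Im (z * w) =
  complex.Re z * complex.Im w + complex.Im z * complex.Re w.
Proof. by case: z w => [? ?] []. Qed.

Lemma complex_eta z w : complex.Re z = complex.Re w ->
  complex.Im z = complex.Im w -> z = w.
Proof. by case: z w => [? ?] [? ?] /= -> ->. Qed.

End cabs_theory.

Section complex_integral.
Context {R : realType} d (T : measurableType d) (mu : {measure set T -> \bar R}).
Implicit Types (f g : T -> R[i]) (a : R[i]).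

(** Measurability of a complex function, through its real and imaginary parts. *)
Definition cmeas f := measurable_fun setT (fun x => complex.Re (f x)) /\
  measurable_fun setT (fun x => complex.Im (f x)).

(** Integrability and integral of a complex function on an arbitrary measure
    space; on Lebesgue measure they unfold to [cintegrable] and [cint]. *)
Definition cintegrable_on f :=
  mu.-integrable setT (EFin \o (fun x => complex.Re (f x))) /\
  mu.-integrable setT (EFin \o (fun x => complex.Im (f x))).

Definition cint_on f : R[i] :=
  ((\int[mu]_x complex.Re (f x)) +i* (\int[mu]_x complex.Im (f x)))%C.

Lemma cmeas_cst a : cmeas (fun=> a).
Proof. by split; exact: measurable_cst. Qed.

Lemma cmeasD f g : cmeas f -> cmeas g -> cmeas (fun x => f x + g x).
Proof.
move=> [f1 f2] [g1 g2]; split.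
  by under eq_fun do rewrite ReD; exact: measurable_funD.
by under eq_fun do rewrite ImD; exact: measurable_funD.
Qed.

Lemma cmeasM f g : cmeas f -> cmeas g -> cmeas (fun x => f x * g x).
Proof.
move=> [f1 f2] [g1 g2]; split.
  under eq_fun do rewrite ReM.
  by apply: measurable_funB; exact: measurable_funM.
under eq_fun do rewrite ImM.
by apply: measurable_funD; exact: measurable_funM.
Qed.

Lemma cmeasN f : cmeas f -> cmeas (fun x => - f x).
Proof.
move=> mf; rewrite (_ : (fun x => - f x) = (fun x => (- 1) * f x)).
  by apply: cmeasM => //; exact: cmeas_cst.
by apply/funext => x; rewrite mulN1r.
Qed.

Lemma cmeasB f g : cmeas f -> cmeas g -> cmeas (fun x => f x - g x).
Proof. by move=> mf mg; apply: cmeasD => //; exact: cmeasN. Qed.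

Lemma cmeas_real (g : T -> R) : measurable_fun setT g -> cmeas (fun x => (g x)%:C)%C.
Proof. by move=> mg; split => //=; exact: measurable_cst. Qed.

Lemma cmeas_cabs f : cmeas f -> measurable_fun setT (fun x => cabs (f x)).
Proof.
move=> [f1 f2]; under eq_fun do rewrite cabs_def.
have ms : measurable_fun setT (@Num.sqrt R).
  by apply: continuous_measurable_fun; exact: sqrt_continuous.
apply: (measurableT_comp ms).
by apply: measurable_funD; exact: measurable_funX.
Qed.

Lemma cmeas_cabse f : cmeas f -> measurable_fun setT (fun x => (cabs (f x))%:E).
Proof. by move=> /cmeas_cabs mf; exact/measurable_EFinP. Qed.

Lemma cintegrable_meas f : cintegrable_on f -> cmeas f.
Proof.
by move=> [/measurable_int/measurable_EFinP f1 /measurable_int/measurable_EFinP f2].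
Qed.

Lemma le_cintegrable f (g : T -> R) : cmeas f -> mu.-integrable setT (EFin \o g) ->
  (forall x, cabs (f x) <= g x) -> cintegrable_on f.
Proof.
move=> [f1 f2] ig fg; split; (apply: (le_integrable _ _ _ ig) => //;
    first exact/measurable_EFinP) => x _ /=; rewrite lee_fin.
  by rewrite (le_trans (Re_le_cabs _))// (le_trans (fg x))// ler_norm.
by rewrite (le_trans (Im_le_cabs _))// (le_trans (fg x))// ler_norm.
Qed.

Lemma cintegrable_cabs f : cintegrable_on f ->
  mu.-integrable setT (fun x => (cabs (f x))%:E).
Proof.
move=> /[dup] /cintegrable_meas mf [i1 i2].
apply: (@le_integrable _ _ _ mu setT measurableT _ (fun x => `|complex.Re (f x)|%:E + `|complex.Im (f x)|%:E)%E) => //.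
- exact: cmeas_cabse.
- by move=> x _ /=; rewrite lee_fin [leLHS]ger0_norm ?cabs_ge0// [leRHS]ger0_norm ?addr_ge0// cabs_le_ReIm.
- by apply: integrableD => //; exact: integrable_norm.
Qed.

Lemma cintegrableP f : cintegrable_on f <->
  cmeas f /\ (\int[mu]_x (cabs (f x))%:E < +oo)%E.
Proof.
split=> [fi|[mf fy]].
  split; first exact: cintegrable_meas.
  have /integrableP[_] := cintegrable_cabs fi; apply: le_lt_trans.
  rewrite le_eqVlt; apply/orP; left; apply/eqP; apply: eq_integral => x _ /=.
  by rewrite ger0_norm ?cabs_ge0.
apply: (le_cintegrable (g := fun x => cabs (f x))) => //.
apply/integrableP; split; first exact: cmeas_cabse.
apply: le_lt_trans fy; rewrite le_eqVlt; apply/orP; left; apply/eqP.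
by apply: eq_integral => x _ /=; rewrite ger0_norm ?cabs_ge0.
Qed.

Lemma cintegrableD f g : cintegrable_on f -> cintegrable_on g ->
  cintegrable_on (fun x => f x + g x).
Proof.
move=> [f1 f2] [g1 g2]; split.
  by apply: eq_integrable (integrableD _ f1 g1) => // x _ /=; rewrite ReD.
by apply: eq_integrable (integrableD _ f2 g2) => // x _ /=; rewrite ImD.
Qed.

Lemma cintegrableZ a f : cintegrable_on f -> cintegrable_on (fun x => a * f x).
Proof.
move=> [f1 f2]; split.
  apply: eq_integrable (integrableB _ (integrableZl _ (complex.Re a) f1)
    (integrableZl _ (complex.Im a) f2)) => // x _ /=.
  by rewrite ReM.
apply: eq_integrable (integrableD _ (integrableZl _ (complex.Re a) f2)
    (integrableZl _ (complex.Im a) f1)) => // x _ /=.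
by rewrite ImM.
Qed.

Lemma cintegrableN f : cintegrable_on f -> cintegrable_on (fun x => - f x).
Proof.
move=> /(cintegrableZ (-1)); rewrite (_ : (fun x => -1 * f x) = (fun x => - f x))//.
by apply/funext => x; rewrite mulN1r.
Qed.

Lemma cintegrableB f g : cintegrable_on f -> cintegrable_on g ->
  cintegrable_on (fun x => f x - g x).
Proof. by move=> fi /cintegrableN gi; exact: cintegrableD. Qed.

Lemma cintegrable0 : cintegrable_on (fun=> 0).
Proof. by split; exact: integrable0. Qed.

Lemma cintegrable_sum (I : Type) (s : seq I) (F : I -> T -> R[i]) :
  (forall i, cintegrable_on (F i)) ->
  cintegrable_on (fun x => \sum_(i <- s) F i x).
Proof.
move=> iF; elim: s => [|i s IH].
  by under eq_fun do rewrite big_nil; exact: cintegrable0.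
by under eq_fun do rewrite big_cons; exact: cintegrableD.
Qed.

Lemma cintD f g : cintegrable_on f -> cintegrable_on g ->
  cint_on (fun x => f x + g x) = cint_on f + cint_on g.
Proof.
move=> [f1 f2] [g1 g2]; rewrite /cint_on; apply: complex_eta; rewrite ?ReD ?ImD /=.
  by under eq_Rintegral do rewrite ReD; rewrite RintegralD.
by under eq_Rintegral do rewrite ImD; rewrite RintegralD.
Qed.

Lemma cintZ a f : cintegrable_on f -> cint_on (fun x => a * f x) = a * cint_on f.
Proof.
move=> [f1 f2]; rewrite /cint_on; apply: complex_eta; rewrite ?ReM ?ImM /=.
  under eq_Rintegral do rewrite ReM.
  rewrite RintegralB// ?RintegralZl//; first exact: (integrableZl _ _ f1).
  exact: (integrableZl _ _ f2).
under eq_Rintegral do rewrite ImM.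
rewrite RintegralD// ?RintegralZl//; first exact: (integrableZl _ _ f2).
exact: (integrableZl _ _ f1).
Qed.

Lemma cintN f : cintegrable_on f -> cint_on (fun x => - f x) = - cint_on f.
Proof. by move=> fi; under eq_fun do rewrite -mulN1r; rewrite cintZ// mulN1r. Qed.

Lemma cintB f g : cintegrable_on f -> cintegrable_on g ->
  cint_on (fun x => f x - g x) = cint_on f - cint_on g.
Proof. by move=> fi gi; rewrite cintD ?cintN//; exact: cintegrableN. Qed.

Lemma cint0 : cint_on (fun=> 0) = 0.
Proof.
by rewrite /cint_on /Rintegral /= integral0.
Qed.

Lemma cint_sum (I : Type) (s : seq I) (F : I -> T -> R[i]) :
  (forall i, cintegrable_on (F i)) ->
  cint_on (fun x => \sum_(i <- s) F i x) = \sum_(i <- s) cint_on (F i).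
Proof.
move=> iF; elim: s => [|i s IH].
  by under eq_fun do rewrite big_nil; rewrite big_nil cint0.
under eq_fun do rewrite big_cons; rewrite big_cons cintD ?IH//.
exact: cintegrable_sum.
Qed.

Lemma cint_real (g : T -> R) :
  cint_on (fun x => (g x)%:C)%C = ((\int[mu]_x g x)%:C)%C.
Proof. by rewrite /cint_on /= [X in (_ +i* X)%C]/Rintegral integral0. Qed.

(** The modulus of the integral is at most the integral of the modulus: rotate the
    integral onto the positive real axis. *)
Lemma cabs_cint f : cintegrable_on f ->
  ((cabs (cint_on f))%:E <= \int[mu]_x (cabs (f x))%:E)%E.
Proof.
move=> fi; set z := cint_on f.
have [z0|z0] := eqVneq (cabs z) 0.
  by rewrite z0 integral_ge0// => x _; rewrite lee_fin cabs_ge0.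
pose u : R[i] := (z^* )%C / ((cabs z)%:C)%C.
have cz : z * (z^* )%C = ((cabs z ^+ 2)%:C)%C.
  apply: complex_eta; rewrite ?ReM ?ImM cabs_def sqr_sqrtr ?addr_ge0 ?sqr_ge0//;
  case: (z) => a b /=; ring.
have czu : (cabs z)%:C%C = u * z.
  rewrite /u mulrAC [_ * z]mulrC cz expr2 rmorphM/= mulfK//.
  by apply: contra z0 => /eqP/(congr1 (@complex.Re R))/= ->.
have u1 : cabs u = 1.
  have := congr1 (@cabs R) czu; rewrite cabsM cabs_real ger0_norm ?cabs_ge0//.
  by move=> /(congr1 (fun t => t / cabs z)); rewrite mulfK// divff.
have -> : cabs z = \int[mu]_x complex.Re (u * f x).
  have -> : cabs z = complex.Re (u * z) by rewrite -czu.
  by rewrite /z -cintZ.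
have [h1 _] := cintegrableZ u fi.
rewrite /Rintegral fineK; last exact: (integrable_fin_num _ h1).
apply: (le_trans (y := (\int[mu]_x `|complex.Re (u * f x)|%:E)%E)).
  apply: le_integral => //; first exact: integrable_norm.
  by move=> x _; rewrite lee_fin ler_norm.
apply: ge0_le_integral => //.
- by apply/measurable_EFinP; apply: measurableT_comp => //;
    have /measurable_int/measurable_EFinP := h1.
- by apply: cmeas_cabse; exact: cintegrable_meas.
- by move=> x _; rewrite lee_fin (le_trans (Re_le_cabs _))// cabsM u1 mul1r.
Qed.

Lemma eq_cint f g : f =1 g -> cint_on f = cint_on g.
Proof. by move=> /funext ->. Qed.

Lemma cintegrable_bounded_mul f g (M : R) : cintegrable_on f -> cmeas g ->
  (forall x, cabs (g x) <= M) -> cintegrable_on (fun x => f x * g x).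
Proof.
move=> fi mg gM; have mf := cintegrable_meas fi.
apply: (le_cintegrable (g := fun x => M * cabs (f x))).
- exact: cmeasM.
- exact: (integrableZl _ M (cintegrable_cabs fi)).
- by move=> x; rewrite cabsM mulrC ler_wpM2r// cabs_ge0.
Qed.

Lemma cintegrable_indic f (A : set T) : cintegrable_on f -> measurable A ->
  cintegrable_on (fun x => f x * (\1_A x)%:C%C).
Proof.
move=> fi mA; apply: (@cintegrable_bounded_mul _ _ 1) => //.
  by apply: cmeas_real; exact: measurable_indic.
by move=> x; rewrite cabs_real indicE ger0_norm// lern1; case: (_ \in _).
Qed.

End complex_integral.

Lemma cmeas_comp {R : realType} d d' (T : measurableType d) (T' : measurableType d')
  (f : T' -> R[i]) (h : T -> T') : measurable_fun setT h -> cmeas f ->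
  cmeas (fun x => f (h x)).
Proof.
by move=> mh [f1 f2]; split; [exact: (measurableT_comp f1)|exact: (measurableT_comp f2)].
Qed.

(** An integrable extended-real function is finite almost everywhere, so passing to
    its finite part changes neither integrability nor the integral. *)
Lemma integrable_fine {R : realType} d (T : measurableType d)
    (m : {measure set T -> \bar R}) (F : T -> \bar R) :
  m.-integrable setT F ->
  m.-integrable setT (EFin \o (fun x => fine (F x))) /\
  (\int[m]_x (fine (F x))%:E = \int[m]_x F x)%E.
Proof.
move=> Fi; have mF := measurable_int m Fi.
have mfF : measurable_fun setT (fun x => (fine (F x))%:E).
  by apply/measurable_EFinP; apply: measurableT_comp.
have aeF : ae_eq m setT (fun x => (fine (F x))%:E) F.
  have := integrable_ae measurableT Fi; apply: filterS => x /= H _.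
  by rewrite fineK// H.
split; last by apply: ae_eq_integral.
apply/integrableP; split => //.
move/integrableP : Fi => [_]; apply: le_lt_trans.
rewrite le_eqVlt; apply/orP; left; apply/eqP; apply: ae_eq_integral => //.
- exact: measurableT_comp.
- exact: measurableT_comp.
- by apply: filterS aeF => x H Dx; rewrite /= -H.
Qed.

Section fubini_complex.
Context {R : realType} d1 d2 (T1 : measurableType d1) (T2 : measurableType d2).
Variables (m1 : {sigma_finite_measure set T1 -> \bar R})
          (m2 : {sigma_finite_measure set T2 -> \bar R}).

Lemma Rfubini_integrable (f : T1 * T2 -> R) :
  (m1 \x m2)%E.-integrable setT (EFin \o f) ->
  m1.-integrable setT (EFin \o (fun x => \int[m2]_y f (x, y))) /\
  \int[m1]_x \int[m2]_y f (x, y) = fine (\int[m1 \x m2]_z (f z)%:E)%E.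
Proof.
move=> fi; have [h1 h2] := integrable_fine (integrable_fubini_F fi).
split; first exact: h1.
by rewrite {1}/Rintegral [X in fine X]h2 integral12_prod_meas1.
Qed.

End fubini_complex.

Section fubini_complex2.
Context {R : realType} d1 d2 (T1 : measurableType d1) (T2 : measurableType d2).
Variables (m1 : {sigma_finite_measure set T1 -> \bar R})
          (m2 : {sigma_finite_measure set T2 -> \bar R}).

Lemma Rfubini (f : T1 * T2 -> R) :
  (m1 \x m2)%E.-integrable setT (EFin \o f) ->
  \int[m1]_x \int[m2]_y f (x, y) = \int[m2]_y \int[m1]_x f (x, y).
Proof.
move=> fi; have [_ ->] := Rfubini_integrable fi.
have /integrableP[mf _] := fi.
have fsi : (m2 \x m1)%E.-integrable setT (EFin \o (fun p => f (p.2, p.1))).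
  apply/integrable12ltyP.
    apply: (measurableT_comp (f := EFin \o f) mf (g := fun p : T2 * T1 => (p.2, p.1))).
    by apply: measurable_fun_pair; [exact: measurable_snd|exact: measurable_fst].
  exact: (integrable21ltyP m1 m2 mf).1 fi.
have [_] := Rfubini_integrable fsi; rewrite /= => ->.
rewrite -integral12_prod_meas1// -integral21_prod_meas1//.
Qed.

Lemma cfubini (f : T1 * T2 -> R[i]) : cintegrable_on (m1 \x m2)%E f ->
  cint_on m1 (fun x => cint_on m2 (fun y => f (x, y))) =
  cint_on m2 (fun y => cint_on m1 (fun x => f (x, y))).
Proof.
move=> [f1 f2]; rewrite /cint_on/=.
by congr (_ +i* _)%C; [exact: (Rfubini f1)|exact: (Rfubini f2)].
Qed.

Lemma cintegrable_cint (f : T1 * T2 -> R[i]) : cintegrable_on (m1 \x m2)%E f ->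
  cintegrable_on m1 (fun x => cint_on m2 (fun y => f (x, y))).
Proof.
move=> [f1 f2]; split; [exact: (Rfubini_integrable f1).1|].
exact: (Rfubini_integrable f2).1.
Qed.

Lemma cintegrable_prodP (f : T1 * T2 -> R[i]) : cmeas f ->
  (\int[m1]_x \int[m2]_y (cabs (f (x, y)))%:E < +oo)%E ->
  cintegrable_on (m1 \x m2)%E f.
Proof.
move=> mf fy; apply/cintegrableP; split => //.
have := @fubini_tonelli1 _ _ _ _ _ m1 m2 (fun z => (cabs (f z))%:E) (cmeas_cabse mf).
by move=> -> // x; rewrite lee_fin cabs_ge0.
Qed.

Lemma measurable_int_section (f : T1 * T2 -> \bar R) : measurable_fun setT f ->
  (forall z, 0 <= f z)%E -> measurable_fun setT (fun x => \int[m2]_y f (x, y))%E.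
Proof. by move=> mf f0; exact: measurable_fun_fubini_tonelli_F. Qed.

End fubini_complex2.

Section cint_leb.
Context {R : realType} {N : nat}.
Notation V := 'rV[R]_N.
Notation leb := (lebesgue_rV (R := R) N).
Implicit Types (f g : V -> R[i]).

Lemma cint_comp_scaled (T : V -> V) (k : R) f :
  0 <= k -> measurable_fun setT T ->
  (forall g : V -> \bar R, measurable_fun setT g -> (forall x, 0 <= g x)%E ->
    (\int[leb]_x g (T x) = k%:E * \int[leb]_x g x)%E) ->
  cintegrable f -> cintegrable (f \o T) /\ cint (f \o T) = k%:C%C * cint f.
Proof.
move=> k0 mT Tg [f1 f2].
have [g1 e1] := integral_comp_scaled k0 mT Tg f1.
have [g2 e2] := integral_comp_scaled k0 mT Tg f2.
split; first by split.
have F1 := integrable_fin_num measurableT f1.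
have F2 := integrable_fin_num measurableT f2.
by apply: complex_eta; rewrite ?ReM ?ImM /= ?mul0r ?subr0 ?addr0 /Rintegral
  ?[X in fine X = _]e1 ?[X in fine X = _]e2 fineM.
Qed.

Lemma cint_affine (s : R) (b : V) f : 0 < s -> cintegrable f ->
  cintegrable (fun x => f (s *: x + b)) /\
  cint (fun x => f (s *: x + b)) = (s ^- N)%:C%C * cint f.
Proof.
move=> s0 fi; apply: (@cint_comp_scaled (affine s b)) => //.
- by rewrite invr_ge0 exprn_ge0// ltW.
- exact: measurable_affine.
- by move=> g mg g0; exact: ge0_integral_affine.
Qed.

Lemma cint_reflect (b : V) f : cintegrable f ->
  cintegrable (fun x => f (b - x)) /\ cint (fun x => f (b - x)) = cint f.
Proof.
move=> fi; have [|||i e] := @cint_comp_scaled (reflect_at b) 1 f _ _ _ fi => //.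
- exact: measurable_reflect.
- by move=> g mg g0; rewrite mul1e ge0_integral_reflect.
by split => //; rewrite [LHS]e mul1r.
Qed.

Lemma cint_shift (b : V) f : cintegrable f ->
  cintegrable (fun x => f (x + b)) /\ cint (fun x => f (x + b)) = cint f.
Proof.
move=> /(@cint_affine 1 b f ltr01) [i e].
have E : (fun x => f (1 *: x + b)) = (fun x => f (x + b)).
  by apply/funext => x; rewrite scale1r.
by rewrite -E; split => //; rewrite e expr1n invr1 mul1r.
Qed.

Lemma ge0_integral_shift (b : V) (f : V -> \bar R) :
  measurable_fun setT f -> (forall x, 0 <= f x)%E ->
  (\int[leb]_x f (x + b)%R = \int[leb]_x f x)%E.
Proof.
move=> mf f0; rewrite -[RHS]mul1e -[X in (X%:E * _)%E]invr1 -(expr1n _ N).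
rewrite -(ge0_integral_affine b)//.
by apply: eq_integral => x _; rewrite /affine scale1r.
Qed.

Lemma measurable_subV : measurable_fun setT (fun p : V * V => p.1 - p.2).
Proof.
apply: measurable_fun_coordP => i; under eq_fun do rewrite !mxE.
by apply: measurable_funB; apply: (measurableT_comp (measurable_coord i)).
Qed.

Lemma measurable_scaleV (s : R) : measurable_fun setT (fun p : V => s *: p).
Proof.
apply: measurable_fun_coordP => i; under eq_fun do rewrite !mxE.
by apply: measurable_funM => //; exact: measurable_coord.
Qed.

Lemma measurable_shiftV (b : V) : measurable_fun setT (fun p : V => p + b).
Proof.
apply: measurable_fun_coordP => i; under eq_fun do rewrite !mxE.
by apply: measurable_funD => //; exact: measurable_coord.
Qed.

End cint_leb.

(** * Convolution *)

Section convolution.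
Context {R : realType} {N : nat}.
Notation V := 'rV[R]_N.
Notation leb := (lebesgue_rV (R := R) N).
Implicit Types (f g h K : V -> R[i]) (x y : V).

(** The [L^1] norm as an extended real, and as a real for integrable functions. *)
Definition L1e f : \bar R := (\int[leb]_x (cabs (f x))%:E)%E.

Lemma L1e_ge0 f : (0 <= L1e f)%E.
Proof. by apply: integral_ge0 => x _; rewrite lee_fin cabs_ge0. Qed.

Lemma cintegrable_lty f : cintegrable f -> (L1e f < +oo)%E.
Proof. by move=> /(cintegrableP leb)[_]. Qed.

Lemma L1e_fin f : cintegrable f -> L1e f \is a fin_num.
Proof. by move=> fi; rewrite ge0_fin_numE ?L1e_ge0// cintegrable_lty. Qed.

Definition L1n f : R := fine (L1e f).

Lemma L1n_ge0 f : 0 <= L1n f.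
Proof. by rewrite fine_ge0// L1e_ge0. Qed.

Lemma L1eE f : cintegrable f -> L1e f = (L1n f)%:E.
Proof. by move=> fi; rewrite fineK// L1e_fin. Qed.

Lemma cabs_cint_le_L1n f : cintegrable f -> cabs (cint f) <= L1n f.
Proof. by move=> fi; rewrite -lee_fin -L1eE//; exact: cabs_cint. Qed.

Lemma cmeas_reflect x f : cmeas f -> cmeas (fun y => f (x - y)).
Proof. by apply: cmeas_comp; exact: (measurable_reflect x). Qed.

Lemma cmeas_shift x f : cmeas f -> cmeas (fun y => f (y + x)).
Proof. by apply: cmeas_comp; exact: (measurable_shiftV x). Qed.

Lemma convol_section_integrable K f (M : R) x : cmeas K ->
  (forall y, cabs (K y) <= M) -> cintegrable f ->
  cintegrable (fun y => K (x - y) * f y).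
Proof.
move=> mK KM fi; under eq_fun do rewrite mulrC.
apply: (@cintegrable_bounded_mul _ _ _ _ _ _ M) => //; exact: cmeas_reflect.
Qed.

Lemma ge0_integral_cabsZ f (M : R) : 0 <= M -> cmeas f ->
  (\int[leb]_x (M * cabs (f x))%:E = M%:E * L1e f)%E.
Proof.
move=> M0 mf; rewrite /L1e -ge0_integralZl_EFin//.
- by move=> x _; rewrite lee_fin cabs_ge0.
- exact: cmeas_cabse.
Qed.

Lemma cabs_cint_le f (g : V -> R) : cintegrable f -> measurable_fun setT g ->
  (forall x, cabs (f x) <= g x) -> ((cabs (cint f))%:E <= \int[leb]_x (g x)%:E)%E.
Proof.
move=> fi mg fg; apply: (le_trans (cabs_cint fi)).
apply: ge0_le_integral => //.
- by move=> x _; rewrite lee_fin cabs_ge0.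
- exact/cmeas_cabse/(cintegrable_meas fi).
- exact/measurable_EFinP.
- by move=> x _; rewrite lee_fin.
Qed.

Lemma cabs_cint_bounded_mul f h (M : R) : 0 <= M -> cintegrable f ->
  cintegrable h -> (forall y, cabs (h y) <= M * cabs (f y)) ->
  cabs (cint h) <= M * L1n f.
Proof.
move=> M0 fi hi hM; rewrite -lee_fin EFinM -L1eE// -ge0_integral_cabsZ//; last first.
  exact: cintegrable_meas fi.
apply: cabs_cint_le => //; apply: measurable_funM => //.
exact/cmeas_cabs/(cintegrable_meas fi).
Qed.

Lemma cabs_convol_bounded K f (M : R) x : cmeas K ->
  (forall y, cabs (K y) <= M) -> cintegrable f ->
  cabs (convol K f x) <= M * L1n f.
Proof.
move=> mK KM fi; have M0 : 0 <= M by rewrite (le_trans _ (KM 0))// cabs_ge0.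
apply: cabs_cint_bounded_mul => //; first exact: convol_section_integrable KM fi.
by move=> y; rewrite cabsM ler_wpM2r// cabs_ge0.
Qed.

Lemma convolC_at f g x : cintegrable (fun y => f (x - y) * g y) ->
  convol f g x = convol g f x.
Proof.
rewrite /convol => /(cint_reflect x)[_ <-]; apply: (@eq_cint _ _ _ leb) => y.
by rewrite subKr mulrC.
Qed.

Lemma cmeas_diff f : cmeas f -> cmeas (fun p : V * V => f (p.1 - p.2)).
Proof. by apply: cmeas_comp; exact: measurable_subV. Qed.

Lemma cmeas_fst f : cmeas f -> cmeas (fun p : V * V => f p.1).
Proof. by apply: cmeas_comp; exact: measurable_fst. Qed.

Lemma cmeas_snd f : cmeas f -> cmeas (fun p : V * V => f p.2).
Proof. by apply: cmeas_comp; exact: measurable_snd. Qed.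

Lemma ge0_integral_shift_cabs f (b : V) : cmeas f ->
  (\int[leb]_x (cabs (f (x + b)))%:E = L1e f)%E.
Proof.
move=> mf; rewrite (ge0_integral_shift b (f := fun x => (cabs (f x))%:E))//.
  exact: cmeas_cabse.
by move=> x; rewrite lee_fin cabs_ge0.
Qed.

Lemma integral_conv_tonelli f g : cmeas f -> cmeas g ->
  (\int[leb]_x \int[leb]_y (cabs (f (x - y) * g y))%:E = L1e f * L1e g)%E.
Proof.
move=> mf mg.
have m1 : cmeas (fun p : V * V => f (p.1 - p.2) * g p.2).
  by apply: cmeasM; [exact: cmeas_diff|exact: cmeas_snd].
rewrite (@fubini_tonelli _ _ _ _ _ leb leb
  (fun p : V * V => (cabs (f (p.1 - p.2) * g p.2))%:E))/=; last first.
- by move=> p; rewrite lee_fin cabs_ge0.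
- exact: cmeas_cabse.
transitivity (\int[leb]_y (L1e f * (cabs (g y))%:E))%E.
  apply: eq_integral => y _.
  under eq_integral do rewrite cabsM mulrC EFinM.
  rewrite ge0_integralZl_EFin//; last exact: cabs_ge0.
  - by rewrite ge0_integral_shift_cabs// muleC.
  - by move=> x _; rewrite lee_fin cabs_ge0.
  - by apply: cmeas_cabse; exact: cmeas_shift.
rewrite ge0_integralZl//.
- exact: cmeas_cabse.
- by move=> x _; rewrite lee_fin cabs_ge0.
- exact: L1e_ge0.
Qed.

Lemma cintegrable_conv_prod f g : cintegrable f -> cintegrable g ->
  cintegrable_on (leb \x leb)%E (fun p : V * V => f (p.1 - p.2) * g p.2).
Proof.
move=> fi gi; have mf := cintegrable_meas fi; have mg := cintegrable_meas gi.
apply: cintegrable_prodP.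
  by apply: cmeasM; [exact: cmeas_diff|exact: cmeas_snd].
rewrite /= integral_conv_tonelli//.
by rewrite !L1eE// -EFinM ltry.
Qed.

Lemma cintegrable_tensor f g : cintegrable f -> cintegrable g ->
  cintegrable_on (leb \x leb)%E (fun p : V * V => f p.1 * g p.2).
Proof.
move=> fi gi; have mf := cintegrable_meas fi; have mg := cintegrable_meas gi.
apply: cintegrable_prodP.
  by apply: cmeasM; [exact: cmeas_fst|exact: cmeas_snd].
rewrite /=; under eq_integral => x _.
  under eq_integral do rewrite cabsM EFinM.
  rewrite ge0_integralZl_EFin//; [|by move=> y _; rewrite lee_fin cabs_ge0|
    exact: cmeas_cabse|exact: cabs_ge0].
  rewrite -/(L1e g); over.
rewrite ge0_integralZr// ?L1e_ge0//.
- by rewrite -/(L1e f) !L1eE// -EFinM ltry.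
- exact: cmeas_cabse.
- by move=> x _; rewrite lee_fin cabs_ge0.
Qed.

(** Young's inequality for two integrable functions. *)
Lemma cintegrable_convol f g : cintegrable f -> cintegrable g ->
  cintegrable (convol f g) /\ L1n (convol f g) <= L1n f * L1n g.
Proof.
move=> fi gi; have cp := cintegrable_conv_prod fi gi.
have ci : cintegrable (convol f g) := cintegrable_cint cp.
split => //; have mf := cintegrable_meas fi; have mg := cintegrable_meas gi.
rewrite -lee_fin EFinM -!L1eE// -integral_conv_tonelli//.
have m1 : cmeas (fun p : V * V => f (p.1 - p.2) * g p.2).
  by apply: cmeasM; [exact: cmeas_diff|exact: cmeas_snd].
have mi : measurable_fun setT
    (fun x => \int[leb]_y (cabs (f (x - y) * g y))%:E)%E.
  apply: (@measurable_int_section _ _ _ _ _ leb (fun p : V * V => (cabs (f (p.1 - p.2) * g p.2))%:E)).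
    exact: cmeas_cabse.
  by move=> p; rewrite lee_fin cabs_ge0.
apply: ge0_le_integral => //.
- by move=> x _; rewrite lee_fin cabs_ge0.
- exact/cmeas_cabse/(cintegrable_meas ci).
move=> x _; have [fxi|nfxi] := pselect (cintegrable (fun y => f (x - y) * g y)).
  exact: cabs_cint.
(* where the section is not integrable the right-hand side is infinite *)
suff -> : (\int[leb]_y (cabs (f (x - y) * g y))%:E = +oo)%E by rewrite leey.
apply/eqP; rewrite eq_le leey/= leNgt; apply/negP => lty; apply: nfxi.
by apply/(cintegrableP leb); split => //; apply: cmeasM => //; exact: cmeas_reflect.
Qed.

(** Associativity, in the form in which a bounded kernel [K] ends up applied to
    the second factor. *)
Lemma convolA K g h (M : R) x : cmeas K -> (forall y, cabs (K y) <= M) ->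
  cintegrable g -> cintegrable h ->
  (forall y, cintegrable (fun z => g (y - z) * h z)) ->
  convol K (convol g h) x = cint (fun w => convol K h (x - w) * g w).
Proof.
move=> mK KM gi hi si; have mg := cintegrable_meas gi; have mh := cintegrable_meas hi.
pose F (p : V * V) : R[i] := (g (p.1 - p.2) * h p.2) * K (x - p.1).
have Fi : cintegrable_on (leb \x leb)%E F.
  apply: (@cintegrable_bounded_mul _ _ _ _ _ _ M).
  - exact: cintegrable_conv_prod.
  - exact: (cmeas_fst (cmeas_reflect x mK)).
  - by move=> p; exact: KM.
pose G (p : V * V) : R[i] := (h p.1 * g p.2) * K (x - p.1 - p.2).
have Gi : cintegrable_on (leb \x leb)%E G.
  apply: (@cintegrable_bounded_mul _ _ _ _ _ _ M).
  - exact: cintegrable_tensor.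
  - apply: (cmeas_comp (f := K)) => //.
    apply: (measurableT_comp (f := fun p : V * V => p.1 - p.2) measurable_subV
      (g := fun p : V * V => (x - p.1, p.2))).
    apply: measurable_fun_pair; last exact: measurable_snd.
    exact: (measurableT_comp (measurable_reflect x) measurable_fst).
  - by move=> p; exact: KM.
transitivity (cint (fun y => cint (fun z => F (y, z)))).
  apply: (@eq_cint _ _ _ leb) => y; rewrite /F/=.
  rewrite [RHS](_ : _ = cint (fun z => K (x - y) * (g (y - z) * h z))).
    exact/esym/(cintZ (K (x - y)) (si y)).
  by apply: (@eq_cint _ _ _ leb) => z; rewrite mulrC.
transitivity (cint (fun z => cint (fun y => F (y, z)))); first exact: (cfubini Fi).
transitivity (cint (fun z => cint (fun w => G (z, w)))).
  apply: (@eq_cint _ _ _ leb) => z.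
  have Fzi : cintegrable (fun y => F (y, z)).
    rewrite /F/=; apply: (@cintegrable_bounded_mul _ _ _ _ _ _ M).
    - apply: (@cintegrable_bounded_mul _ _ _ _ _ _ (cabs (h z))) => //.
      exact: (cint_shift (- z) gi).1.
    - exact: cmeas_reflect.
    - by move=> y; exact: KM.
  have [_ <-] := cint_shift z Fzi; apply: (@eq_cint _ _ _ leb) => w.
  by rewrite /F/G/= addrK -addrA -opprD (addrC z w) [h z * _]mulrC.
transitivity (cint (fun w => cint (fun z => G (z, w)))); first exact: (cfubini Gi).
apply: (@eq_cint _ _ _ leb) => w; rewrite /convol mulrC.
rewrite -[RHS](cintZ (mu := leb)); last exact: convol_section_integrable KM hi.
apply: (@eq_cint _ _ _ leb) => z; rewrite /G/= (addrAC x).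
by ring.
Qed.

(** The convolution of [|g|] with a nonnegative extended-real function. *)
Definition econv g (F : V -> \bar R) : V -> \bar R :=
  fun x => (\int[leb]_w ((cabs (g w))%:E * F (x - w)%R))%E.

Lemma measurable_econv_prod g (F : V -> \bar R) : cmeas g -> measurable_fun setT F ->
  measurable_fun setT (fun p : V * V => (cabs (g p.2))%:E * F (p.1 - p.2)%R)%E.
Proof.
move=> mg mF; apply: emeasurable_funM.
  by apply: cmeas_cabse; exact: cmeas_snd.
exact: (measurableT_comp mF measurable_subV).
Qed.

Lemma econv_ge0 g (F : V -> \bar R) x : (forall x, 0 <= F x)%E -> (0 <= econv g F x)%E.
Proof. by move=> F0; apply: integral_ge0 => w _; rewrite mule_ge0// lee_fin cabs_ge0. Qed.

Lemma measurable_econv g (F : V -> \bar R) : cmeas g -> measurable_fun setT F ->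
  (forall x, 0 <= F x)%E -> measurable_fun setT (econv g F).
Proof.
move=> mg mF F0.
apply: (@measurable_int_section _ _ _ _ _ leb (fun p : V * V => (cabs (g p.2))%:E * F (p.1 - p.2)%R)%E).
  exact: measurable_econv_prod.
by move=> p; rewrite mule_ge0// lee_fin cabs_ge0.
Qed.

Lemma integral_econv g (F : V -> \bar R) : cmeas g -> measurable_fun setT F ->
  (forall x, 0 <= F x)%E ->
  (\int[leb]_x econv g F x = L1e g * \int[leb]_x F x)%E.
Proof.
move=> mg mF F0; rewrite /econv.
rewrite (@fubini_tonelli _ _ _ _ _ leb leb
  (fun p : V * V => (cabs (g p.2))%:E * F (p.1 - p.2)%R)%E)/=; last 2 first.
- exact: measurable_econv_prod.
- by move=> p; rewrite mule_ge0// lee_fin cabs_ge0.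
rewrite -ge0_integralZr//.
- apply: eq_integral => w _; rewrite ge0_integralZl_EFin ?cabs_ge0//.
    by rewrite ge0_integral_shift.
  exact: (measurableT_comp mF (measurable_shiftV (- w))).
- exact: cmeas_cabse.
- by move=> x _; rewrite lee_fin cabs_ge0.
- exact: integral_ge0.
Qed.

Lemma le_econv g (F G : V -> \bar R) x : cmeas g -> measurable_fun setT F ->
  measurable_fun setT G ->
  (forall x, 0 <= F x)%E -> (forall w, (g w != 0)%R -> F (x - w)%R <= G (x - w)%R)%E ->
  (econv g F x <= econv g G x)%E.
Proof.
move=> mg mF mG F0 FG.
have ms (H : V -> \bar R) : measurable_fun setT H ->
    measurable_fun setT (fun w => (cabs (g w))%:E * H (x - w)%R)%E.
  move=> mH; apply: emeasurable_funM; first exact: cmeas_cabse.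
  exact: (measurableT_comp mH (measurable_reflect x)).
apply: ge0_le_integral => //; [|exact: ms|exact: ms|].
  by move=> w _; rewrite mule_ge0// lee_fin cabs_ge0.
move=> w _; have [->|gw] := eqVneq (g w) 0; first by rewrite cabs0 !mul0e.
by rewrite lee_wpmul2l ?FG// lee_fin cabs_ge0.
Qed.

(** ** Dilations *)

Lemma dilate_integrable (s : R) f : 0 < s -> cintegrable f ->
  cintegrable (dilate s f) /\ cint (dilate s f) = cint f.
Proof.
move=> s0 fi; have s1 : 0 < s^-1 by rewrite invr_gt0.
have [i e] := cint_affine 0 s1 fi.
have E : (fun x => f (s^-1 *: x + 0)) = (fun x => f (s^-1 *: x)).
  by apply/funext => x; rewrite addr0.
rewrite E in i e; split; first exact: (cintegrableZ _ i).
rewrite [LHS](cintZ _ i) [X in _ * X]e mulrA -rmorphM/= exprVn invrK mulVf ?mul1r//.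
by rewrite expf_neq0// gt_eqF.
Qed.

Lemma dilate_meas (s : R) f : cmeas f -> cmeas (dilate s f).
Proof.
move=> mf; apply: cmeasM; first exact: cmeas_cst.
exact: cmeas_comp (measurable_scaleV _) mf.
Qed.

Lemma cabs_dilate (s : R) f x : 0 < s ->
  cabs (dilate s f x) = s ^- N * cabs (f (s^-1 *: x)).
Proof.
by move=> s0; rewrite cabsM cabs_real ger0_norm// invr_ge0 exprn_ge0// ltW.
Qed.

Lemma cabs_dilate_le (s : R) f (M : R) x : 0 < s -> (forall y, cabs (f y) <= M) ->
  cabs (dilate s f x) <= s ^- N * M.
Proof.
by move=> s0 fM; rewrite cabs_dilate// ler_wpM2l// invr_ge0 exprn_ge0// ltW.
Qed.

Lemma L1e_dilate (s : R) f : 0 < s -> cmeas f -> L1e (dilate s f) = L1e f.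
Proof.
move=> s0 mf; have s1 : 0 < s^-1 by rewrite invr_gt0.
have sN : 0 <= s ^- N by rewrite invr_ge0 exprn_ge0// ltW.
rewrite /L1e; under eq_integral do rewrite cabs_dilate//.
rewrite (ge0_integral_cabsZ (f := fun x => f (s^-1 *: x)))//; last first.
  exact: cmeas_comp (measurable_scaleV _) mf.
rewrite /L1e; have := ge0_integral_affine 0 s1 (cmeas_cabse mf).
rewrite /affine; under eq_integral do rewrite addr0.
move=> -> //; last by move=> x; rewrite lee_fin cabs_ge0.
by rewrite muleA -EFinM exprVn invrK mulVf ?mul1e// expf_neq0// gt_eqF.
Qed.

Lemma L1n_dilate (s : R) f : 0 < s -> cmeas f -> L1n (dilate s f) = L1n f.
Proof. by move=> s0 mf; rewrite /L1n L1e_dilate. Qed.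

End convolution.

(** * Radial weights and Schwartz functions *)

Section radial_weights.
Context {R : realType} {N : nat}.
Notation V := 'rV[R]_N.
Notation leb := (lebesgue_rV (R := R) N).

Lemma measurable_indic_ball (r : R) (c : R) :
  measurable_fun setT (fun x : V => (c * \1_(ball (0 : V) r) x)%:E).
Proof.
apply/measurable_EFinP; apply: measurable_funM => //.
by apply: measurable_indic; exact: measurable_rV_ball.
Qed.

Lemma integral_indic_ball (r : R) (c : R) : 0 < r -> 0 <= c ->
  (\int[leb]_x (c * \1_(ball (0 : V) r) x)%:E = (c * (r *+ 2) ^+ N)%:E)%E.
Proof.
move=> r0 c0; under eq_integral do rewrite EFinM.
rewrite ge0_integralZl_EFin//; last first.
  by apply/measurable_EFinP; apply: measurable_indic; exact: measurable_rV_ball.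
rewrite integral_indic// ?setIT; last exact: measurable_rV_ball.
by rewrite EFinM; congr (_ * _)%E; exact: leb_ball.
Qed.

(** A nonnegative function dominated by a superposition of balls whose total mass
    is controlled by a geometric series has a finite integral. *)
Lemma integral_le_shells (F : V -> R) (c r : nat -> R) (K : R) :
  measurable_fun setT F -> (forall x, 0 <= F x) ->
  (forall k, 0 <= c k) -> (forall k, 0 < r k) -> 0 <= K ->
  (forall k, c k * (r k *+ 2) ^+ N <= K / (2 ^ k.+1)%:R) ->
  (forall x, exists n, F x <= \sum_(0 <= k < n) c k * \1_(ball (0 : V) (r k)) x) ->
  (\int[leb]_x (F x)%:E <= K%:E)%E.
Proof.
move=> mF F0 c0 r0 K0 cr FS.
apply: (le_trans (y := (\int[leb]_x
    (\sum_(0 <= k <oo) (c k * \1_(ball (0 : V) (r k)) x)%:E)%E)%E)).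
  apply: ge0_le_integral => //.
  - by move=> x _; rewrite lee_fin.
  - exact/measurable_EFinP.
  - apply: ge0_emeasurable_sum => [k x _ _|k _].
      by rewrite lee_fin mulr_ge0.
    exact: measurable_indic_ball.
  - move=> x _; have [n Fn] := FS x.
    apply: (le_trans _ (nneseries_lim_ge n _)); last first.
      by move=> k _ _; rewrite lee_fin mulr_ge0.
    by rewrite sumEFin lee_fin.
rewrite integral_nneseries//; last 2 first.
- by move=> k; exact: measurable_indic_ball.
- by move=> k x _; rewrite lee_fin mulr_ge0.
apply: (le_trans _ (epsilon_trick0 xpredT K0)).
apply: lee_nneseries => [k _ _|k _].
  by apply: integral_ge0 => x _; rewrite lee_fin mulr_ge0.
by rewrite integral_indic_ball// lee_fin.
Qed.

Lemma ball0E (r : R) (x : V) : (ball (0 : V) r x) = (`|x| < r).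
Proof. by rewrite -ball_normE /= sub0r normrN. Qed.

Lemma indic_ball1 (r : R) (x : V) : `|x| < r -> \1_(ball (0 : V) r) x = 1 :> R.
Proof. by move=> xr; rewrite indicE mem_set// ball0E. Qed.

Lemma exists_pow2_gt (t : R) : exists n : nat, t < 2 ^+ n.
Proof.
exists (Num.truncn t).+1; apply: (lt_trans (truncnS_gt t)).
by rewrite -natrX ltr_nat ltn_expl.
Qed.

(** The radial weight [(1 + |x|) ^ - n], for the max norm. *)
Definition weight (n : nat) (x : V) : R := (1 + `|x|) ^- n.

Lemma weight_ge0 n x : 0 <= weight n x.
Proof. by rewrite /weight invr_ge0 exprn_ge0// addr_ge0. Qed.

Lemma measurable_weight n : measurable_fun setT (weight n).
Proof.
have mi : measurable_fun setT (fun t : R => (1 + `|t|)^-1).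
  apply: continuous_measurable_fun => t; apply: cvgV.
    by rewrite gt_eqF// ltr_pwDl.
  by apply: cvgD; [exact: cvg_cst|exact: norm_continuous].
rewrite (_ : weight n = (fun x => ((1 + `| `|x| |)^-1) ^+ n)); last first.
  by apply/funext => x; rewrite /weight normr_id exprVn.
apply: measurable_funX; exact: (measurableT_comp mi measurable_rV_norm).
Qed.

Lemma weight_le1 n x : weight n x <= 1.
Proof. by rewrite /weight invf_le1 ?exprn_gt0 ?ltr_pwDl// exprn_ege1// lerDl. Qed.

Lemma weightS n x : weight n.+1 x * (1 + `|x|) = weight n x.
Proof.
by rewrite /weight exprS invfM mulrAC mulVf ?mul1r// gt_eqF// ltr_pwDl.
Qed.

Lemma weight_le n m x : (n <= m)%N -> weight m x <= weight n x.
Proof.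
move=> nm; rewrite /weight lef_pV2 ?posrE ?exprn_gt0 ?ltr_pwDl//.
by rewrite ler_weXn2l// lerDl.
Qed.

(** An upper bound for [weight N.+1] where [2 ^ k <= 2 * |x|]. *)
Definition shell_coef (k : nat) : R := 2 ^+ N.+1 / (2 ^+ k) ^+ N.+1.

Lemma shell_coef_ge0 k : 0 <= shell_coef k.
Proof. by rewrite divr_ge0 ?exprn_ge0. Qed.

Lemma weight_le_shells n x : `|x| < 2 ^+ n ->
  weight N.+1 x <= \sum_(0 <= k < n.+1) shell_coef k * \1_(ball (0 : V) (2 ^+ k)) x.
Proof.
elim: n => [|n IH] xn.
  rewrite big_nat1 indic_ball1// mulr1 (le_trans (weight_le1 _ _))//.
  by rewrite /shell_coef expr0 expr1n divr1 exprn_ege1// ler1n.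
rewrite big_nat_recr//=; have [/IH H|nx] := ltP `|x| (2 ^+ n).
  by rewrite ler_wpDr// mulr_ge0// shell_coef_ge0.
rewrite indic_ball1// mulr1 ler_wpDl//.
  by apply: sumr_ge0 => k _; rewrite mulr_ge0// shell_coef_ge0.
rewrite /shell_coef -expr_div_n /weight -exprVn.
rewrite ler_pXn2r ?nnegrE ?invr_ge0 ?divr_ge0 ?addr_ge0 ?exprn_ge0//.
rewrite (exprS 2 n) invfM mulrA divff// mul1r lef_pV2 ?posrE ?exprn_gt0 ?ltr_pwDl//.
by rewrite (le_trans nx)// lerDr.
Qed.

Lemma weight_le_outside n x : 2 ^+ n <= `|x| -> weight N.+1 x <= (2 ^+ n) ^- N.+1.
Proof.
move=> nx; rewrite /weight lef_pV2 ?posrE ?exprn_gt0 ?ltr_pwDl//.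
by rewrite lerXn2r ?nnegrE ?addr_ge0 ?exprn_ge0// (le_trans nx)// lerDr.
Qed.

(** [weight (N + 1)] is the borderline weight that decays one power faster than
    the volume grows. *)
Lemma integrable_weight : leb.-integrable setT (EFin \o weight N.+1).
Proof.
apply/integrableP; split; first by apply/measurable_EFinP; exact: measurable_weight.
under eq_integral => x _ do rewrite /= ger0_norm ?weight_ge0//.
apply: le_lt_trans (ltry (2 ^+ N.+1 * 2 ^+ N * 2 : R)).
apply: (@integral_le_shells _ shell_coef (fun k => 2 ^+ k)).
- exact: measurable_weight.
- by move=> x; exact: weight_ge0.
- exact: shell_coef_ge0.
- by move=> k; rewrite exprn_gt0.
- by rewrite !mulr_ge0 ?exprn_ge0.
- move=> k; rewrite natrX -(mulr_natl (2 ^+ k)) exprMn /shell_coef.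
  have k0 : (2 : R) ^+ k != 0 by rewrite expf_neq0.
  rewrite (exprS (2 ^+ k) N) (exprS 2 k) le_eqVlt; apply/orP; left; apply/eqP.
  by field; rewrite k0 expf_neq0.
- by move=> x; have [n xn] := exists_pow2_gt `|x|; exists n.+1; exact: weight_le_shells.
Qed.

(** Local integrability of the logarithm: in the unit ball [|ln |x| |] is at most the
    number of balls of radius [2 * 2 ^ - k] that contain [x]. *)
Lemma integral_ln_ball : (0 < N)%N ->
  (\int[leb]_x (`|ln `|x| | * \1_(ball (0 : V) 1) x)%:E <= (4 ^+ N * 2)%:E)%E.
Proof.
move=> N0.
apply: (@integral_le_shells _ (fun=> 1) (fun k => 2 * 2 ^- k)) => //.
- apply: measurable_funM; last by apply: measurable_indic; exact: measurable_rV_ball.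
  apply: measurableT_comp => //; apply: measurableT_comp; first exact: measurable_ln.
  exact: measurable_rV_norm.
- move=> k; have k0 : (2 : R) ^+ k != 0 by rewrite expf_neq0.
  rewrite mul1r (_ : 2 / 2 ^+ k *+ 2 = 4 * 2 ^- k); last first.
    by rewrite -mulr_natl; field.
  rewrite natrX (_ : _ / 2 ^+ k.+1 = 4 ^+ N * 2 ^- k); last by rewrite exprS; field.
  rewrite exprMn ler_wpM2l ?exprn_ge0//.
  rewrite -[leRHS]expr1 ler_wiXn2l ?invr_ge0 ?exprn_ge0//.
  by rewrite invf_le1 ?exprn_gt0// exprn_ege1// ler1n.
move=> x.
have [->|x0] := eqVneq x 0.
  by exists 0%N; rewrite big_nil normr0 ln0// normr0 mul0r.
have {}x0 : 0 < `|x| by rewrite normr_gt0.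
have [x1|x1] := leP 1 `|x|.
  exists 0%N; rewrite big_nil indicE memNset ?mulr0//.
  by rewrite ball0E; apply/negP; rewrite -leNgt.
have [n xn] := exists_pow2_gt `|x|^-1.
have {}xn : 2 ^- n < `|x|.
  by rewrite -[ltRHS]invrK ltf_pV2 ?posrE ?exprn_gt0 ?invr_gt0.
have l2 : ln 2 <= 1 :> R by rewrite -[2]/(1 + 1) le_ln1Dx.
exists n; rewrite indic_ball1// mulr1.
elim: n xn => [|n IH] xn.
  by move: xn; rewrite expr0 invr1 ltNge (ltW x1).
have [/IH H|nx] := ltP (2 ^- n) `|x|.
  by rewrite big_nat_recr//= ler_wpDr// mul1r.
rewrite (_ : \sum_(0 <= k < n.+1) _ = n.+1%:R).
  rewrite ler0_norm; last by rewrite ln_le0// ltW.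
  rewrite -lnV ?posrE// (le_trans (y := ln (2 ^+ n.+1)))//.
    rewrite ler_ln ?posrE ?invr_gt0 ?exprn_gt0//.
    by rewrite -[leRHS]invrK lef_pV2 ?posrE ?invr_gt0 ?exprn_gt0// ltW.
  by rewrite lnXn// ler_wMn2r.
rewrite (eq_big_nat _ _ (F2 := fun=> 1)) ?big_const_nat ?subn0 ?iter_addr_0//.
move=> k /andP[_ kn]; rewrite mul1r indic_ball1// (le_lt_trans nx)//.
apply: (@le_lt_trans _ _ (2 ^- k)); last by rewrite ltr_pMl// ?ltr1n// invr_gt0 exprn_gt0.
by rewrite lef_pV2 ?posrE ?exprn_gt0// ler_weXn2l// ler1n.
Qed.

End radial_weights.

Section schwartz_decay.
Context {R : realType} {N : nat}.
Notation V := 'rV[R]_N.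
Notation leb := (lebesgue_rV (R := R) N).
Implicit Types (x y u h p : V).

Lemma is_derive_line (f : V -> R) p (v : V) (t : R) : derivable f (p + t *: v) v ->
  is_derive t (1 : R) (fun t : R => f (p + t *: v)) ('D_v f (p + t *: v)).
Proof.
move=> df; pose g (t : R) := f (p + t *: v).
have E : (fun h : R => h^-1 *: ((g \o shift t) (h *: (1 : R)) - g t)) =
  (fun h : R => h^-1 *: ((f \o shift (p + t *: v)) (h *: v) - f (p + t *: v))).
  apply/funext => h /=; congr (_ *: (f _ - _)).
  by rewrite [h *: 1]mulr1 scalerDl addrCA.
by apply: DeriveDef; rewrite ?/derivable ?/derive E.
Qed.

Lemma segment_increment_le (f : V -> R) p (v : V) (s m : R) :
  (forall u, derivable f u v) ->
  (forall t, `|t| <= `|s| -> `|'D_v f (p + t *: v)| <= m) ->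
  `|f (p + s *: v) - f p| <= m * `|s|.
Proof.
move=> df Dm; pose g t := f (p + t *: v).
have dg (t : R) : is_derive t (1 : R) g ('D_v f (p + t *: v)) by exact: is_derive_line.
have cg (a b : R) : {within `[a, b], continuous g}.
  by apply: derivable_within_continuous => t _; exact: ex_derive.
have -> : f p = g 0 by rewrite /g scale0r addr0.
have [s0|s0] := leP 0 s.
  have [t ts ->] := MVT_segment s0 (fun t _ => dg t) (cg 0 s).
  rewrite subr0 normrM ler_wpM2r// Dm//.
  by move: ts; rewrite in_itv/= => /andP[t0 ts]; rewrite !ger0_norm.
rewrite distrC; have [t ts ->] := MVT_segment (ltW s0) (fun t _ => dg t) (cg s 0).
rewrite sub0r normrM normrN ler_wpM2r// Dm//.
by move: ts; rewrite in_itv/= => /andP[t0 ts]; rewrite !ler0_norm ?lerN2// ltW.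
Qed.

Lemma rV_norm_leP x (r : R) : 0 <= r -> (forall i, `|x ord0 i| <= r) -> `|x| <= r.
Proof.
move=> r0 H; rewrite [`|x|]/Num.norm/= mx_normrE; apply/bigmax_leP; split => //.
by move=> -[i j] _ /=; rewrite ord1.
Qed.

(** Mean value inequality: move from [x] to [x + h] one coordinate at a time. *)
Lemma increment_le (f : V -> R) x h (m : R) : 0 <= m ->
  (forall i u, derivable f u (delta_mx ord0 i)) ->
  (forall i u, `|u - x| <= `|h| -> `|'D_(delta_mx ord0 i) f u| <= m) ->
  `|f (x + h) - f x| <= N%:R * m * `|h|.
Proof.
move=> m0 df Dm.
pose p (j : nat) : V := \row_i (x ord0 i + (if (i < j)%N then h ord0 i else 0)).
have pN : p N = x + h by apply/rowP => i; rewrite !mxE ltn_ord.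
have p0 : p 0 = x by apply/rowP => i; rewrite !mxE ltn0 addr0.
have pS (j : 'I_N) : p j.+1 = p j + h ord0 j *: delta_mx ord0 j.
  apply/rowP => i; rewrite !mxE eqxx/= ltnS leq_eqVlt.
  rewrite -addrA; congr (_ + _).
  have [->|ij] := eqVneq i j; first by rewrite eqxx ltnn add0r mulr1.
  by rewrite val_eqE (negbTE ij)/= mulr0 addr0.
rewrite -pN -p0 -(@telescope_sumr _ 0 N (fun j => f (p j)))// big_mkord.
apply: (le_trans (ler_norm_sum _ _ _)).
apply: (le_trans (y := \sum_(j < N) (m * `|h|))); last first.
  by rewrite sumr_const card_ord -[leLHS]mulr_natl mulrA.
apply: ler_sum => j _; rewrite pS.
apply: (le_trans (y := m * `|h ord0 j|)); last by rewrite ler_wpM2l// rV_coord_le.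
apply: segment_increment_le => // t th; apply: Dm.
apply: rV_norm_leP => // i; rewrite !mxE eqxx/=.
rewrite addrAC [x _ _ + _]addrC addrK; case: ltnP => ij.
  by rewrite -val_eqE/= ltn_eqF// mulr0 addr0 rV_coord_le.
rewrite add0r; case: (i == j); last by rewrite mulr0 normr0.
by rewrite mulr1 (le_trans th)// rV_coord_le.
Qed.

Lemma norm_le_enorm x : `|x| <= enorm x.
Proof.
apply: rV_norm_leP => [|i]; first exact: sqrtr_ge0.
rewrite -sqrtr_sqr ler_wsqrtr// (bigD1 i)//= lerDl sumr_ge0// => j _.
exact: sqr_ge0.
Qed.

Lemma enorm_le_norm x : enorm x <= N%:R * `|x|.
Proof.
rewrite -[leRHS]ger0_norm ?mulr_ge0// -sqrtr_sqr ler_wsqrtr//.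
apply: (le_trans (y := \sum_(i < N) `|x| ^+ 2)).
  apply: ler_sum => i _; rewrite -[leLHS]real_normK ?num_real//.
  by rewrite lerXn2r ?nnegrE// rV_coord_le.
rewrite sumr_const card_ord exprMn -[leLHS]mulr_natl ler_wpM2r// ?sqr_ge0//.
by rewrite -natrX ler_nat; case: (N) => // n; rewrite expnS leq_pmulr// expn_gt0.
Qed.

Lemma enorm_ge0 x : 0 <= enorm x.
Proof. exact: sqrtr_ge0. Qed.

Lemma decay_weight (g : V -> R) n :
  (forall k : nat, exists M : R, forall x, enorm x ^+ k * `|g x| <= M) ->
  exists2 C, 0 <= C & forall x, `|g x| <= C * weight n x.
Proof.
move=> H; have [M0 HM0] := H 0%N; have [Mn HMn] := H n.
exists (2 ^+ n * (`|M0| + `|Mn|)) => [|x]; first by rewrite mulr_ge0// exprn_ge0.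
rewrite /weight ler_pdivlMr ?exprn_gt0 ?ltr_pwDl// mulrC.
apply: (le_trans (y := 2 ^+ n * ((1 + enorm x ^+ n) * `|g x|))).
  rewrite mulrA ler_wpM2r//.
  apply: (le_trans (y := (2 * Num.max 1 `|x|) ^+ n)).
    rewrite lerXn2r ?nnegrE ?mulr_ge0// ?addr_ge0 ?le_max ?ler01//.
    by rewrite mulr_natl mulr2n lerD// le_max lexx ?orbT.
  rewrite exprMn ler_wpM2l ?exprn_ge0//.
  case: (leP 1 `|x|) => x1; last by rewrite expr1n lerDl exprn_ge0 ?enorm_ge0.
  by rewrite ler_wpDl// lerXn2r ?nnegrE ?enorm_ge0// norm_le_enorm.
rewrite ler_wpM2l ?exprn_ge0// mulrDl lerD//.
  by have := HM0 x; rewrite expr0 => /le_trans -> //; exact: ler_norm.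
by rewrite (le_trans (HMn x))// ler_norm.
Qed.

(** The quantitative information about a Schwartz function that is used below:
    size and increments are controlled by an arbitrary power of the distance to
    the origin. *)
Lemma schwartz_bounds (Phi : V -> R[i]) n : schwartz Phi ->
  exists2 C, 0 <= C & [/\ forall x, cabs (Phi x) <= C * weight n x,
    forall x y, cabs (Phi x - Phi y) <= C * `|x - y| &
    forall x h, 2 * `|h| <= `|x| ->
      cabs (Phi (x + h) - Phi x) <= C * `|h| * (2 ^+ n * weight n x)].
Proof.
have real_case (f : V -> R) : real_schwartz f ->
  exists2 C, 0 <= C & [/\ forall x, `|f x| <= C * weight n x,
    forall x y, `|f x - f y| <= C * `|x - y| &
    forall x h, 2 * `|h| <= `|x| ->
      `|f (x + h) - f x| <= C * `|h| * (2 ^+ n * weight n x)].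
  move=> sf; have [df fM] := sf [::]; have [C0 C00 HC0] := decay_weight n fM.
  have /choice[C1 HC1] (i : 'I_N) : exists C1, 0 <= C1 /\
      forall x, `|'D_(delta_mx ord0 i) f x| <= C1 * weight n x.
    have [_ DM] := sf [:: i]; have [C1 ? ?] := decay_weight n DM; by exists C1.
  pose C := \sum_i C1 i.
  have C_ge0 : 0 <= C by apply: sumr_ge0 => i _; case: (HC1 i).
  have C1C i : C1 i <= C.
    by rewrite /C (bigD1 i)//= lerDl sumr_ge0// => j _; case: (HC1 j).
  have DC i u : `|'D_(delta_mx ord0 i) f u| <= C * weight n u.
    by have [_ /(_ u)/le_trans->//] := HC1 i; rewrite ler_wpM2r ?weight_ge0.
  exists (C0 + N%:R * C); first by rewrite addr_ge0// mulr_ge0.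
  split => [x|x y|x h hx].
  - by rewrite (le_trans (HC0 x))// ler_wpM2r ?weight_ge0// lerDl mulr_ge0.
  - have := @increment_le f y (x - y) C C_ge0 df.
    rewrite (addrC y) subrK => H; apply: (le_trans (H _)).
      move=> i u _; rewrite (le_trans (DC i u))// ler_piMr//.
      exact: weight_le1.
    by rewrite ler_wpM2r// lerDr.
  - have m0 : 0 <= C * (2 ^+ n * weight n x).
      by rewrite mulr_ge0// mulr_ge0 ?exprn_ge0// weight_ge0.
    have := increment_le m0 df (h := h) (x := x).
    move=> H; apply: (le_trans (H _)).
      move=> i u ux; rewrite (le_trans (DC i u))// ler_wpM2l//.
      rewrite /weight -[2 ^+ n]invrK -invfM lef_pV2 ?posrE; last 2 first.
      + by rewrite exprn_gt0// ltr_pwDl.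
      + by rewrite mulr_gt0 ?invr_gt0 ?exprn_gt0 ?ltr_pwDl.
      rewrite -exprVn -exprMn lerXn2r ?nnegrE ?mulr_ge0 ?addr_ge0 ?invr_ge0//.
      have : `|x| <= `|u| + `|u - x|.
        by rewrite -{1}(subKr u x) (le_trans (ler_normB _ _)).
      lra.
    rewrite (_ : N%:R * _ * _ = N%:R * C * `|h| * (2 ^+ n * weight n x)); last by ring.
    rewrite ler_wpM2r ?mulr_ge0 ?exprn_ge0 ?weight_ge0//.
    by rewrite ler_wpM2r// lerDr.
move=> [/real_case[C C0 [a1 a2 a3]] /real_case[D D0 [b1 b2 b3]]].
exists (C + D); first by rewrite addr_ge0.
split => [x|x y|x h hx]; rewrite (le_trans (cabs_le_ReIm _))// ?ReD ?ImD ?ReN ?ImN.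
- by rewrite mulrDl lerD.
- by rewrite mulrDl lerD.
- by rewrite !mulrDl lerD// ?a3 ?b3.
Qed.

End schwartz_decay.

(** * The radial maximal function *)

Section lipschitz.
Context {R : realType} {N : nat}.
Notation V := 'rV[R]_N.

Lemma lipschitz_continuous (F : V -> R) (L : R) :
  (forall x y, `|F x - F y| <= L * `|x - y|) -> continuous F.
Proof.
move=> FL x A /nbhs_ballP[e /= e0 eA].
have L0 : 0 < `|L| + 1 by rewrite ltr_wpDl.
apply/nbhs_ballP; exists ((`|L| + 1)^-1 * e); first by rewrite /= mulr_gt0// invr_gt0.
move=> y; rewrite -[ball x _ y]/(ball x _ y) -ball_normE /= => xy; apply: eA.
rewrite -ball_normE /=; apply: (le_lt_trans (FL x y)).
apply: (@le_lt_trans _ _ ((`|L| + 1) * `|x - y|)).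
  by rewrite ler_wpM2r// (le_trans (ler_norm L))// lerDl.
by rewrite -ltr_pdivlMl.
Qed.

(** Lipschitz continuity with constant [L], for the max norm. *)
Definition clipschitz (L : R) (f : V -> R[i]) :=
  forall x y, cabs (f x - f y) <= L * `|x - y|.

Lemma clipschitz_Re (L : R) f : clipschitz L f ->
  continuous (fun x => complex.Re (f x)).
Proof.
move=> fL; apply: (@lipschitz_continuous _ L) => x y.
by rewrite -ReN -ReD (le_trans (Re_le_cabs _)).
Qed.

Lemma clipschitz_Im (L : R) f : clipschitz L f ->
  continuous (fun x => complex.Im (f x)).
Proof.
move=> fL; apply: (@lipschitz_continuous _ L) => x y.
by rewrite -ImN -ImD (le_trans (Im_le_cabs _)).
Qed.

Lemma clipschitz_meas (L : R) f : clipschitz L f -> cmeas f.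
Proof.
move=> fL; split; apply: continuous_measurable_rV.
  exact: clipschitz_Re fL.
exact: clipschitz_Im fL.
Qed.

Lemma cabs_dist (z w : R[i]) : `|cabs z - cabs w| <= cabs (z - w).
Proof.
have h1 : cabs z <= cabs (z - w) + cabs w by rewrite -{1}(subrK w z) cabsD.
have h2 : cabs w <= cabs (z - w) + cabs z by rewrite cabsBC -{1}(subrK z w) cabsD.
by rewrite ler_norml; apply/andP; split; lra.
Qed.

Lemma clipschitz_cabs (L : R) f : clipschitz L f -> continuous (fun x => cabs (f x)).
Proof.
move=> fL; apply: (@lipschitz_continuous _ L) => x y.
by rewrite (le_trans (cabs_dist _ _)).
Qed.

(** A supremum of continuous functions is lower semicontinuous, hence measurable,
    even if the family is uncountable. *)
Lemma measurable_sup_continuous (I : Type) (P : set I) (F : I -> V -> R) :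
  (forall i, P i -> continuous (F i)) ->
  measurable_fun setT (fun x => ereal_sup [set (F i x)%:E | i in P]).
Proof.
move=> cF; apply: (measurability _ (ErealGenOInfty.measurableE R)).
move=> _ [_ [a ->] <-]; rewrite setTI; apply: open_measurable_rV.
rewrite preimage_itvoy.
rewrite (_ : [set _ | _] = \bigcup_(i in P) (F i @^-1` [set t | a < t])).
  apply: bigcup_open => i Pi; apply: open_comp; last exact: open_gt.
  by move=> x _; exact: cF.
apply/seteqP; split => x /=.
  by move=> /ereal_sup_gt[_ [i Pi <-]]; rewrite lte_fin => ai; exists i.
move=> [i Pi /= ai]; apply: (@lt_le_trans _ _ (F i x)%:E); first by rewrite lte_fin.
by apply: ereal_sup_ubound; exists i.
Qed.

End lipschitz.

Section maximal.
Context {R : realType} {N : nat}.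
Notation V := 'rV[R]_N.
Notation leb := (lebesgue_rV (R := R) N).
Implicit Types (f g phi : V -> R[i]) (x y : V).

(** Size, Lipschitz and decaying-increment bounds with a common constant: all that
    is used of a Schwartz function. *)
Definition kernel_bounds (C : R) (Phi : V -> R[i]) :=
  [/\ 0 <= C, forall x, cabs (Phi x) <= C * weight N.+2 x, clipschitz C Phi &
    forall x h, 2 * `|h| <= `|x| ->
      cabs (Phi (x + h) - Phi x) <= C * `|h| * weight N.+1 x].

Lemma schwartz_kernel_bounds (Phi : V -> R[i]) : schwartz Phi ->
  exists C, kernel_bounds C Phi.
Proof.
move=> /(schwartz_bounds N.+2)[C C_ge0 [a1 a2 a3]].
have E1 : 1 <= 2 ^+ N.+2 :> R by rewrite exprn_ege1// ler1n.
have CE : C <= C * 2 ^+ N.+2 by rewrite ler_peMr.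
exists (C * 2 ^+ N.+2); split.
- by rewrite mulr_ge0.
- by move=> x; rewrite (le_trans (a1 x))// ler_wpM2r// weight_ge0.
- by move=> x y; rewrite (le_trans (a2 x y))// ler_wpM2r.
- move=> x h xh; rewrite (le_trans (a3 x h xh))//.
  rewrite (_ : C * `|h| * _ = C * 2 ^+ N.+2 * `|h| * weight N.+2 x); last by ring.
  rewrite ler_wpM2l//; last exact: weight_le.
  by rewrite mulr_ge0// mulr_ge0// ?exprn_ge0.
Qed.

Variables (Phi : V -> R[i]) (C : R).
Hypothesis HC : kernel_bounds C Phi.

Let C_ge0 : 0 <= C. Proof. by case: HC. Qed.

Lemma Phi_meas : cmeas Phi.
Proof. by case: HC => _ _ L _; exact: clipschitz_meas L. Qed.

Lemma Phi_le x : cabs (Phi x) <= C.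
Proof.
case: HC => _ H _ _; rewrite (le_trans (H x))// ler_piMr//; exact: weight_le1.
Qed.

Lemma Phi_le_weight x : cabs (Phi x) <= C * weight N.+1 x.
Proof. by case: HC => _ H _ _; rewrite (le_trans (H x))// ler_wpM2l// weight_le. Qed.

Lemma Phi_integrable : cintegrable Phi.
Proof.
apply: (le_cintegrable (g := fun x => C * weight N.+1 x)).
- exact: Phi_meas.
- exact: (integrableZl _ C integrable_weight).
- exact: Phi_le_weight.
Qed.

Lemma Phi_moment_integrable : leb.-integrable setT (fun x => (cabs (Phi x) * `|x|)%:E).
Proof.
apply: (@le_integrable _ _ _ leb setT measurableT _ (fun x => (C * weight N.+1 x)%:E)) => //.
- apply/measurable_EFinP; apply: measurable_funM; last exact: measurable_rV_norm.
  exact/cmeas_cabs/Phi_meas.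
- move=> x _; rewrite lee_fin !ger0_norm ?mulr_ge0 ?weight_ge0 ?cabs_ge0//.
  case: HC => _ H _ _; rewrite (le_trans (ler_wpM2r _ (H x)))//.
  by rewrite -mulrA ler_wpM2l// -[leRHS]weightS ler_wpM2l ?weight_ge0// lerDr.
- exact: (integrableZl _ C integrable_weight).
Qed.

(** [u s f] is the average of [f] at scale [s]. *)
Notation u s f := (convol (dilate s Phi) f).

Lemma dilPhi_meas (s : R) : cmeas (dilate s Phi).
Proof. exact/dilate_meas/Phi_meas. Qed.

Lemma dilPhi_le (s : R) x : 0 < s -> cabs (dilate s Phi x) <= s ^- N * C.
Proof. by move=> s0; apply: cabs_dilate_le => //; exact: Phi_le. Qed.

Lemma dilPhi_section (s : R) f x : 0 < s -> cintegrable f ->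
  cintegrable (fun y => dilate s Phi (x - y) * f y).
Proof.
move=> s0 fi; apply: convol_section_integrable fi; first exact: dilPhi_meas.
by move=> y; exact: dilPhi_le.
Qed.

Lemma dilPhi_lipschitz (s : R) : 0 < s ->
  clipschitz (s ^- N * (C * s^-1)) (dilate s Phi).
Proof.
move=> s0 x y; rewrite /dilate -mulrBr cabsM cabs_real ger0_norm; last first.
  by rewrite invr_ge0 exprn_ge0// ltW.
rewrite -!mulrA ler_wpM2l ?invr_ge0 ?exprn_ge0 ?(ltW s0)//.
have [_ _ L _] := HC; rewrite (le_trans (L _ _))// ler_wpM2l//.
by rewrite -scalerBr normrZ ger0_norm// invr_ge0 ltW.
Qed.

Lemma u_lipschitz (s : R) f : 0 < s -> cintegrable f ->
  clipschitz (s ^- N * (C * s^-1) * L1n f) (u s f).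
Proof.
move=> s0 fi x y; rewrite /convol.
have ix := dilPhi_section x s0 fi; have iy := dilPhi_section y s0 fi.
rewrite -[X in cabs X](cintB ix iy) mulrAC.
apply: cabs_cint_bounded_mul => //.
- by rewrite !mulr_ge0// ?invr_ge0 ?exprn_ge0// ltW.
- exact: cintegrableB.
- move=> z; rewrite -mulrBl cabsM ler_wpM2r ?cabs_ge0//.
  rewrite (le_trans (dilPhi_lipschitz s0 _ _))//.
  by rewrite (_ : x - z - (y - z) = x - y)// opprB addrA subrK.
Qed.

Lemma measurable_maximal f : cintegrable f -> measurable_fun setT (maximal_fun Phi f).
Proof.
move=> fi; apply: (@measurable_sup_continuous _ _ _ [set s | 0 < s]
  (fun s x => cabs (u s f x))) => s /= s0.
exact: clipschitz_cabs (u_lipschitz s0 fi).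
Qed.

Lemma u_le_maximal (s : R) f x : 0 < s ->
  ((cabs (u s f x))%:E <= maximal_fun Phi f x)%E.
Proof. by move=> s0; apply: ereal_sup_ubound; exists s. Qed.

Lemma maximal_ge0 f x : (0 <= maximal_fun Phi f x)%E.
Proof. by apply: le_trans (u_le_maximal f x ltr01); rewrite lee_fin cabs_ge0. Qed.

Lemma maximal_le f x (M : \bar R) :
  (forall s : R, (0 < s)%R -> (cabs (u s f x))%:E <= M)%E -> (maximal_fun Phi f x <= M)%E.
Proof. by move=> H; apply: ge_ereal_sup => _ [s /= s0 <-]; exact: H. Qed.

Lemma uD (s : R) f g x : 0 < s -> cintegrable f -> cintegrable g ->
  u s (fun x => f x + g x) x = u s f x + u s g x.
Proof.
move=> s0 fi gi.
have ix := dilPhi_section x s0 fi; have iy := dilPhi_section x s0 gi.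
by rewrite -[RHS](cintD ix iy); apply: (@eq_cint _ _ _ leb) => y; rewrite mulrDr.
Qed.

Lemma uZ (s : R) (a : R[i]) f x : 0 < s -> cintegrable f ->
  u s (fun x => a * f x) x = a * u s f x.
Proof.
move=> s0 fi; have ix := dilPhi_section x s0 fi.
by rewrite -[RHS](cintZ a ix); apply: (@eq_cint _ _ _ leb) => y; rewrite mulrCA.
Qed.

Lemma maximalD f g x : cintegrable f -> cintegrable g ->
  (maximal_fun Phi (fun x => f x + g x)%R x <= maximal_fun Phi f x + maximal_fun Phi g x)%E.
Proof.
move=> fi gi; apply: maximal_le => s s0; rewrite uD//.
apply: (@le_trans _ _ ((cabs (u s f x))%:E + (cabs (u s g x))%:E)%E).
  by rewrite -EFinD lee_fin cabsD.
by apply: leeD; exact: u_le_maximal.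
Qed.

Lemma maximalZ (a : R[i]) f x : cintegrable f ->
  (maximal_fun Phi (fun x => a * f x)%R x <= (cabs a)%:E * maximal_fun Phi f x)%E.
Proof.
move=> fi; apply: maximal_le => s s0; rewrite uZ// cabsM EFinM.
by rewrite lee_wpmul2l ?lee_fin ?cabs_ge0// u_le_maximal.
Qed.

(** Hardy seminorm as an extended real, locked to keep unification from unfolding
    the integral. *)
Definition Hnorm f : \bar R := locked (\int[leb]_x maximal_fun Phi f x)%E.

Lemma HnormE f : Hnorm f = (\int[leb]_x maximal_fun Phi f x)%E.
Proof. by rewrite /Hnorm -lock. Qed.

Lemma Hnorm_ge0 f : (0 <= Hnorm f)%E.
Proof. by rewrite HnormE; apply: integral_ge0 => x _; exact: maximal_ge0. Qed.

Lemma hardyP f : hardy Phi f <-> cintegrable f /\ (Hnorm f < +oo)%E.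
Proof.
split=> [[fi /integrableP[_ H]]|[fi fy]]; split => //.
  rewrite HnormE; apply: le_lt_trans H; apply: ge0_le_integral => //.
  - by move=> x _; exact: maximal_ge0.
  - exact: measurable_maximal.
  - by apply: measurableT_comp => //; exact: measurable_maximal.
  - by move=> x _; rewrite lee_abs.
apply/integrableP; split; first exact: measurable_maximal.
by move: fy; rewrite HnormE; under [X in (_ -> X < _)%E]eq_integral do rewrite gee0_abs ?maximal_ge0//.
Qed.

Lemma hardy_normE f : hardy Phi f -> Hnorm f = (hardy_norm Phi f)%:E.
Proof.
move=> /hardyP[fi fy]; rewrite /hardy_norm -HnormE fineK//.
by rewrite ge0_fin_numE ?Hnorm_ge0.
Qed.

Lemma hardy_norm_ge0 f : 0 <= hardy_norm Phi f.
Proof. by rewrite /hardy_norm -HnormE fine_ge0// Hnorm_ge0. Qed.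

Lemma HnormD f g : cintegrable f -> cintegrable g ->
  (Hnorm (fun x => f x + g x)%R <= Hnorm f + Hnorm g)%E.
Proof.
move=> fi gi; rewrite !HnormE -ge0_integralD//; [|by move=> x _; exact: maximal_ge0|
  exact: measurable_maximal|by move=> x _; exact: maximal_ge0|exact: measurable_maximal].
apply: ge0_le_integral => //.
- by move=> x _; exact: maximal_ge0.
- by apply: measurable_maximal; exact: cintegrableD.
- by apply: emeasurable_funD; exact: measurable_maximal.
- by move=> x _; exact: maximalD.
Qed.

Lemma HnormZ (a : R[i]) f : cintegrable f ->
  (Hnorm (fun x => a * f x)%R <= (cabs a)%:E * Hnorm f)%E.
Proof.
move=> fi; rewrite !HnormE -ge0_integralZl_EFin ?cabs_ge0//; last 2 first.
- by move=> x _; exact: maximal_ge0.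
- exact: measurable_maximal.
apply: ge0_le_integral => //.
- by move=> x _; exact: maximal_ge0.
- by apply: measurable_maximal; exact: cintegrableZ.
- by apply: emeasurable_funM => //; exact: measurable_maximal.
- by move=> x _; exact: maximalZ.
Qed.

Lemma hardyD f g : hardy Phi f -> hardy Phi g -> hardy Phi (fun x => f x + g x).
Proof.
move=> /hardyP[fi fy] /hardyP[gi gy]; apply/hardyP; split; first exact: cintegrableD.
have h := HnormD fi gi.
apply: (le_lt_trans h).
apply: lte_add_pinfty; first exact: fy.
exact: gy.
Qed.

Lemma hardyZ (a : R[i]) f : hardy Phi f -> hardy Phi (fun x => a * f x).
Proof.
move=> /hardyP[fi fy]; apply/hardyP; split; first exact: cintegrableZ.
apply: (le_lt_trans (HnormZ a fi)); apply: lte_mul_pinfty => //.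
by rewrite lee_fin cabs_ge0.
Qed.

Lemma hardy_normD f g : hardy Phi f -> hardy Phi g ->
  hardy_norm Phi (fun x => f x + g x) <= hardy_norm Phi f + hardy_norm Phi g.
Proof.
move=> fh gh; have [[fi _] [gi _]] := (fh, gh); have := HnormD fi gi.
by rewrite (hardy_normE fh) (hardy_normE gh) (hardy_normE (hardyD fh gh)) -EFinD lee_fin.
Qed.

Lemma hardy_normZ (a : R[i]) f : hardy Phi f ->
  hardy_norm Phi (fun x => a * f x) <= cabs a * hardy_norm Phi f.
Proof.
move=> fh; have [fi _] := fh; have := HnormZ a fi.
by rewrite (hardy_normE fh) (hardy_normE (hardyZ a fh)) -EFinM lee_fin.
Qed.

(** Translation invariance and Minkowski: convolution with an integrable function
    is controlled pointwise by the convolution of the maximal function. *)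
Lemma maximal_convol g phi x : cintegrable g -> cintegrable phi ->
  (forall y, cintegrable (fun z => g (y - z) * phi z)) ->
  (maximal_fun Phi (convol g phi) x <= econv g (maximal_fun Phi phi) x)%E.
Proof.
move=> gi phii si; apply: maximal_le => s s0.
have KM y : cabs (dilate s Phi y) <= s ^- N * C by exact: dilPhi_le.
rewrite (convolA x (dilPhi_meas s) KM gi phii si).
have cm : cmeas (fun w : V => u s phi (x - w)).
  by apply: cmeas_reflect; exact: clipschitz_meas (u_lipschitz s0 phii).
have ci : cintegrable (fun w : V => u s phi (x - w) * g w).
  under eq_fun do rewrite mulrC.
  apply: (@cintegrable_bounded_mul _ _ _ _ _ _ (s ^- N * C * L1n phi)) => // w.
  exact: (cabs_convol_bounded _ (dilPhi_meas s)).
apply: (le_trans (cabs_cint ci)).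
apply: ge0_le_integral; first exact: measurableT.
- by move=> w _; rewrite lee_fin cabs_ge0.
- exact/cmeas_cabse/(cintegrable_meas ci).
- apply: emeasurable_funM; first exact/cmeas_cabse/(cintegrable_meas gi).
  exact: (measurableT_comp (measurable_maximal phii) (measurable_reflect x)).
- move=> w _; rewrite cabsM mulrC EFinM lee_wpmul2l ?lee_fin ?cabs_ge0//.
  exact: u_le_maximal.
Qed.

Lemma Hnorm_convol g phi : cintegrable g -> cintegrable phi ->
  (forall y, cintegrable (fun z => g (y - z) * phi z)) ->
  (Hnorm (convol g phi) <= L1e g * Hnorm phi)%E.
Proof.
move=> gi phii si; have mM := measurable_maximal phii.
have mg := cintegrable_meas gi.
rewrite !HnormE -integral_econv//; last by move=> x; exact: maximal_ge0.
apply: ge0_le_integral; first exact: measurableT.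
- by move=> x _; exact: maximal_ge0.
- by apply: measurable_maximal; exact: (cintegrable_convol gi phii).1.
- by apply: measurable_econv => // x; exact: maximal_ge0.
- by move=> x _; exact: maximal_convol.
Qed.

End maximal.

(** * A dyadic weak-type estimate *)

Section dyadic.
Context {R : realType} {N : nat}.
Notation V := 'rV[R]_N.
Notation leb := (lebesgue_rV (R := R) N).
Implicit Types (x y : V) (k j : nat).

Lemma pow2_gt0 k : 0 < (2 : R) ^+ k.
Proof. by rewrite exprn_gt0. Qed.

Lemma pow2V_gt0 k : 0 < (2 : R) ^- k.
Proof. by rewrite invr_gt0 pow2_gt0. Qed.

(** Integer coordinates of the dyadic cube of side [2 ^ - k] that contains [x]. *)
Definition fl k x (i : 'I_N) : int := Num.floor (2 ^+ k * x ord0 i).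

(** The dyadic cube of side [2 ^- k] that contains [x]. *)
Definition cell k x : set V := [set y | forall i, fl k y i = fl k x i].

Lemma cellE k x : cell k x = [set y | forall i,
  `[(fl k x i)%:~R * 2 ^- k, (fl k x i + 1)%:~R * 2 ^- k[%classic (y ord0 i)].
Proof.
have p0 := pow2_gt0 k.
apply/seteqP; split => y /= + i => /(_ i); rewrite /= in_itv/=.
  move=> <-; have /andP[h1 h2] := Num.Theory.floor_itv (2 ^+ k * y ord0 i).
  by rewrite ler_pdivrMr// ltr_pdivlMr// ![_ * 2 ^+ k]mulrC h1 h2.
rewrite ler_pdivrMr// ltr_pdivlMr// ![_ * 2 ^+ k]mulrC => H.
exact: Num.Theory.floor_def.
Qed.

Lemma measurable_cell k x : measurable (cell k x).
Proof.
rewrite cellE; exact: (@measurable_forall_coord _ _ (fun i =>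
 `[(fl k x i)%:~R * 2 ^- k, (fl k x i + 1)%:~R * 2 ^- k[%classic)).
Qed.

Lemma leb_cell k x : leb (cell k x) = ((2 ^- k) ^+ N)%:E.
Proof.
rewrite cellE (@lebesgue_rV_box R N (fun i =>
   `[(fl k x i)%:~R * 2 ^- k, (fl k x i + 1)%:~R * 2 ^- k[%classic)).
  rewrite (eq_bigr (fun=> (2 ^- k)%:E)) => [|i _].
    by rewrite prodEFin prodr_const card_ord.
  rewrite lebesgue_measure_itv/= lte_fin ltr_pM2r ?pow2V_gt0// ltr_int ltzD1 lexx.
  by rewrite -EFinB; congr EFin; rewrite -mulrBl -rmorphB/= addrAC subrr add0r mul1r.
by move=> i; exact: measurable_itv.
Qed.

Lemma cell_sym k x y : cell k x y -> cell k y x.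
Proof. by move=> H i; rewrite H. Qed.

Lemma cell_eq k x y : cell k x y -> cell k y = cell k x.
Proof. by move=> H; apply/seteqP; split => z /= zi i; rewrite zi ?H. Qed.

Lemma floor_double (a b : R) : Num.floor (2 * a) = Num.floor (2 * b) ->
  Num.floor a = Num.floor b.
Proof.
move=> H; apply: Num.Theory.floor_def.
have /andP[b1 b2] := Num.Theory.floor_itv b.
have /andP[a1 a2] := Num.Theory.floor_itv (2 * a).
set m := Num.floor b in b1 b2 *.
have h1 : (2 * m <= Num.floor (2 * a))%R.
  by rewrite H Num.Theory.floor_ge_int rmorphM/= ler_pM2l.
have h2 : (Num.floor (2 * a) + 1 <= 2 * m + 2)%R.
  have : (Num.floor (2 * a) < 2 * m + 2)%R.
    rewrite H Num.Theory.floor_lt_int rmorphD rmorphM/=.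
    by move: b2; rewrite rmorphD/=; lra.
  by lia.
have h1' : (2 * m)%:~R <= 2 * a by apply: le_trans a1; rewrite ler_int.
have h2' : 2 * a < (2 * m + 2)%:~R by apply: lt_le_trans a2 _; rewrite ler_int.
by apply/andP; split; [rewrite rmorphM/= in h1'|rewrite !rmorphD/= rmorphM/= in h2' *]; lra.
Qed.

Lemma cellS k x y : cell k.+1 x y -> cell k x y.
Proof.
by move=> H i; have := H i; rewrite /fl !exprS -!mulrA => /floor_double.
Qed.

Lemma cell_le j k x y : (j <= k)%N -> cell k x y -> cell j x y.
Proof.
by move=> /subnK <-; elim: (k - j)%N => // n IH /cellS/IH.
Qed.

(** The [3 ^ N] translations by at most one side in each coordinate direction. *)
Definition offset k (v : {ffun 'I_N -> 'I_3}) : V :=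
  \row_i (2 ^- k * ((v i)%:R - 1)).

Lemma floor_near (a b : R) : `|a - b| <= 1 -> Num.floor b <= Num.floor a + 1.
Proof.
move=> ab; rewrite -[X in _ + X](@intrKfloor R 1) -Num.Theory.floorDrz ?intr1//.
by apply: Num.Theory.le_floor; move: ab; rewrite ler_norml => /andP[]; lra.
Qed.

(** A ball of radius [2 ^ - k] is covered by the cube of its centre and the cubes
    adjacent to it. *)
Lemma cell_neighbour k x y : `|x - y| <= 2 ^- k ->
  exists v, cell k (x + offset k v) y.
Proof.
move=> xy; have p0 := pow2_gt0 k.
have ab i : `|2 ^+ k * x ord0 i - 2 ^+ k * y ord0 i| <= 1.
  rewrite -mulrBr normrM gtr0_norm// -ler_pdivlMl// mulr1 (le_trans _ xy)//.
  by have := rV_coord_le (x - y) i; rewrite !mxE.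
pose m i := fl k y i - fl k x i + 1.
have m1 i : 0 <= m i <= 2.
  have h1 := floor_near (ab i); have h2 : Num.floor (2 ^+ k * x ord0 i) <= Num.floor (2 ^+ k * y ord0 i) + 1.
    by apply: floor_near; rewrite distrC.
  by rewrite /m /fl; apply/andP; split; lia.
exists [ffun i => inord `|m i|%N] => i.
rewrite /fl !mxE ffunE inordK; last by have := m1 i; lia.
rewrite mulrDr mulrA mulfV ?mul1r ?gt_eqF//.
have -> : (`|m i|%N)%:R - 1 = (m i - 1)%:~R :> R.
  rewrite rmorphB/=; congr (_ - _); rewrite natr_absz ger0_norm//.
  by have /andP[] := m1 i.
by rewrite Num.Theory.floorDrz ?intr_int// intrKfloor /m /fl addrK addrC subrK.
Qed.

Lemma sub_offset k x y : `|x - y| <= 2 ^- k ->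
  exists v, cell k x (y - offset k v).
Proof.
rewrite distrC => /cell_neighbour[v] /= H.
pose w : {ffun 'I_N -> 'I_3} := [ffun i => inord (2 - v i)].
have ow : offset k w = - offset k v.
  apply/rowP => i; rewrite !mxE ffunE inordK; last by have := ltn_ord (v i); lia.
  rewrite natrB; last by have := ltn_ord (v i); lia.
  by ring.
exists w => i; rewrite ow opprK; exact/esym/H.
Qed.

Lemma measurable_same_cell k :
  measurable [set p : V * V | cell k p.1 p.2].
Proof.
rewrite (_ : [set p : V * V | cell k p.1 p.2] = \bigcap_(i in [set: 'I_N])
   \bigcup_(m in [set: int]) ([set p : V * V | fl k p.1 i = m] `&`
                              [set p : V * V | fl k p.2 i = m])); last first.
  apply/seteqP; split => p /= H i; first by move=> _; exists (fl k p.1 i) => //; split => //; exact: H.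
  by have [m _ [-> ->]] := H i I.
apply: fin_bigcap_measurable => // i _; apply: measurable_bigcup_countable => m.
have mfl : measurable [set x : V | fl k x i = m].
  rewrite (_ : [set x : V | _] = (fun x : V => 2 ^+ k * x ord0 i) @^-1` `[m%:~R, (m + 1)%:~R[%classic).
    have mc : measurable_fun setT (fun x : V => 2 ^+ k * x ord0 i).
      by apply: measurable_funM => //; exact: measurable_coord.
    rewrite -[X in measurable X]setTI; exact: (mc measurableT _ (measurable_itv _)).
  apply/seteqP; split => x /=; rewrite in_itv/= -Num.Theory.floor_eq; by move/eqP.
apply: measurableI.
  by rewrite -[X in measurable X]setTI; exact: (@measurable_fst _ _ V V measurableT _ mfl).
by rewrite -[X in measurable X]setTI; exact: (@measurable_snd _ _ V V measurableT _ mfl).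
Qed.

Section weak_type.
Variables (g : V -> R) (lam : R).
Hypotheses (mg : measurable_fun setT g) (g0 : forall x, 0 <= g x) (lam0 : 0 < lam).

Let mge : measurable_fun setT (fun y => (g y)%:E).
Proof. exact/measurable_EFinP. Qed.

Let ge0 : forall y, (0 <= (g y)%:E)%E.
Proof. by move=> y; rewrite lee_fin. Qed.

(** The integral of [g] over the dyadic cube of [x]. *)
Definition cell_int k x : \bar R := (\int[leb]_(y in cell k x) (g y)%:E)%E.

Lemma integral_indicE (A : set V) : measurable A ->
  (\int[leb]_(y in A) (g y)%:E = \int[leb]_y ((g y)%:E * (\1_A y)%:E))%E.
Proof.
move=> mA; rewrite integral_mkcond; apply: eq_integral => y _.
by rewrite /patch indicE; case: (y \in A); rewrite ?mule1 ?mule0.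
Qed.

Lemma indic_cellC k x y : \1_(cell k x) y = \1_(cell k y) x :> R.
Proof.
rewrite !indicE; have -> // : (y \in cell k x) = (x \in cell k y).
by apply/idP/idP; rewrite !inE => /cell_sym.
Qed.

Lemma measurable_cell_prod k :
  measurable_fun setT (fun p : V * V => (g p.2)%:E * (\1_(cell k p.1) p.2)%:E)%E.
Proof.
apply: emeasurable_funM; first exact: (measurableT_comp mge measurable_snd).
apply/measurable_EFinP.
rewrite (_ : (fun p : V * V => _) = \1_[set p : V * V | cell k p.1 p.2]).
  by apply: measurable_indic; exact: measurable_same_cell.
by apply/funext => p; rewrite !indicE.
Qed.

Lemma measurable_cell_int k : measurable_fun setT (cell_int k).
Proof.
rewrite (_ : cell_int k = fun x => \int[leb]_y ((g y)%:E * (\1_(cell k x) y)%:E))%E.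
  apply: (@measurable_int_section _ _ _ _ _ leb
    (fun p : V * V => (g p.2)%:E * (\1_(cell k p.1) p.2)%:E)%E).
    exact: measurable_cell_prod.
  by move=> p; rewrite mule_ge0// lee_fin.
by apply/funext => x; rewrite /cell_int integral_indicE//; exact: measurable_cell.
Qed.

(** The average of [g] over the dyadic cube of side [2 ^ - k] around [x] exceeds
    [lam]. *)
Definition bad k x : Prop := ((lam * (2 ^- k) ^+ N)%:E < cell_int k x)%E.
(** The points for which [k] is the first such scale; a union of cubes. *)
Definition stop k : set V := [set x | bad k x /\ forall j, (j < k)%N -> ~ bad j x].

Lemma measurable_bad k : measurable [set x | bad k x].
Proof.
rewrite -[X in measurable X]setTI.
by apply: emeasurable_fun_o_infty => //; exact: measurable_cell_int.
Qed.

Lemma measurable_stop k : measurable (stop k).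
Proof.
rewrite (_ : stop k = [set x | bad k x] `&`
    \bigcap_(j in `I_k) ~` [set x | bad j x]); last by apply/seteqP; split.
apply: measurableI; first exact: measurable_bad.
apply: bigcap_measurableType => j _; apply: measurableC; exact: measurable_bad.
Qed.

Lemma stop_cell k x y : cell k x y -> stop k x -> stop k y.
Proof.
move=> xy [bx nb]; have E j : (j <= k)%N -> cell_int j y = cell_int j x.
  by move=> jk; rewrite /cell_int (cell_eq (cell_le jk xy)).
split; first by rewrite /bad E.
by move=> j jk; rewrite /bad E ?(ltnW jk)//; exact: nb.
Qed.

Lemma trivIset_stop : trivIset setT stop.
Proof.
move=> i j _ _ [x [[bi ni] [bj nj]]].
have [ij|ji|//] := ltngtP i j; first by have := nj _ ij.
by have := ni _ ji.
Qed.

(** Chebyshev's inequality in each cube of [stop k], written as an exchange of the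
    integrals over pairs of points that share a cube. *)
Lemma leb_stop_le k : (lam%:E * leb (stop k) <= \int[leb]_(y in stop k) (g y)%:E)%E.
Proof.
have mS := measurable_stop k.
pose F (p : V * V) : \bar R := (((2 ^+ k) ^+ N)%:E * (\1_(stop k) p.1)%:E *
   ((g p.2)%:E * (\1_(cell k p.1) p.2)%:E))%E.
have p0 : 0 <= (2 : R) ^+ k by rewrite ltW// pow2_gt0.
have F0 p : (0 <= F p)%E by rewrite /F !mule_ge0// lee_fin// exprn_ge0.
have mF : measurable_fun setT F.
  apply: emeasurable_funM; last exact: measurable_cell_prod.
  apply: emeasurable_funM => //; apply/measurable_EFinP.
  by apply: (measurableT_comp _ measurable_fst); exact: measurable_indic.
apply: (@le_trans _ _ (\int[leb]_x \int[leb]_y F (x, y))%E).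
  rewrite (_ : leb (stop k) = \int[leb]_x (\1_(stop k) x)%:E)%E; last first.
    by rewrite integral_indic// setIT.
  rewrite -ge0_integralZl_EFin//; last 2 first.
  - by apply/measurable_EFinP; exact: measurable_indic.
  - exact: ltW.
  apply: ge0_le_integral => //.
  - by move=> x _; rewrite mule_ge0// lee_fin// ltW.
  - by apply: emeasurable_funM => //; apply/measurable_EFinP; exact: measurable_indic.
  - exact: (@measurable_int_section _ _ _ _ _ leb F).
  move=> x _; rewrite /F/= ge0_integralZl; [|exact: measurableT|
    by apply: emeasurable_funM => //; apply/measurable_EFinP; apply: measurable_indic;
      exact: measurable_cell|
    by move=> y _; rewrite mule_ge0// lee_fin|
    by rewrite mule_ge0// lee_fin// exprn_ge0].
  rewrite -integral_indicE; last exact: measurable_cell.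
  rewrite indicE; case: (boolP (x \in stop k)); last by rewrite !mule0 mul0e.
  rewrite inE => -[/ltW bx _]; rewrite !mule1.
  apply: (le_trans _ (lee_wpmul2l _ bx)); last by rewrite lee_fin exprn_ge0.
  by rewrite -EFinM lee_fin mulrCA -exprMn mulfV ?expr1n ?mulr1.
rewrite (@fubini_tonelli _ _ _ _ _ leb leb F)//.
rewrite (integral_indicE mS); apply: ge0_le_integral => //.
- by move=> y _; exact: integral_ge0.
- apply: (@measurable_int_section _ _ _ _ _ leb (fun p => F (p.2, p.1))) => //.
  apply: (measurableT_comp mF (g := fun p : V * V => (p.2, p.1))).
  by apply: measurable_fun_pair; [exact: measurable_snd|exact: measurable_fst].
- by apply: emeasurable_funM => //; apply/measurable_EFinP; exact: measurable_indic.
move=> y _; rewrite (_ : (fun x => F (x, y)) = fun x =>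
    (((2 ^+ k) ^+ N)%:E * ((g y)%:E * (\1_(stop k) y)%:E)) * (\1_(cell k y) x)%:E)%E.
  rewrite ge0_integralZl; [|exact: measurableT|
    by apply/measurable_EFinP; apply: measurable_indic; exact: measurable_cell|
    by move=> x _; rewrite lee_fin|
    by rewrite mule_ge0 ?mule_ge0// lee_fin// exprn_ge0].
  rewrite integral_indic//; last exact: measurable_cell.
  rewrite setIT [X in (_ * X)%E](leb_cell k y) muleC muleA -EFinM -exprMn mulVf.
    by rewrite expr1n mul1r EFinM.
  by rewrite gt_eqF// pow2_gt0.
apply/funext => x; rewrite /F/= (indic_cellC k x y).
have E : \1_(stop k) x * \1_(cell k y) x = \1_(stop k) y * \1_(cell k y) x :> R.
  rewrite !indicE; case: (boolP (x \in cell k y)); rewrite ?mulr0// ?mulr1 inE => yx.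
  have -> // : (x \in stop k) = (y \in stop k).
  by apply/idP/idP; rewrite !inE; apply: stop_cell => //; exact: cell_sym.
rewrite -!EFinM; congr EFin; rewrite -[LHS]mulrA (mulrCA (\1_(stop k) x)) E.
by ring.
Qed.

Lemma leb_bigsetU_le (I : Type) (r : seq I) (A : I -> set V) (m : \bar R) :
  (forall i, measurable (A i)) -> (forall i, leb (A i) <= m)%E ->
  (leb (\big[setU/set0]_(i <- r) A i) <= (size r)%:R%:E * m)%E.
Proof.
move=> mA Am; elim: r => [|i r IH].
  by rewrite big_nil measure0 mul0e.
rewrite big_cons; apply: (@le_trans _ _ (leb (A i) + leb (\big[setU/set0]_(j <- r) A j))%E).
  by apply: measureU2 => //; exact: bigsetU_measurable.
have m0 : (0 <= m)%E by apply: le_trans (Am i).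
rewrite /= -natr1 EFinD ge0_muleDl ?lee_fin// mul1e addeC.
by apply: leeD.
Qed.

(** [stop k] with one layer of neighbouring cubes added. *)
Definition enlarged k : set V := \big[setU/set0]_(v : {ffun 'I_N -> 'I_3})
  (affine 1 (- offset k v) @^-1` stop k).

Lemma measurable_shifted_stop k (b : V) : measurable (affine 1 b @^-1` stop k).
Proof.
rewrite -[X in measurable X]setTI; apply: measurable_affine => //.
exact: measurable_stop.
Qed.

Lemma measurable_enlarged k : measurable (enlarged k).
Proof. by apply: bigsetU_measurable => v _; exact: measurable_shifted_stop. Qed.

Lemma leb_enlarged k : (leb (enlarged k) <= (3 ^+ N)%:E * leb (stop k))%E.
Proof.
have -> : 3 ^+ N = (size (index_enum {ffun 'I_N -> 'I_3}))%:R :> R.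
  by rewrite -natrX [index_enum _]unlock -enumT -cardT card_ffun !card_ord.
apply: leb_bigsetU_le => v; first exact: measurable_shifted_stop.
have := leb_affine (- offset k v) ltr01 (measurable_stop k).
by rewrite expr1n mul1e => <-.
Qed.

(** Outside a set of measure at most [3 ^ N / lam] times the integral of [g], all
    averages of [g] over small cubes centred at the point are at most a multiple
    of [lam]. *)
Lemma weak_type : exists E : set V, [/\ measurable E,
  (lam%:E * leb E <= (3 ^+ N)%:E * \int[leb]_x (g x)%:E)%E &
  forall x, ~ E x -> forall j,
    (\int[leb]_(y in ball x (2 ^- j)) (g y)%:E <= (3 ^+ N * (lam * (2 ^- j) ^+ N))%:E)%E].
Proof.
exists (\bigcup_k enlarged k); split.
- by apply: bigcupT_measurable => k; exact: measurable_enlarged.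
- have h1 : (leb (\bigcup_k enlarged k) <= \sum_(0 <= k <oo) (3 ^+ N)%:E * leb (stop k))%E.
    apply: (le_trans (generalized_Boole_inequality leb measurable_enlarged _)).
      by apply: bigcupT_measurable => k; exact: measurable_enlarged.
    by apply: lee_nneseries => k _ //; exact: leb_enlarged.
  apply: (le_trans (lee_wpmul2l _ h1)); first by rewrite lee_fin ltW.
  have N3 : 0 <= 3 ^+ N :> R by rewrite exprn_ge0.
  rewrite -nneseriesZl//; last by move=> k _; rewrite mule_ge0.
  rewrite (eq_eseriesr (g := fun k => (3 ^+ N)%:E * (lam%:E * leb (stop k)))%E); last first.
    by move=> k _; rewrite muleCA.
  rewrite nneseriesZl//; last by move=> k _; rewrite mule_ge0// lee_fin ltW.
  apply: lee_wpmul2l => //.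
  apply: (@le_trans _ _ (\sum_(0 <= k <oo) \int[leb]_(y in stop k) (g y)%:E)%E).
    apply: lee_nneseries => k _; last exact: leb_stop_le.
    by rewrite mule_ge0// lee_fin ltW.
  rewrite -(@ge0_integral_bigcup _ _ _ leb stop)//.
  - apply: ge0_subset_integral => //; apply: bigcupT_measurable; exact: measurable_stop.
  - exact: measurable_stop.
  - exact: measurable_funTS.
  - exact: trivIset_stop.
move=> x nE j.
have notbad v : (cell_int j (x + offset j v) <= (lam * (2 ^- j) ^+ N)%:E)%E.
  rewrite leNgt; apply/negP => bj; apply: nE.
  pose P k := `[< bad k (x + offset j v) >].
  have exP : exists k, P k by exists j; apply/asboolP.
  (* the first bad scale of a translate of [x] puts [x] in an enlarged set *)
  case: (ex_minnP exP) => k /asboolP bk mk.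
  have kj : (k <= j)%N by apply: mk; apply/asboolP.
  have stk : stop k (x + offset j v).
    by split => // i ik; move=> bi; have := mk i (introT (asboolP _) bi); rewrite leqNgt ik.
  have xv : `|(x + offset j v) - x| <= 2 ^- k.
    rewrite addrC addKr; apply: (@le_trans _ _ (2 ^- j)); last first.
      by rewrite lef_pV2 ?posrE ?pow2_gt0// ler_weXn2l// ler1n.
    apply: rV_norm_leP => [|i]; first by rewrite ltW// pow2V_gt0.
    rewrite !mxE normrM gtr0_norm ?pow2V_gt0// ler_piMr ?(ltW (pow2V_gt0 _))//.
    by have := ltn_ord (v i); case: (nat_of_ord (v i)) => [|[|[|//]]] _; rewrite ler_norml; apply/andP; split; lra.
  have [w Hw] := sub_offset xv; exists k => //; rewrite /enlarged -bigcup_seq.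
  exists w; first by rewrite /= mem_index_enum.
  by rewrite /= /affine scale1r; exact: stop_cell Hw stk.
rewrite (integral_indicE (measurable_rV_ball _ _)).
apply: (@le_trans _ _ (\int[leb]_y (\sum_(v : {ffun 'I_N -> 'I_3})
    ((g y)%:E * (\1_(cell j (x + offset j v)) y)%:E))%E)%E).
  have mi (A : set V) : measurable A ->
      measurable_fun setT (fun y => (g y)%:E * (\1_A y)%:E)%E.
    by move=> mA; apply: emeasurable_funM => //; apply/measurable_EFinP; exact: measurable_indic.
  apply: ge0_le_integral => //.
  - by move=> y _; rewrite mule_ge0// lee_fin.
  - by apply: mi; exact: measurable_rV_ball.
  - by apply: emeasurable_sum => v _; exact: (mi _ (measurable_cell j _)).
  move=> y _; have sum0 (P : pred {ffun 'I_N -> 'I_3}) :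
      (0 <= \sum_(v | P v) ((g y)%:E * (\1_(cell j (x + offset j v)) y)%:E))%E.
    by apply: sume_ge0 => v _; rewrite mule_ge0// lee_fin.
  rewrite indicE; case: (boolP (y \in _)) => [|_]; last by rewrite mule0.
  rewrite inE -ball_normE /= => /ltW/cell_neighbour[v yv].
  by rewrite (bigD1 v)//= indicE mem_set// leeDl.
rewrite ge0_integral_sum//; last 2 first.
- move=> v; apply: emeasurable_funM => //; apply/measurable_EFinP.
  by apply: measurable_indic; exact: measurable_cell.
- by move=> v y _; rewrite mule_ge0// lee_fin.
apply: (@le_trans _ _ (\sum_(v : {ffun 'I_N -> 'I_3}) (lam * (2 ^- j) ^+ N)%:E)%E).
  apply: lee_sum => v _; rewrite -integral_indicE; last exact: measurable_cell.
  exact: notbad.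
rewrite sumEFin lee_fin sumr_const card_ffun !card_ord -[leLHS]mulr_natl natrX.
by [].
Qed.

End weak_type.

End dyadic.

(** * Almost everywhere convergence of the approximate identity *)

Section ae_convergence.
Context {R : realType} {N : nat}.
Notation V := 'rV[R]_N.
Notation leb := (lebesgue_rV (R := R) N).
Implicit Types (f g h : V -> R[i]) (x y : V).
Variables (Phi : V -> R[i]) (C : R).
Hypothesis HC : kernel_bounds C Phi.
Hypothesis Phi1 : cint Phi = 1.

Let C_ge0 : 0 <= C. Proof. by case: HC. Qed.

Notation u s f := (convol (dilate s Phi) f).

(** The constant that compares kernel averages with averages over balls. *)
Definition avg_const : R := C * (3 ^+ N * 2 ^+ (N + N).+2 + 2 ^+ N.+1).

Lemma avg_const_ge0 : 0 <= avg_const.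
Proof. by rewrite mulr_ge0// addr_ge0// ?mulr_ge0 ?exprn_ge0. Qed.

Lemma dyadic_scale (s : R) : 0 < s -> s <= 1 ->
  exists j : nat, 2 ^- j.+1 < s <= 2 ^- j.
Proof.
move=> s0 s1; have [n sn] := exists_pow2_gt s^-1.
have {}sn : 2 ^- n < s by rewrite -[ltRHS]invrK ltf_pV2 ?posrE ?invr_gt0 ?exprn_gt0.
elim: n sn => [|n IH] sn; first by move: sn; rewrite expr0 invr1 ltNge s1.
have [/IH//|ns] := ltP (2 ^- n) s.
by exists n; rewrite sn.
Qed.

Lemma half_sum n : \sum_(0 <= k < n) (2 : R) ^- k <= 2.
Proof.
suff -> : \sum_(0 <= k < n) (2 : R) ^- k = 2 - 2 * 2 ^- n.
  by rewrite gerBl mulr_ge0// invr_ge0 exprn_ge0.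
elim: n => [|n IH]; first by rewrite big_nil expr0 invr1 mulr1 subrr.
by rewrite big_nat_recr//= IH exprS invfM; field; rewrite expf_neq0.
Qed.

(** If all averages of [g] over small balls around [x] are at most [lam], the
    kernel averages at small scales are controlled by [lam]. *)
Lemma kernel_average_le (g : V -> R) x (lam s : R) :
  measurable_fun setT g -> (forall x, 0 <= g x) -> 0 <= lam -> 0 < s -> s <= 1 ->
  leb.-integrable setT (EFin \o g) ->
  (forall j, \int[leb]_(y in ball x (2 ^- j)) (g y)%:E <=
     (3 ^+ N * (lam * (2 ^- j) ^+ N))%:E)%E ->
  (\int[leb]_y (cabs (dilate s Phi (x - y)) * g y)%:E <=
    (avg_const * (lam + s * \int[leb]_y g y))%:E)%E.
Proof.
move=> mg g0 lam0 s0 s1 gi gB; have [j /andP[js sj]] := dyadic_scale s0 s1.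
have sN0 : 0 <= s ^- N by rewrite invr_ge0 exprn_ge0// ltW.
have mge : measurable_fun setT (fun y => (g y)%:E) by exact/measurable_EFinP.
have mgA (A : set V) : measurable A ->
    measurable_fun setT (fun y => (g y)%:E * (\1_A y)%:E)%E.
  by move=> mA; apply: emeasurable_funM => //; apply/measurable_EFinP; exact: measurable_indic.
(* the weight is dominated by multiples of indicators of dyadic balls, except far from
   the origin, where it is at most [(2 ^ j) ^ - (N + 1)] *)
pose B k : set V := ball x (2 ^- (j - k)).
pose T k y : \bar R := ((shell_coef (N := N) k)%:E * ((g y)%:E * (\1_(B k) y)%:E))%E.
have mT k : measurable_fun setT (T k).
  by apply: emeasurable_funM => //; apply: mgA; exact: measurable_rV_ball.
have T0 k y : (0 <= T k y)%E.
  by rewrite /T -!EFinM lee_fin mulr_ge0 ?shell_coef_ge0// mulr_ge0.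
pose D y : \bar R := (((2 ^+ j) ^- N.+1)%:E * (g y)%:E)%E.
have mD : measurable_fun setT D by apply: emeasurable_funM.
have D0 y : (0 <= D y)%E by rewrite /D -EFinM lee_fin mulr_ge0// invr_ge0 exprn_ge0 ?exprn_ge0.
have mST : measurable_fun setT (fun y => \sum_(0 <= k < j.+1) T k y)%E.
  by apply: emeasurable_sum => k _; exact: mT.
have ST0 y : (0 <= \sum_(0 <= k < j.+1) T k y)%E by apply: sume_ge0.
apply: (@le_trans _ _ ((s ^- N * C)%:E *
    \int[leb]_y (\sum_(0 <= k < j.+1) T k y + D y))%E).
  rewrite -ge0_integralZl_EFin ?mulr_ge0//; last 2 first.
  - by move=> y _; rewrite adde_ge0.
  - exact: emeasurable_funD.
  apply: ge0_le_integral => //.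
  - by move=> y _; rewrite lee_fin mulr_ge0// cabs_ge0.
  - apply/measurable_EFinP; apply: measurable_funM => //.
    by apply: cmeas_cabs; apply: cmeas_reflect; exact: dilPhi_meas HC _.
  - by apply: emeasurable_funM => //; exact: emeasurable_funD.
  move=> y _; rewrite cabs_dilate//.
  set w := s^-1 *: (x - y).
  have wE : `|w| = s^-1 * `|x - y| by rewrite /w normrZ ger0_norm// invr_ge0 ltW.
  have -> : (\sum_(0 <= k < j.+1) T k y + D y)%E =
     (((\sum_(0 <= k < j.+1) shell_coef (N := N) k * \1_(B k) y) + (2 ^+ j) ^- N.+1) * g y)%:E.
    rewrite /T/D; under eq_bigr do rewrite -!EFinM.
    rewrite sumEFin -EFinM -EFinD mulrDl mulr_suml; congr (_ + _)%:E.
    by apply: eq_bigr => k _; rewrite -mulrA [g y * _]mulrC.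
  rewrite -EFinM lee_fin mulrA ler_wpM2r// -!mulrA ler_wpM2l//.
  apply: (le_trans (Phi_le_weight HC w)); rewrite ler_wpM2l//.
  have [wj|jw] := ltP `|w| (2 ^+ j); last first.
    rewrite (le_trans (weight_le_outside jw))// lerDr sumr_ge0// => k _.
    by rewrite mulr_ge0// shell_coef_ge0.
  rewrite (le_trans (weight_le_shells wj))// ler_wpDr ?invr_ge0 ?exprn_ge0 ?exprn_ge0//.
  apply: ler_sum_nat => k /andP[_ kj]; rewrite ler_wpM2l ?shell_coef_ge0//.
  rewrite [leLHS]indicE; case: (boolP (w \in _)) => [|_ //].
  rewrite inE ball0E wE ltr_pdivrMl// => wk.
  rewrite indicE mem_set// /B -ball_normE /=; apply: (lt_le_trans wk).
  rewrite (le_trans (ler_wpM2r _ sj)) ?exprn_ge0//.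
  by rewrite -(subnK (_ : k <= j)%N)// exprD addnK invfM -mulrA mulVf ?mulr1// expf_neq0.
have I0 : 0 <= \int[leb]_y g y by apply: Rintegral_ge0.
rewrite ge0_integralD//.
rewrite ge0_integral_sum//.
have -> : (\int[leb]_y D y = ((2 ^+ j) ^- N.+1 * \int[leb]_y g y)%:E)%E.
  rewrite /D ge0_integralZl_EFin; [|exact: measurableT|by move=> y _; rewrite lee_fin|
    exact: mge|by rewrite invr_ge0 exprn_ge0 ?exprn_ge0].
  by rewrite EFinM /Rintegral fineK//; exact: (integrable_fin_num _ gi).
have TB k : (k < j.+1)%N -> (\int[leb]_y T k y <=
    (shell_coef (N := N) k * (3 ^+ N * (lam * (2 ^- (j - k)) ^+ N)))%:E)%E.
  move=> kj; rewrite /T ge0_integralZl_EFin ?shell_coef_ge0//; last 2 first.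
  - by move=> y _; rewrite mule_ge0// lee_fin.
  - by apply: mgA; exact: measurable_rV_ball.
  rewrite [leRHS]EFinM; apply: lee_wpmul2l; first by rewrite lee_fin shell_coef_ge0.
  rewrite -integral_indicE//; last exact: measurable_rV_ball.
  exact: gB.
apply: (@le_trans _ _ ((s ^- N * C)%:E * (\sum_(0 <= k < j.+1)
   (shell_coef (N := N) k * (3 ^+ N * (lam * (2 ^- (j - k)) ^+ N))) +
   (2 ^+ j) ^- N.+1 * \int[leb]_y g y)%:E)%E).
  apply: lee_wpmul2l; first by rewrite lee_fin mulr_ge0.
  rewrite EFinD; apply: leeD2r; rewrite -sumEFin.
  rewrite big_nat [leRHS]big_nat; apply: lee_sum => k /andP[_ kj]; exact: TB.
rewrite -EFinM lee_fin /avg_const -!mulrA [s ^- N * _]mulrCA ler_wpM2l//.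
have sNj : s ^- N <= (2 ^+ j.+1) ^+ N.
  rewrite -[leRHS]invrK lef_pV2 ?posrE ?exprn_gt0 ?invr_gt0 ?exprn_gt0//.
  by rewrite -exprVn lerXn2r ?nnegrE ?invr_ge0 ?exprn_ge0 ?(ltW s0)// ltW.
set S := \sum_(_ <= _ < _) _.
have p0 : (2 : R) ^+ j != 0 by rewrite expf_neq0.
have S0 : 0 <= S.
  apply: sumr_ge0 => k _; rewrite mulr_ge0 ?shell_coef_ge0// mulr_ge0 ?exprn_ge0//.
  by rewrite mulr_ge0// exprn_ge0 ?invr_ge0 ?exprn_ge0.
apply: (@le_trans _ _ ((2 ^+ j.+1) ^+ N * (S + (2 ^+ j) ^- N.+1 * \int[leb]_y g y))).
  by rewrite ler_wpM2r// addr_ge0// mulr_ge0// invr_ge0 exprn_ge0 ?exprn_ge0.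
rewrite mulrDr mulrDl !mulrDr.
have h1 : (2 ^+ j.+1) ^+ N * S <= 3 ^+ N * 2 ^+ (N + N).+2 * lam.
  rewrite /S mulr_sumr.
  rewrite (_ : \sum_(_ <= _ < _) _ =
     \sum_(0 <= k < j.+1) (3 ^+ N * 2 ^+ (N + N).+1 * lam) * 2 ^- k); last first.
    apply: eq_big_nat => k /andP[_ kj].
    have -> : 2 ^- (j - k) = 2 ^+ k / 2 ^+ j :> R.
      by rewrite -{2}(subnK (_ : k <= j)%N)// exprD invfM mulrCA mulfV ?mulr1// expf_neq0.
    have k0 : (2 : R) ^+ k != 0 by rewrite expf_neq0.
    rewrite /shell_coef (exprS 2 j) !exprMn (exprS 2 (N + N)) exprD (exprS (2 ^+ k)) (exprS 2 N) exprVn.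
    by field; rewrite k0 !expf_neq0.
  rewrite -mulr_sumr (exprS 2 (N + N).+1) (_ : 3 ^+ N * (2 * _) * lam = 3 ^+ N * 2 ^+ (N + N).+1 * lam * 2); last by ring.
  by rewrite ler_wpM2l ?half_sum// mulr_ge0// mulr_ge0 ?exprn_ge0.
have h2 : (2 ^+ j.+1) ^+ N * ((2 ^+ j) ^- N.+1 * \int[leb]_y g y) <=
    2 ^+ N.+1 * (s * \int[leb]_y g y).
  rewrite (_ : _ * (_ * _) = 2 ^+ N.+1 * (2 ^- j.+1 * \int[leb]_y g y)); last first.
    rewrite (exprS 2 j) exprMn (exprS (2 ^+ j)) (exprS 2 N).
    by field; rewrite p0 expf_neq0.
  by rewrite ler_wpM2l ?exprn_ge0// ler_wpM2r// ltW.
have h3 : 0 <= 3 ^+ N * 2 ^+ (N + N).+2 * (s * \int[leb]_y g y).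
  by apply: mulr_ge0; apply: mulr_ge0; rewrite ?exprn_ge0 ?(ltW s0).
have h4 : 0 <= 2 ^+ N.+1 * lam by rewrite mulr_ge0 ?exprn_ge0.
lra.
Qed.

(** Convergence at a point as the scale tends to zero, and almost everywhere. *)
Definition conv_at f x := forall e : R, 0 < e -> exists2 d : R, 0 < d &
  forall s, 0 < s -> s < d -> cabs (u s f x - f x) <= e.

Definition conv_ae f := {ae leb, forall x, conv_at f x}.

Lemma conv_atD f g x : cintegrable f -> cintegrable g -> conv_at f x -> conv_at g x ->
  conv_at (fun x => f x + g x) x.
Proof.
move=> fi gi cf cg e e0; have e2 : 0 < e / 2 by rewrite divr_gt0.
have [d1 d10 H1] := cf _ e2; have [d2 d20 H2] := cg _ e2.
exists (Num.min d1 d2); first by rewrite lt_min d10.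
move=> s s0; rewrite lt_min => /andP[s1 s2]; rewrite (uD HC)//.
rewrite opprD addrACA (le_trans (cabsD _ _))//.
by have := H1 s s0 s1; have := H2 s s0 s2; lra.
Qed.

Lemma conv_atZ (a : R[i]) f x : cintegrable f -> conv_at f x ->
  conv_at (fun x => a * f x) x.
Proof.
move=> fi cf e e0; have a1 : 0 < cabs a + 1 by rewrite ltr_wpDl ?cabs_ge0.
have [d d0 H] := cf (e / (cabs a + 1)) (divr_gt0 e0 a1).
exists d => // s s0 sd; rewrite (uZ HC)// -mulrBr cabsM.
rewrite (le_trans (ler_wpM2l (cabs_ge0 a) (H s s0 sd)))//.
by rewrite mulrCA ler_piMr ?(ltW e0)// ler_pdivrMr// mul1r lerDl.
Qed.

Lemma conv_aeD f g : cintegrable f -> cintegrable g -> conv_ae f -> conv_ae g ->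
  conv_ae (fun x => f x + g x).
Proof. by move=> fi gi; apply: filterS2 => x; exact: conv_atD. Qed.

Lemma conv_aeZ (a : R[i]) f : cintegrable f -> conv_ae f -> conv_ae (fun x => a * f x).
Proof. by move=> fi; apply: filterS => x; exact: conv_atZ. Qed.

Lemma conv_aeB f g : cintegrable f -> cintegrable g -> conv_ae f -> conv_ae g ->
  conv_ae (fun x => f x - g x).
Proof.
move=> fi gi cf cg; have := conv_aeD fi (cintegrableZ (-1) gi) cf (conv_aeZ (-1) gi cg).
by under [X in conv_ae X -> _]eq_fun do rewrite mulN1r.
Qed.

Lemma conv_ae0 : conv_ae (fun=> 0).
Proof.
apply: aeW => x e e0; exists 1 => // s s0 s1.
have -> : u s (fun=> 0) x = 0.
  rewrite -[RHS](cint0 leb); apply: (@eq_cint _ _ _ leb) => y; by rewrite mulr0.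
by rewrite subrr cabs0 ltW.
Qed.

Lemma conv_ae_sum (I : Type) (r : seq I) (F : I -> V -> R[i]) :
  (forall i, cintegrable (F i)) -> (forall i, conv_ae (F i)) ->
  conv_ae (fun x => \sum_(i <- r) F i x).
Proof.
move=> iF cF; elim: r => [|i r IH].
  by under [X in conv_ae X]eq_fun do rewrite big_nil; exact: conv_ae0.
under [X in conv_ae X]eq_fun do rewrite big_cons.
by apply: conv_aeD => //; exact: cintegrable_sum.
Qed.

Lemma negligible_small (A : set V) :
  (forall e : R, 0 < e -> exists E, [/\ measurable E, A `<=` E & (leb E <= e%:E)%E]) ->
  leb.-negligible A.
Proof.
move=> H.
have /choice[E HE] (n : nat) : exists E, [/\ measurable E, A `<=` E &
   (leb E <= (n.+1%:R^-1)%:E)%E] by apply: H; rewrite invr_gt0.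
have mE : measurable (\bigcap_n E n).
  by apply: bigcapT_measurable => n; have [] := HE n.
exists (\bigcap_n E n); split => //; last first.
  by move=> x Ax n _; have [_ AE _] := HE n; exact: AE.
have le1 n : (leb (\bigcap_n E n) <= (n.+1%:R^-1)%:E)%E.
  have [mEn _ En] := HE n; apply: le_trans En; apply: le_measure; rewrite ?inE//.
  exact: bigcap_inf.
apply/eqP; rewrite eq_le measure_ge0 andbT; apply/lee_addgt0Pr => e e0.
rewrite add0e; apply: (le_trans (le1 (Num.truncn e^-1))); rewrite lee_fin.
rewrite -[leRHS]invrK lef_pV2 ?posrE ?invr_gt0//.
by rewrite ltW// truncnS_gt.
Qed.

(** The set where the modulus of [f] exceeds [a]. *)
Definition superlevel f (a : R) : set V := [set x | a < cabs (f x)].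

Lemma markov_cabs f (a : R) : 0 < a -> cintegrable f ->
  measurable (superlevel f a) /\
  (a%:E * leb (superlevel f a) <= (L1n f)%:E)%E.
Proof.
move=> a0 fi; have mf := cmeas_cabs (cintegrable_meas fi).
have mA : measurable (superlevel f a).
  rewrite -[X in measurable X]setTI.
  have := mf measurableT `]a, +oo[%classic (measurable_itv _).
  by rewrite (_ : _ @^-1` _ = superlevel f a)//; apply/seteqP; split => x /=;
    rewrite in_itv/= andbT.
split => //; rewrite -L1eE//.
rewrite (_ : leb _ = \int[leb]_x (\1_(superlevel f a) x)%:E)%E; last first.
  by rewrite integral_indic// setIT.
rewrite -ge0_integralZl_EFin; [|exact: measurableT|by move=> x _; rewrite lee_fin|
  by apply/measurable_EFinP; exact: measurable_indic|exact: ltW].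
apply: ge0_le_integral => //.
- by move=> x _; rewrite -EFinM lee_fin mulr_ge0// ltW.
- by apply: emeasurable_funM => //; apply/measurable_EFinP; exact: measurable_indic.
- exact/measurable_EFinP.
move=> x _; rewrite -EFinM lee_fin indicE; case: (boolP (x \in _)); last first.
  by rewrite mulr0 cabs_ge0.
by rewrite inE/= mulr1 => /ltW.
Qed.

Lemma L1nE f : cintegrable f -> L1n f = \int[leb]_x cabs (f x).
Proof. by []. Qed.

(** The weak-type estimate makes the class of functions with almost everywhere
    convergence closed in L^1. *)
Lemma conv_ae_lim f : cintegrable f ->
  (forall e : R, 0 < e -> exists g, [/\ cintegrable g, conv_ae g &
     L1n (fun x => f x - g x) <= e]) -> conv_ae f.
Proof.
move=> fi H.
pose B (m : nat) : set V := [set x | ~ exists2 d : R, 0 < d &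
   forall s, 0 < s -> s < d -> cabs (u s f x - f x) <= m.+1%:R^-1].
suff nB m : leb.-negligible (B m).
  apply: (@negligibleS _ _ _ _ (\bigcup_m B m)); last exact: negligible_bigcup.
  move=> x /= /existsNP[e /not_implyP[e0 He]]; exists (Num.truncn e^-1) => //.
  apply: contra_not He => -[d d0 Hd]; exists d => // s s0 sd.
  apply: (le_trans (Hd s s0 sd)); rewrite -[leRHS]invrK lef_pV2 ?posrE ?invr_gt0//.
  by rewrite ltW// truncnS_gt.
pose e : R := m.+1%:R^-1; have e0 : 0 < e by rewrite invr_gt0.
apply: negligible_small => dl dl0.
have A0 := avg_const_ge0; set A := avg_const in A0.
(* [lam] makes the averages of [f - g] at most [e / 4] off the exceptional set; [eta]
   makes the exceptional sets of [f - g] have measure at most [dl / 2] *)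
pose lam := e / 4 / (A + 1).
have A1 : 0 < A + 1 by rewrite ltr_wpDl.
have lam0 : 0 < lam by rewrite !divr_gt0.
have e4 : 0 < e / 4 by rewrite divr_gt0.
have p3 : 0 < (3 : R) ^+ N by rewrite exprn_gt0.
pose eta := Num.min (dl / 2 * (e / 4)) (dl / 2 * lam / 3 ^+ N).
have eta0 : 0 < eta by rewrite lt_min !mulr_gt0 ?invr_gt0// divr_gt0.
have [g [gi cg fg]] := H _ eta0.
pose h x := f x - g x; have hi : cintegrable h by exact: cintegrableB.
have mh : measurable_fun setT (fun x => cabs (h x)) := cmeas_cabs (cintegrable_meas hi).
have hI : leb.-integrable setT (EFin \o (fun x => cabs (h x))) := cintegrable_cabs hi.
have h0 x : 0 <= cabs (h x) by exact: cabs_ge0.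
have [E1 [mE1 E1le HE1]] := weak_type mh h0 lam0.
have [mE2 E2le] := markov_cabs e4 hi.
set E2 := superlevel h (e / 4) in mE2 E2le.
have [E3 [mE3 E30 HE3]] := cg.
exists (E1 `|` E2 `|` E3); split.
- by apply: measurableU => //; exact: measurableU.
- move=> x Bx; apply: contrapT => nE; apply: Bx; rewrite -/e.
  have n1 : ~ E1 x by move=> ?; apply: nE; left; left.
  have n2 : cabs (h x) <= e / 4.
    by rewrite leNgt; apply/negP => ?; apply: nE; left; right.
  have [d d0 Hd] : exists2 d : R, 0 < d &
      forall s, 0 < s -> s < d -> cabs (u s g x - g x) <= e / 4.
    apply: contrapT => n3; apply: nE; right; apply: HE3 => /=.
    by move=> /(_ (e / 4) e4).
  pose K := A * L1n h + 1.
  have K0 : 0 < K by rewrite ltr_wpDl// mulr_ge0// L1n_ge0.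
  exists (Num.min d (Num.min 1 (e / 4 / K))).
    by rewrite !lt_min d0 ltr01 divr_gt0.
  move=> s s0; rewrite !lt_min => /andP[sd /andP[s1 sK]].
  have uf : u s f x = u s h x + u s g x.
    rewrite -(uD HC x s0 hi gi); congr (convol _ _ _); apply/funext => y.
    by rewrite /h subrK.
  have -> : u s f x - f x = u s h x + (u s g x - g x) - h x.
    by rewrite uf /h opprB addrA (addrAC _ (g x)) -addrA; ring.
  have uh : cabs (u s h x) <= A * (lam + s * L1n h).
    rewrite -lee_fin L1nE//; apply: le_trans (kernel_average_le mh h0 (ltW lam0) s0 (ltW s1) hI (HE1 x n1)).
    apply: (le_trans (cabs_cint (dilPhi_section HC x s0 hi))).
    by rewrite le_eqVlt; apply/orP; left; apply/eqP; apply: eq_integral => y _; rewrite cabsM.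
  have Alam : A * lam <= e / 4.
    by rewrite /lam mulrCA ler_piMr ?(ltW e4)// ler_pdivrMr// mul1r lerDl.
  have As : A * (s * L1n h) <= e / 4.
    rewrite mulrCA; apply: (@le_trans _ _ (s * K)); first by rewrite ler_wpM2l ?(ltW s0)// lerDl.
    by rewrite -ler_pdivlMr// ltW.
  have := Hd s s0 sd; have := cabsB (u s h x + (u s g x - g x)) (h x).
  have := cabsD (u s h x) (u s g x - g x); rewrite mulrDr in uh; lra.
- have fE1 : (leb E1 <= (dl / 2)%:E)%E.
    rewrite -(@lee_pmul2l _ lam%:E)// ?lte_fin//; apply: (le_trans E1le).
    rewrite [X in ((3 ^+ N)%:E * X <= _)%E](_ : _ = (L1n h)%:E); last first.
      by rewrite -L1eE.
    rewrite -!EFinM lee_fin -ler_pdivlMl//; apply: (le_trans fg).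
    rewrite /eta ge_min (_ : 3 ^- N * _ = dl / 2 * lam / 3 ^+ N) ?lexx ?orbT//.
    by ring.
  have fE2 : (leb E2 <= (dl / 2)%:E)%E.
    rewrite -(@lee_pmul2l _ (e / 4)%:E)// ?lte_fin//; apply: (le_trans E2le).
    rewrite -EFinM lee_fin; apply: (le_trans fg).
    by rewrite /eta ge_min mulrC lexx.
  apply: (le_trans (measureU2 leb (measurableU _ _ mE1 mE2) mE3)).
  rewrite [X in (_ + X)%E]E30 adde0; apply: (le_trans (measureU2 leb mE1 mE2)).
  rewrite (_ : dl = dl / 2 + dl / 2); last by field.
  by rewrite EFinD; apply: leeD.
Qed.

End ae_convergence.

Lemma cabs_realB {R : realType} (a b : R) : cabs (a%:C%C - b%:C%C) = `|a - b|.
Proof. by rewrite -[X in cabs X](rmorphB (real_complex R)) cabs_real. Qed.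

Section ae_convergence_L1.
Context {R : realType} {N : nat}.
Notation V := 'rV[R]_N.
Notation leb := (lebesgue_rV (R := R) N).
Implicit Types (f g h : V -> R[i]) (x y : V).
Variables (Phi : V -> R[i]) (C : R).
Hypothesis HC : kernel_bounds C Phi.
Hypothesis Phi1 : cint Phi = 1.


Notation u s f := (convol (dilate s Phi) f).
Notation conv_at := (conv_at Phi).
Notation conv_ae := (conv_ae Phi).

(** First absolute moment of the kernel. *)
Definition moment : R := \int[leb]_x (cabs (Phi x) * `|x|).

Lemma moment_ge0 : 0 <= moment.
Proof. by apply: Rintegral_ge0 => x _; rewrite mulr_ge0// cabs_ge0. Qed.

Lemma dilate_moment (s : R) : 0 < s ->
  (\int[leb]_z (cabs (dilate s Phi z) * `|z|)%:E = (s * moment)%:E)%E.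
Proof.
move=> s0; have s1 : 0 < s^-1 by rewrite invr_gt0.
have sN : 0 < s ^+ N by rewrite exprn_gt0.
have mF : measurable_fun setT (fun x : V => (cabs (Phi x) * `|x|)%:E).
  apply/measurable_EFinP; apply: measurable_funM; last exact: measurable_rV_norm.
  exact/cmeas_cabs/(Phi_meas HC).
have F0 (x : V) : (0 <= (cabs (Phi x) * `|x|)%:E)%E.
  by rewrite lee_fin mulr_ge0// cabs_ge0.
have := ge0_integral_affine 0 s1 mF F0.
have -> : (\int[leb]_x (cabs (Phi x) * `|x|)%:E)%E = moment%:E.
  rewrite /moment /Rintegral fineK//.
  exact: (integrable_fin_num _ (Phi_moment_integrable HC)).
rewrite exprVn invrK -EFinM => H.
have -> : (s * moment)%:E = ((s / s ^+ N)%:E * (s ^+ N * moment)%:E)%E.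
  by rewrite -EFinM; congr EFin; field; rewrite gt_eqF.
rewrite -H -ge0_integralZl_EFin; [|exact: measurableT|by move=> x _; exact: F0| |].
- apply: eq_integral => z _; rewrite /affine addr0 cabs_dilate// -EFinM; congr EFin.
  rewrite normrZ ger0_norm ?(ltW s1)//.
  by field; rewrite !gt_eqF.
- exact: (measurableT_comp mF (measurable_affine _ _)).
- by rewrite divr_ge0// ltW.
Qed.

(** Pointwise convergence with rate when [g] has a Lipschitz bound at [x]. *)
Lemma u_sub_le g x (L s : R) : cintegrable g -> 0 <= L -> 0 < s ->
  (forall z, cabs (g (x - z) - g x) <= L * `|z|) ->
  cabs (u s g x - g x) <= L * (s * moment).
Proof.
move=> gi L0 s0 gL; have [di d1] := dilate_integrable s0 (Phi_integrable HC).
have si := dilPhi_section HC x s0 gi.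
have si' : cintegrable (fun z => dilate s Phi z * g (x - z)).
  have := (cint_reflect x si).1; rewrite (_ : (fun _ => _) = (fun z => dilate s Phi z * g (x - z)))//.
  by apply/funext => z; rewrite subKr.
have ci : cintegrable (fun z => dilate s Phi z * g x).
  under eq_fun do rewrite mulrC; exact: cintegrableZ.
have -> : u s g x - g x = cint (fun z => dilate s Phi z * (g (x - z) - g x)).
  rewrite (_ : (fun z => dilate s Phi z * (g (x - z) - g x)) =
     (fun z => dilate s Phi z * g (x - z) - dilate s Phi z * g x)); last first.
    by apply/funext => z; rewrite mulrBr.
  rewrite [RHS](cintB si' ci); congr (_ - _).
    rewrite convolC_at//; apply: (@eq_cint _ _ _ leb) => z; exact: mulrC.
  under eq_fun do rewrite mulrC.
  by rewrite [RHS](cintZ _ di) [X in _ * X]d1 Phi1 mulr1.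
have ti : cintegrable (fun z => dilate s Phi z * (g (x - z) - g x)).
  have := cintegrableB si' ci; rewrite (_ : (fun _ => _) = (fun z => dilate s Phi z * (g (x - z) - g x)))//.
  by apply/funext => z; rewrite mulrBr.
rewrite -lee_fin EFinM -dilate_moment//.
have mD : measurable_fun setT (fun z : V => cabs (dilate s Phi z) * `|z|).
  apply: measurable_funM; last exact: measurable_rV_norm.
  exact/cmeas_cabs/(dilPhi_meas HC).
rewrite -ge0_integralZl_EFin; [|exact: measurableT|
  by move=> z _; rewrite lee_fin mulr_ge0// cabs_ge0|exact/measurable_EFinP|exact: L0].
apply: (cabs_cint_le (g := fun z => L * (cabs (dilate s Phi z) * `|z|))) => //.
  exact: measurable_funM.
by move=> z; rewrite cabsM mulrCA ler_wpM2l ?cabs_ge0.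
Qed.

(** Membership in a half-open interval is stable under perturbations smaller than the
    distance to both end points. *)
Lemma near_itv (a b t z : R) : `|z| < `|t - a| -> `|z| < `|t - b| ->
  (a < t - z <= b) = (a < t <= b).
Proof.
case: (ger0P (t - a)) => ta; case: (ger0P (t - b)) => tb; case: (ger0P z) => z0 h1 h2;
  apply/idP/idP => /andP[h3 h4]; apply/andP; split; lra.
Qed.

(** Complex-valued indicator functions. *)
Definition cindic (A : set V) : V -> R[i] := fun x => ((\1_A x)%:C)%C.

Lemma cindic_integrable (A : set V) : measurable A -> (leb A < +oo)%E ->
  cintegrable (cindic A).
Proof.
move=> mA Ay; apply/(cintegrableP leb); split.
  by apply: cmeas_real; exact: measurable_indic.
rewrite (_ : (\int[leb]_x _)%E = leb A)// -[RHS]/(leb A) -[in RHS](setIT A).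
rewrite -integral_indic//; apply: eq_integral => x _.
by rewrite cabs_real ger0_norm.
Qed.

(** The indicator of a box is locally constant off the hyperplanes that carry its
    faces. *)
Lemma conv_at_box (a b x : V) :
  (forall i, x ord0 i != a ord0 i /\ x ord0 i != b ord0 i) ->
  conv_at (cindic (box a b)) x.
Proof.
move=> xab; pose F (i : 'I_N) := Num.min `|x ord0 i - a ord0 i| `|x ord0 i - b ord0 i|.
pose rho := \big[Num.min/1]_i F i.
have rho0 : 0 < rho.
  apply/bigmin_gtP; split => [|i _]; first exact: ltr01.
  by have [xa xb] := xab i; rewrite lt_min !normr_gt0 !subr_eq0 xa xb.
have rhoi i : rho <= F i by exact: bigmin_le.
have near z : `|z| < rho -> \1_(box a b) (x - z) = \1_(box a b) x :> R.
  move=> zr; rewrite !indicE; have -> // : (x - z \in box a b) = (x \in box a b).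
  have zi i : `|z ord0 i| < `|x ord0 i - a ord0 i| /\ `|z ord0 i| < `|x ord0 i - b ord0 i|.
    apply/andP; rewrite -lt_min; apply: lt_le_trans (rhoi i).
    exact: le_lt_trans (rV_coord_le z i) zr.
  by apply/idP/idP; rewrite !inE => H i; have := H i; rewrite /= !mxE !in_itv/=;
    have [h1 h2] := zi i; rewrite near_itv.
have L0 : 0 <= rho^-1 by rewrite invr_ge0 ltW.
have bi : cintegrable (cindic (box a b)).
  by apply: cindic_integrable; [exact: measurable_box|exact: box_lty].
have bL z : cabs (cindic (box a b) (x - z) - cindic (box a b) x) <= rho^-1 * `|z|.
  rewrite /cindic; have [zr|rz] := ltP `|z| rho.
    by rewrite near// subrr cabs0 mulr_ge0.
  rewrite cabs_realB; apply: (@le_trans _ _ 1).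
    rewrite !indicE; case: (_ \in _); case: (_ \in _); rewrite ?subrr ?normr0//=.
      by rewrite subr0 normr1.
    by rewrite sub0r normrN normr1.
  by rewrite mulrC ler_pdivlMr// mul1r.
move=> e e0; pose K := rho^-1 * moment + 1.
have K0 : 0 < K by rewrite ltr_wpDl// mulr_ge0// moment_ge0.
exists (e / K) => [|s s0 sd]; first by rewrite divr_gt0.
apply: (le_trans (u_sub_le bi L0 s0 bL)).
rewrite ltr_pdivlMr// in sd; apply: le_trans (ltW sd).
by rewrite mulrCA ler_wpM2l ?(ltW s0)// lerDl.
Qed.

Lemma hyperplane_negligible (i : 'I_N) (c : R) :
  leb.-negligible [set x : V | x ord0 i = c].
Proof.
pose A (j : 'I_N) : set (measurableTypeR R) := if j == i then [set c] else setT.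
have mA j : measurable (A j) by rewrite /A; case: ifP => // _; exact: measurable_set1.
have -> : [set x : V | x ord0 i = c] = [set x : V | forall j, A j (x ord0 j)].
  apply/seteqP; split => x /= H.
    by move=> j; rewrite /A; case: eqP => [->|].
  by have := H i; rewrite /A eqxx.
apply/negligibleP; first exact: measurable_forall_coord.
transitivity (\prod_(j < N) lebesgue_measure (A j))%E; first exact: lebesgue_rV_box.
by rewrite (bigD1 i)//= {1}/A eqxx [X in (X * _)%E]lebesgue_measure_set1 mul0e.
Qed.

Lemma ae_forall_ord (P : 'I_N -> V -> Prop) :
  (forall i, {ae leb, forall x, P i x}) -> {ae leb, forall x, forall i, P i x}.
Proof.
move=> H; apply: (@negligibleS _ _ _ _ (\bigcup_k
   (if insub k is Some i then ~` [set x | P i x] else set0))).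
  move=> x /= /existsNP[i Pi]; exists (nat_of_ord i) => //.
  by rewrite insubT// => ltik; rewrite (_ : Sub _ _ = i)//; exact: val_inj.
apply: negligible_bigcup => k; case: insubP => [i _ _|_]; first exact: H.
exact: negligible_set0.
Qed.

Lemma conv_ae_box (a b : V) : conv_ae (cindic (box a b)).
Proof.
have : {ae leb, forall x, forall i, x ord0 i != a ord0 i /\ x ord0 i != b ord0 i}.
  apply: ae_forall_ord => i; apply: (@filterS2 _ _ _ (fun x : V => x ord0 i != a ord0 i)
    (fun x : V => x ord0 i != b ord0 i)); first by [].
    apply: negligibleS (hyperplane_negligible i (a ord0 i)) => x /= /negP.
    by rewrite negbK => /eqP.
  apply: negligibleS (hyperplane_negligible i (b ord0 i)) => x /= /negP.
  by rewrite negbK => /eqP.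
by apply: filterS => x; exact: conv_at_box.
Qed.

Lemma L1n_cindicB (A B : set V) : measurable A -> measurable B -> B `<=` A ->
  (leb A < +oo)%E ->
  L1n (fun x => cindic A x - cindic B x) = fine (leb A) - fine (leb B).
Proof.
move=> mA mB BA Ay; have By : (leb B < +oo)%E.
  by apply: le_lt_trans Ay; apply: le_measure; rewrite ?inE.
have mAB : measurable (A `\` B) by exact: measurableD.
transitivity (fine (leb (A `\` B))).
  congr fine; rewrite -[RHS]/(leb (A `\` B)) -[in RHS](setIT (A `\` B)) -integral_indic//.
  apply: eq_integral => x _; rewrite /cindic cabs_realB; congr EFin.
  rewrite !indicE in_setD; have [xA|xA] := boolP (x \in A); have [xB|xB] := boolP (x \in B) => //=.
  - by rewrite subrr normr0.
  - by rewrite subr0 normr1.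
  - by move: xB xA; rewrite !inE => /BA/mem_set/= -> .
  - by rewrite subrr normr0.
have /(congr1 fine) := measureD mA mB Ay; rewrite setIidr// => ->.
by rewrite fineB// ge0_fin_numE.
Qed.

(** An exhausting sequence of boxes. *)
Definition cube (n : nat) : set V := box (- const_mx n%:R) (const_mx n%:R).

(** From boxes to bounded measurable sets by Dynkin's theorem; the limit step uses that
    almost everywhere convergence passes to [L^1] limits. *)
Lemma conv_ae_indic_cube (A : set V) n : measurable A ->
  conv_ae (cindic (A `&` cube n)).
Proof.
pose H : set (set V) := [set A | measurable A /\ conv_ae (cindic (A `&` cube n))].
have mQ : measurable (cube n) by exact: measurable_box.
have fin (B : set V) : measurable B -> (leb (B `&` cube n) < +oo)%E.
  move=> mB; apply: le_lt_trans (box_lty (- const_mx n%:R) (const_mx n%:R)).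
  by apply: le_measure; rewrite ?inE//; apply: measurableI.
have ci (B : set V) : measurable B -> cintegrable (cindic (B `&` cube n)).
  by move=> mB; apply: cindic_integrable; [exact: measurableI|exact: fin].
have Dset (B D : set V) : (D `<=` B) ->
    (fun x => cindic (B `&` cube n) x - cindic (D `&` cube n) x) =
    cindic ((B `\` D) `&` cube n).
  move=> DB; apply/funext => x; rewrite /cindic -[LHS](rmorphB (real_complex R)); congr (_ %:C)%C.
  rewrite !indicE 3!in_setI in_setD; have [xB|xB] := boolP (x \in B);
    have [xD|xD] := boolP (x \in D); have [xQ|xQ] := boolP (x \in cube n);
    rewrite /= ?subrr ?subr0//.
  by move: xD xB; rewrite inE => /DB/mem_set ->.
rewrite measurable_boxes => sA; suff [] : H A by [].
apply: (@lambda_system_subset _ boxes boxes_setI setT H _ _ _ A sA); last first.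
- by [].
- move=> _ [[a b] _ <-]; split; first exact: measurable_box.
  by have [[c d] _ <-] := boxes_setI (boxes_box a b) (boxes_box (- const_mx n%:R) (const_mx n%:R));
    exact: conv_ae_box.
- split.
  + by [].
  + split; first exact: measurableT.
    by rewrite setTI; exact: conv_ae_box.
  + move=> B D DB [mB cB] [mD cD]; split; first exact: measurableD.
    by rewrite -(Dset _ _ DB); exact: (conv_aeB HC (ci _ mB) (ci _ mD) cB cD).
  + move=> F ndF HF; have mF k : measurable (F k) by have [] := HF k.
    split; first exact: bigcup_measurable.
    rewrite setI_bigcupl.
    pose G k := F k `&` cube n.
    have mG k : measurable (G k) by exact: measurableI.
    have mU : measurable (\bigcup_k G k) by exact: bigcup_measurable.
    have Uy : (leb (\bigcup_k G k) < +oo)%E.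
      apply: le_lt_trans (box_lty (- const_mx n%:R) (const_mx n%:R)).
      apply: le_measure; rewrite ?inE//.
      by apply: bigcup_sub => k _ x [].
    have ndG : {homo G : a b / (a <= b)%N >-> (a <= b)%O}.
      move=> a b ab; apply/subsetPset; apply: setSI; apply/subsetPset; exact: ndF.
    have cE := nondecreasing_cvg_mu (mu := leb) mG mU ndG.
    have cG : (fine (leb (G k)) @[k --> \oo] --> fine (leb (\bigcup_k G k))).
      by apply: fine_cvg; rewrite fineK// ge0_fin_numE.
    apply: (conv_ae_lim HC (cindic_integrable mU Uy)) => e e0.
    have /cvgrPdist_le /(_ e e0) [k _ /(_ k (leqnn k)) /= Hk] := cG.
    exists (cindic (G k)); split; [exact: ci|by have [] := HF k|].
    rewrite L1n_cindicB//; last exact: bigcup_sup.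
    exact: le_trans (ler_norm _) Hk.
Qed.

End ae_convergence_L1.

Lemma opprB_ACA (T : zmodType) (a b c d : T) : a - b - (c - d) = a - c - (b - d).
Proof. by rewrite !opprD !opprK addrACA. Qed.

Section dominated_tails.
Context {R : realType} {N : nat}.
Notation V := 'rV[R]_N.
Notation leb := (lebesgue_rV (R := R) N).
Implicit Types (x y : V).

(** Dominated convergence to zero, in epsilon form. *)
Lemma dominated_small (F : nat -> V -> \bar R) (G : V -> \bar R) :
  (forall n, measurable_fun setT (F n)) -> (forall n x, 0 <= F n x <= G x)%E ->
  leb.-integrable setT G ->
  {ae leb, forall x, forall e : R, 0 < e ->
    exists n0, forall n, (n0 <= n)%N -> (F n x <= e%:E)%E} ->
  forall e : R, 0 < e -> exists n0, forall n, (n0 <= n)%N ->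
    (\int[leb]_x F n x <= e%:E)%E.
Proof.
move=> mF FG iG F0 e e0.
have m0 : measurable_fun setT (fun _ : V => 0 : \bar R) by exact: measurable_cst.
have c0 : {ae leb, forall x : V, setT x -> F n x @[n --> \oo] --> (0 : \bar R)}.
  apply: filterS F0 => x Fx _; apply/fine_cvgP; split.
    have [n0 Hn0] := Fx 1 ltr01; exists n0 => // n /= n0n.
    have /andP[a b] := FG n x.
    by rewrite ge0_fin_numE// (le_lt_trans (Hn0 n n0n))// ltry.
  apply/cvgrPdist_le => d d0; have [n0 Hn0] := Fx d d0; exists n0 => // n /= n0n.
  have /andP[a _] := FG n x; have b := Hn0 n n0n.
  have fx : F n x \is a fin_num by rewrite ge0_fin_numE// (le_lt_trans b)// ltry.
  rewrite sub0r normrN ger0_norm ?fine_ge0// -lee_fin fineK//.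
have dG : {ae leb, forall x : V, forall n, setT x -> (`|F n x| <= G x)%E}.
  apply: aeW => x n _; have /andP[a b] := FG n x; by rewrite gee0_abs.
have [_ _] := dominated_convergence measurableT mF m0 c0 iG dG.
rewrite integral0 => /fine_cvgP[[n1 _ fin]] /cvgrPdist_le/(_ e e0)[n2 _ H].
exists (maxn n1 n2) => n; rewrite geq_max => /andP[n1n n2n].
have fn : (\int[leb]_x F n x)%E \is a fin_num := fin n n1n.
rewrite -(fineK fn) lee_fin.
by have := H n n2n; rewrite /= sub0r normrN; apply: le_trans; exact: ler_norm.
Qed.

(** The complement of an open ball centred at the origin. *)
Definition far (r : R) : set V := [set x | r <= `|x|].

Lemma measurable_far r : measurable (far r).
Proof.
rewrite -[X in measurable X]setTI.
have := @measurable_rV_norm R N measurableT `[r, +oo[%classic (measurable_itv _).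
by rewrite (_ : _ @^-1` _ = far r)//; apply/seteqP; split => x /=; rewrite in_itv/= andbT.
Qed.

Lemma measurable_mul_indic (F : V -> \bar R) (A : set V) : measurable_fun setT F ->
  measurable A -> measurable_fun setT (fun x => F x * (\1_A x)%:E)%E.
Proof.
by move=> mF mA; apply: emeasurable_funM => //; apply/measurable_EFinP; exact: measurable_indic.
Qed.

Lemma mul_indic_ge0 (F : V -> \bar R) (A : set V) x : (0 <= F x)%E ->
  (0 <= F x * (\1_A x)%:E <= F x)%E.
Proof.
move=> F0; rewrite indicE; case: (x \in A); first by rewrite mule1 lexx F0.
by rewrite mule0 lexx F0.
Qed.

Lemma far_integral_small (F : V -> \bar R) : (forall x, 0 <= F x)%E ->
  leb.-integrable setT F -> forall e : R, 0 < e ->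
  exists n0, forall n, (n0 <= n)%N -> (\int[leb]_x (F x * (\1_(far n%:R) x)%:E) <= e%:E)%E.
Proof.
move=> F0 Fi; apply: (dominated_small (G := F)) => //.
- move=> n; apply: measurable_mul_indic; [exact: (measurable_int leb Fi)|exact: measurable_far].
- by move=> n x; exact: mul_indic_ge0.
apply: aeW => x e e0; exists (Num.truncn `|x|).+1 => n xn.
rewrite indicE memNset ?mule0 ?lee_fin ?(ltW e0)// /far /=.
apply/negP; rewrite -ltNge; apply: (lt_le_trans (truncnS_gt _)).
by rewrite ler_nat.
Qed.

End dominated_tails.

Import HBSimple.

Section ae_convergence_general.
Context {R : realType} {N : nat}.
Notation V := 'rV[R]_N.
Notation leb := (lebesgue_rV (R := R) N).
Implicit Types (f g h : V -> R[i]) (x y : V).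
Variables (Phi : V -> R[i]) (C : R).
Hypothesis HC : kernel_bounds C Phi.
Hypothesis Phi1 : cint Phi = 1.


Notation u s f := (convol (dilate s Phi) f).
Notation conv_at := (conv_at Phi).
Notation conv_ae := (conv_ae Phi).

Lemma cintegrable_real (f : V -> R) : leb.-integrable setT (EFin \o f) ->
  cintegrable (fun x => (f x)%:C%C).
Proof. by move=> fi; split => //; exact: integrable0. Qed.

Lemma notin_cube n x : ~ cube n x -> far n%:R x.
Proof.
move=> nQ; apply: contrapT => /negP; rewrite /far/= -ltNge => xn; apply: nQ => i.
rewrite /= !mxE in_itv/=; have := le_lt_trans (rV_coord_le x i) xn.
by rewrite ltr_norml => /andP[-> /ltW].
Qed.

Lemma sfun_cube_sum (h : {sfun V >-> R}) n :
  (fun x : V => (h x)%:C%C * cindic (cube n) x) =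
  (fun x => \sum_(y <- finmap.enum_fset (fset_set (range h)))
     y%:C%C * cindic (h @^-1` [set y] `&` cube n) x).
Proof.
apply/funext => x; rewrite {1}(fimfunE h) fsbig_finite; last exact: fimfunP.
rewrite rmorph_sum mulr_suml; apply: eq_bigr => y _.
rewrite rmorphM/= -mulrA; congr (_ * _); rewrite /cindic -rmorphM/= !indicE in_setI.
by case: (_ \in _); case: (_ \in _); rewrite /= ?mulr1 ?mulr0 ?mul0r.
Qed.

Lemma sfun_preimage_measurable (h : {sfun V >-> R}) (y : R) :
  measurable (h @^-1` [set y] : set V).
Proof. by rewrite -[X in measurable X]setTI; exact: measurable_funPT. Qed.

Lemma cube_lty (A : set V) n : measurable A -> (leb (A `&` cube n) < +oo)%E.
Proof.
move=> mA; apply: le_lt_trans (box_lty (- const_mx n%:R) (const_mx n%:R)).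
by apply: le_measure; rewrite ?inE//; [apply: measurableI => //|]; exact: measurable_box.
Qed.

Lemma conv_ae_sfun_cube (h : {sfun V >-> R}) n :
  cintegrable (fun x : V => (h x)%:C%C * cindic (cube n) x) /\
  conv_ae (fun x : V => (h x)%:C%C * cindic (cube n) x).
Proof.
have ci (y : R) : cintegrable (cindic (h @^-1` [set y] `&` cube n)).
  apply: cindic_integrable; last first.
    by apply: cube_lty; exact: sfun_preimage_measurable.
  by apply: measurableI; [exact: sfun_preimage_measurable|exact: measurable_box].
have cj (y : R) : cintegrable (fun x => y%:C%C * cindic (h @^-1` [set y] `&` cube n) x).
  exact: (cintegrableZ _ (ci y)).
rewrite sfun_cube_sum; split; first exact: cintegrable_sum.
apply: (conv_ae_sum HC) => // y; apply: (conv_aeZ HC _ (ci y)).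
apply: (conv_ae_indic_cube HC Phi1).
exact: sfun_preimage_measurable.
Qed.

Lemma conv_ae_sfun (h : {sfun V >-> R}) : leb.-integrable setT (EFin \o h) ->
  conv_ae (fun x : V => (h x)%:C%C).
Proof.
move=> hi; have ci := cintegrable_real hi; apply: (conv_ae_lim HC ci) => e e0.
have [n0 /(_ n0 (leqnn _)) Hn] := far_integral_small (fun x => cabs_ge0 _ : 0 <= (cabs ((h x)%:C%C))%:E)%E (cintegrable_cabs ci) e0.
have [gi cg] := conv_ae_sfun_cube h n0.
exists (fun x : V => (h x)%:C%C * cindic (cube n0) x); split => //.
have di := cintegrableB ci gi; rewrite -lee_fin -(L1eE di).
apply: le_trans Hn; apply: ge0_le_integral => //.
- by move=> x _; rewrite lee_fin cabs_ge0.
- exact: cmeas_cabse (cintegrable_meas di).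
- apply: measurable_mul_indic; last exact: measurable_far.
  exact: cmeas_cabse (cintegrable_meas ci).
move=> x _; have [xQ|xQ] := pselect (cube n0 x).
  rewrite /cindic indicE mem_set// mulr1 subrr cabs0.
  by rewrite mule_ge0// lee_fin ?cabs_ge0.
rewrite /cindic indicE memNset// mulr0 subr0 indicE mem_set ?mule1//.
exact: notin_cube.
Qed.

Lemma conv_ae_real (f : V -> R) : leb.-integrable setT (EFin \o f) ->
  conv_ae (fun x : V => (f x)%:C%C).
Proof.
move=> fi; have ci := cintegrable_real fi; apply: (conv_ae_lim HC ci) => e e0.
have [g [gi _]] := approximation_sfun_integrable measurableT fi.
move=> /fine_cvgP[[n1 _ fin]] /cvgrPdist_le/(_ e e0)[n2 _ H].
pose n := maxn n1 n2; exists (fun x => (g n x)%:C%C); split.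
- exact: (cintegrable_real (gi n)).
- exact: (conv_ae_sfun (gi n)).
have := H n (leq_maxr _ _); rewrite /= sub0r normrN; apply: le_trans.
apply: le_trans (ler_norm _).
rewrite le_eqVlt; apply/orP; left; apply/eqP; congr fine; apply: eq_integral => x _.
by rewrite cabs_realB.
Qed.

(** The approximate identity converges almost everywhere on [L^1]. *)
Lemma conv_ae_L1 f : cintegrable f -> conv_ae f.
Proof.
move=> fi; have [f1 f2] := fi.
have -> : f = (fun x => (complex.Re (f x))%:C%C + 'i%C * (complex.Im (f x))%:C%C).
  by apply/funext => x; rewrite -complexE//; case: (f x).
have i1 := cintegrable_real f1; have i2 := cintegrable_real f2.
apply: (conv_aeD HC i1); first exact: cintegrableZ.
  exact: conv_ae_real.
by apply: (conv_aeZ HC _ i2); exact: conv_ae_real.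
Qed.

Lemma le_maximal_ae f : cintegrable f ->
  {ae leb, forall x, ((cabs (f x))%:E <= maximal_fun Phi f x)%E}.
Proof.
move=> fi; apply: filterS (conv_ae_L1 fi) => x cx; apply/lee_addgt0Pr => e e0.
have [d d0 H] := cx e e0; have d2 : 0 < d / 2 by rewrite divr_gt0.
have dd : d / 2 < d by rewrite ltr_pdivrMr// ltr_pMr// ltr1n.
apply: le_trans (leeD (u_le_maximal Phi f x d2) (lexx _)).
rewrite -EFinD lee_fin.
have := H _ d2 dd; have := cabsB (u (d / 2) f x) (u (d / 2) f x - f x).
by rewrite subKr; lra.
Qed.

(** The Hardy norm controls the [L^1] norm. *)
Lemma L1e_le_Hnorm f : cintegrable f -> (L1e f <= Hnorm Phi f)%E.
Proof.
move=> fi; rewrite HnormE; apply: ae_ge0_le_integral.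
- exact: measurableT.
- by move=> x _; rewrite lee_fin cabs_ge0.
- exact: cmeas_cabse (cintegrable_meas fi).
- by move=> x _; exact: maximal_ge0.
- exact: (measurable_maximal HC fi).
- by apply: filterS (le_maximal_ae fi).
Qed.

Lemma L1n_le_hardy_norm f : hardy Phi f -> L1n f <= hardy_norm Phi f.
Proof.
move=> fh; have [fi _] := fh.
by have := L1e_le_Hnorm fi; rewrite (L1eE fi) (hardy_normE HC fh) lee_fin.
Qed.

(** The oscillation of the scales below [d]. *)
Definition osc (d : R) f x : \bar R := ereal_sup
  [set (cabs (u s.1 f x - u s.2 f x))%:E |
    s in [set s : R * R | (0 < s.1 < d) && (0 < s.2 < d)]].

Lemma le_osc (d s t : R) f x : 0 < s < d -> 0 < t < d ->
  ((cabs (u s f x - u t f x))%:E <= osc d f x)%E.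
Proof. by move=> sd td; apply: ereal_sup_ubound; exists (s, t) => //=; rewrite sd. Qed.

Lemma osc_ge0 (d : R) f x : 0 < d -> (0 <= osc d f x)%E.
Proof.
move=> d0; have d2 : 0 < d / 2 < d.
  by rewrite divr_gt0//= ltr_pdivrMr// ltr_pMr// ltr1n.
by apply: le_trans (le_osc f x d2 d2); rewrite subrr cabs0.
Qed.

Lemma osc_le_maximal (d : R) f x :
  (osc d f x <= maximal_fun Phi f x + maximal_fun Phi f x)%E.
Proof.
apply: ge_ereal_sup => _ [[s t] st <-].
rewrite [leLHS](_ : _ = (cabs (u s f x - u t f x))%:E)//.
have /andP[/andP[s0 _] /andP[t0 _]] := st : (0 < s < d) && (0 < t < d).
apply: (@le_trans _ _ ((cabs (u s f x))%:E + (cabs (u t f x))%:E)%E).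
  by rewrite -EFinD lee_fin cabsB.
by apply: leeD; exact: u_le_maximal.
Qed.

Lemma measurable_osc (d : R) f : cintegrable f -> measurable_fun setT (osc d f).
Proof.
move=> fi; apply: (@measurable_sup_continuous _ _ _
  [set s : R * R | (0 < s.1 < d) && (0 < s.2 < d)]
  (fun s x => cabs (u s.1 f x - u s.2 f x))).
move=> [s t] /= /andP[/andP[s0 _] /andP[t0 _]].
have ls := u_lipschitz HC s0 fi; have lt := u_lipschitz HC t0 fi.
apply: (@clipschitz_cabs _ _ (s ^- N * (C * s^-1) * L1n f + t ^- N * (C * t^-1) * L1n f)
  (fun x => u s f x - u t f x)) => x y.
rewrite mulrDl [X in cabs X](opprB_ACA (u s f x)); apply: (le_trans (cabsB _ _)); apply: lerD; [exact: ls|exact: lt].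
Qed.

(** By dominated convergence: the oscillation tends to zero almost everywhere and is at
    most twice the maximal function. *)
Lemma osc_small f : hardy Phi f -> forall e : R, 0 < e ->
  exists2 d : R, 0 < d & (\int[leb]_x osc d f x <= e%:E)%E.
Proof.
move=> [fi Mi] e e0.
have d0 n : 0 < n.+1%:R^-1 :> R by rewrite invr_gt0.
suff [n0 H] : exists n0, forall n, (n0 <= n)%N ->
   (\int[leb]_x osc n.+1%:R^-1 f x <= e%:E)%E.
  by exists (n0.+1%:R^-1) => //; exact: (H n0 (leqnn _)).
apply: (dominated_small (F := fun n => osc n.+1%:R^-1 f)
  (G := fun x => maximal_fun Phi f x + maximal_fun Phi f x)%E) => //.
- by move=> n; exact: measurable_osc.
- by move=> n x; rewrite osc_ge0// osc_le_maximal.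
- exact: integrableD.
apply: filterS (conv_ae_L1 fi) => x cx {}e {}e0.
have e2 : 0 < e / 2 by rewrite divr_gt0.
have [d dp H] := cx _ e2; exists (Num.truncn d^-1) => n nd.
apply: ge_ereal_sup => _ [[s t] st <-].
rewrite [leLHS](_ : _ = (cabs (u s f x - u t f x))%:E)//.
have /andP[/andP[s0 sn] /andP[t0 tn]] :=
  st : (0 < s < n.+1%:R^-1) && (0 < t < n.+1%:R^-1).
have nd' : n.+1%:R^-1 < d.
  rewrite -[ltRHS]invrK ltf_pV2 ?posrE ?invr_gt0//.
  by apply: (lt_le_trans (truncnS_gt _)); rewrite ler_nat.
rewrite lee_fin (le_trans (cabs_triangle (f x) _ _))// (cabsBC (f x)).
have := H s s0 (lt_trans sn nd'); have := H t t0 (lt_trans tn nd'); lra.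
Qed.

End ae_convergence_general.

(** * Pairing with truncated logarithms *)

Section shells.
Context {R : realType} {N : nat}.
Notation V := 'rV[R]_N.
Notation leb := (lebesgue_rV (R := R) N).
Implicit Types (x y : V).
Variables (Phi : V -> R[i]) (C : R).
Hypothesis HC : kernel_bounds C Phi.
Hypothesis Phi1 : cint Phi = 1.
Hypothesis N0 : (0 < N)%N.

Let C_ge0 : 0 <= C. Proof. by case: HC. Qed.

(** Annuli for the max norm. *)
Definition annulus (a b : R) : set V := [set x | a <= `|x| < b].

Lemma annulusE (a b : R) : annulus a b = ball (0 : V) b `\` ball (0 : V) a.
Proof.
apply/seteqP; split => x; rewrite /annulus /= !ball0E.
  by move=> /andP[ax ->]; split => //; apply/negP; rewrite -leNgt.
by move=> [-> /negP]; rewrite -leNgt => ->.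
Qed.

Lemma measurable_annulus (a b : R) : measurable (annulus a b).
Proof. by rewrite annulusE; apply: measurableD; exact: measurable_rV_ball. Qed.

Lemma cintegrable_annulus (a b : R) f : cintegrable f ->
  cintegrable (fun w => f w * cindic (annulus a b) w).
Proof. by move=> fi; apply: cintegrable_indic => //; exact: measurable_annulus. Qed.

Lemma cindic_annulusD (a b c : R) x : a <= b -> b <= c ->
  cindic (annulus a c) x = cindic (annulus a b) x + cindic (annulus b c) x.
Proof.
move=> ab bc; rewrite /cindic -rmorphD/= !indicE; congr (_ %:C)%C.
have E (p q : R) : (x \in annulus p q) = (p <= `|x| < q).
  by apply/idP/idP; rewrite inE.
rewrite !E; have [xb|bx] := ltP `|x| b.
  by rewrite /= addr0 andbT (lt_le_trans xb bc) andbT.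
by rewrite andbF /= add0r (le_trans ab bx).
Qed.

Lemma ball_annulus_far (a b : R) x :
  cabs (Phi x - Phi x * cindic (annulus a b) x) <=
  C * \1_(ball (0 : V) a) x + cabs (Phi x) * \1_(far b) x.
Proof.
have P0 : 0 <= C * \1_(ball (0 : V) a) x by rewrite mulr_ge0.
have Q0 : 0 <= cabs (Phi x) * \1_(far b) x by rewrite mulr_ge0// cabs_ge0.
have [xab|nab] := pselect (annulus a b x).
  by rewrite /cindic indicE mem_set// mulr1 subrr cabs0 addr_ge0.
rewrite {1}/cindic indicE memNset// mulr0 subr0.
have [xa|ax] := ltP `|x| a.
  by rewrite indic_ball1// mulr1 (le_trans (Phi_le HC x))// lerDl.
have xb : far b x by rewrite /far/= leNgt; apply/negP => xb; apply: nab; rewrite /annulus/= ax.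
by rewrite [\1_(far b) x]indicE mem_set// mulr1 lerDr.
Qed.

(** Some annulus carries nonzero mass: if none did, then neither would any union of
    dyadic annuli, and these fill the space up to a small ball and a small tail. *)
Lemma exists_annulus : exists2 a : R, 0 < a &
  cint (fun w => Phi w * cindic (annulus a (2 * a)) w) != 0.
Proof.
apply: contrapT => H.
have {}H (a : R) : 0 < a -> cint (fun w => Phi w * cindic (annulus a (2 * a)) w) = 0.
  by move=> a0; apply/eqP/negP => /negP h; apply: H; exists a.
have H2 (a : R) m : 0 < a -> cint (fun w => Phi w * cindic (annulus a (2 ^+ m * a)) w) = 0.
  move=> a0; have Pi := Phi_integrable HC; elim: m => [|m IH].
    rewrite -[RHS](cint0 leb); apply: (@eq_cint _ _ _ leb) => w.
    rewrite /cindic indicE memNset ?mulr0// /annulus/= expr0 mul1r => /andP[h1].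
    by rewrite ltNge h1.
  have E1 := H (2 ^+ m * a) (mulr_gt0 (pow2_gt0 m) a0).
  rewrite mulrA -exprS in E1.
  have i1 := cintegrable_annulus a (2 ^+ m * a) Pi.
  have i2 := cintegrable_annulus (2 ^+ m * a) (2 ^+ m.+1 * a) Pi.
  have := cintD i1 i2; rewrite [X in _ = X + _]IH [X in _ = _ + X]E1 addr0 => <-.
  apply: (@eq_cint _ _ _ leb) => w; rewrite -mulrDr -cindic_annulusD//.
    by rewrite ler_peMl ?(ltW a0)// exprn_ege1// ler1n.
  by rewrite ler_wpM2r ?(ltW a0)// ler_weXn2l// ler1n.
have Pi := Phi_integrable HC.
(* with this [a] the ball of radius [a] has mass at most 1/4, as [N] is positive *)
pose a := Num.min (2^-1 : R) (8^-1 / (C + 1)).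
have C1 : 0 < C + 1 by rewrite ltr_wpDl.
have a0 : 0 < a by rewrite lt_min invr_gt0 ltr0n/= divr_gt0// invr_gt0.
have a2 : 2 * a <= 1 by rewrite -ler_pdivlMl// mulr1 ge_min lexx.
have aC : C * (2 * a) ^+ N <= 4^-1.
  have a8 : a * (C + 1) <= 8^-1 by rewrite -ler_pdivlMr// ge_min lexx orbT.
  have aN : (2 * a) ^+ N <= 2 * a.
    rewrite -(prednK N0) exprS ler_piMr ?exprn_ile1// mulr_ge0//; exact: ltW.
  by have := ler_wpM2l C_ge0 aN; lra.
have [n0 /(_ n0 (leqnn _)) Hn] := far_integral_small
  (fun x => cabs_ge0 _ : 0 <= (cabs (Phi x))%:E)%E (cintegrable_cabs Pi)
  (ltac:(by rewrite invr_gt0) : 0 < (4^-1 : R)).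
have [m Hm] := exists_pow2_gt (n0%:R / a).
have {}Hm : n0%:R <= 2 ^+ m * a by rewrite -ler_pdivrMr// ltW.
have i1 := cintegrable_annulus a (2 ^+ m * a) Pi.
have i2 := cintegrableB Pi i1.
have := cabs_cint i2.
rewrite [X in cabs X](cintB Pi i1) [X in _ - X]H2// subr0 [X in cabs X]Phi1.
rewrite cabs_real normr1; apply/negP; rewrite -ltNge.
apply: (@le_lt_trans _ _ (2^-1)%:E); last by rewrite lte_fin; lra.
have mB : measurable_fun setT (fun x : V => (C * \1_(ball (0 : V) a) x)%:E).
  apply/measurable_EFinP; apply: measurable_funM => //; apply: measurable_indic.
  exact: measurable_rV_ball.
have mF : measurable_fun setT (fun x : V => (cabs (Phi x) * \1_(far n0%:R) x)%:E).
  apply/measurable_EFinP; apply: measurable_funM; first exact/cmeas_cabs/(cintegrable_meas Pi).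
  apply: measurable_indic; exact: measurable_far.
apply: (@le_trans _ _ (\int[leb]_x (C * \1_(ball (0 : V) a) x)%:E +
   \int[leb]_x (cabs (Phi x) * \1_(far n0%:R) x)%:E)%E).
  rewrite -ge0_integralD//; [|by move=> x _; rewrite lee_fin mulr_ge0|
    by move=> x _; rewrite lee_fin mulr_ge0// cabs_ge0].
  apply: ge0_le_integral; first exact: measurableT.
  - by move=> x _; rewrite lee_fin cabs_ge0.
  - exact: cmeas_cabse (cintegrable_meas i2).
  - exact: emeasurable_funD.
  move=> x _; rewrite -EFinD lee_fin (le_trans (ball_annulus_far _ _ _))//.
  rewrite lerD2l ler_wpM2l ?cabs_ge0// !indicE.
  case: (boolP (x \in far (2 ^+ m * a))) => [|_]; last by rewrite ler0n.
  by rewrite inE /far/= => xm; rewrite mem_set// /far/= (le_trans Hm).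
rewrite integral_indic_ball// (_ : 2^-1 = 4^-1 + 4^-1); last by field.
rewrite EFinD; apply: leeD.
  by rewrite lee_fin -(mulr_natl a 2).
apply: le_trans Hn; rewrite le_eqVlt; apply/orP; left; apply/eqP.
by apply: eq_integral => x _; rewrite EFinM.
Qed.

End shells.

Section dyadic_sums.
Context {R : realType}.

(** Decay of a kernel with a first-order zero and first-order decay. *)
Definition hat (r : R) : R := if r <= 1 then r else r^-1.

Lemma sum_hat_le n (r : R) : 0 <= r -> \sum_(0 <= i < n) hat (r / 2 ^+ i) <= 4.
Proof.
move=> r0.
suff [h1 h2] : (r <= 1 -> \sum_(0 <= i < n) hat (r / 2 ^+ i) <= 2 * r) /\
    (1 < r -> \sum_(0 <= i < n) hat (r / 2 ^+ i) <= 4 - r^-1).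
  have [r1|r1] := leP r 1; first by rewrite (le_trans (h1 r1))//; lra.
  rewrite (le_trans (h2 r1))// gerBl invr_ge0//.
elim: n r r0 => [|n IH] r r0.
  split=> r1; rewrite big_nil; first by rewrite mulr_ge0.
  have : r^-1 < 1 by rewrite invf_lt1// (lt_trans ltr01).
  by lra.
have E : \sum_(0 <= i < n.+1) hat (r / 2 ^+ i) =
    hat r + \sum_(0 <= i < n) hat ((r / 2) / 2 ^+ i).
  rewrite big_nat_recl//= expr0 divr1; congr (_ + _); apply: eq_bigr => i _.
  by rewrite exprS invfM mulrA.
have r20 : 0 <= r / 2 by rewrite divr_ge0.
have [h1 h2] := IH (r / 2) r20; rewrite E; split=> r1.
  rewrite /hat r1; have := h1 _; lra.
have -> : hat r = r^-1 by rewrite /hat leNgt r1.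
have [r2|r2] := leP (r / 2) 1.
  have := h1 r2; have : r^-1 < 1 by rewrite invf_lt1// (lt_trans ltr01).
  lra.
have := h2 r2; rewrite invfM invrK; lra.
Qed.

End dyadic_sums.

Section log_kernel_pairing.
Context {R : realType} {N : nat}.
Notation V := 'rV[R]_N.
Notation leb := (lebesgue_rV (R := R) N).
Implicit Types (x y z : V) (f : V -> R[i]).
Variables (Phi : V -> R[i]) (C : R).
Hypothesis HC : kernel_bounds C Phi.
Variable a : R.
Hypothesis a0 : 0 < a.

Let C_ge0 : 0 <= C. Proof. by case: HC. Qed.

Notation u s f := (convol (dilate s Phi) f).
Notation A := (annulus a (2 * a)).

(** The mass of the kernel on the annulus [A]. *)
Definition kappa : R[i] := cint (fun w => Phi w * cindic A w).

(** The mass on [A] of the translated kernel: close to [kappa] for [z] near the origin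
    and small for [z] far from it. *)
Definition psi z : R[i] := cint (fun w => Phi (w - z) * cindic A w).

Lemma annulus_integrable : cintegrable (cindic A : V -> R[i]).
Proof.
apply: cindic_integrable; first exact: measurable_annulus.
apply: (@le_lt_trans _ _ (leb (ball (0 : V) (2 * a)))).
  apply: le_measure; rewrite ?inE; [exact: measurable_annulus|exact: measurable_rV_ball|].
  by move=> x; rewrite annulusE => -[].
by rewrite [X in (X < _)%E]leb_ball ?ltry// mulr_gt0.
Qed.

Notation lA := (L1n (cindic A : V -> R[i])).

Lemma Phi_shift_integrable z : cintegrable (fun w => Phi (w - z)).
Proof. exact: (cint_shift (- z) (Phi_integrable HC)).1. Qed.

Lemma psi_section z : cintegrable (fun w => Phi (w - z) * cindic A w).
Proof. exact: cintegrable_annulus (Phi_shift_integrable z). Qed.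

Lemma psi_sub_kappa z : cabs (psi z - kappa) <= C * `|z| * lA.
Proof.
have i1 := psi_section z; have i2 := cintegrable_annulus a (2 * a) (Phi_integrable HC).
have i3 := cintegrableB i1 i2.
rewrite /psi /kappa -[X in cabs X](cintB i1 i2).
apply: (cabs_cint_bounded_mul _ annulus_integrable i3) => [|w]; first by rewrite mulr_ge0.
rewrite -mulrBl cabsM ler_wpM2r ?cabs_ge0//; have [_ _ L _] := HC.
by rewrite (le_trans (L _ _))// addrAC subrr add0r normrN.
Qed.

Lemma norm_Phi_le z : `|z| * cabs (Phi z) <= C.
Proof.
rewrite (le_trans (ler_wpM2l _ (Phi_le_weight HC z)))// mulrCA ler_piMr//.
apply: (@le_trans _ _ (weight N z)); last exact: weight_le1.
rewrite -[leRHS]weightS mulrC ler_wpM2l ?weight_ge0//.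
by rewrite lerDr.
Qed.

Lemma psi_decay z : `|z| * cabs (psi z) <= C * (1 + 2 * a) * lA.
Proof.
have i1 := psi_section z; have i2 := cintegrableZ (`|z|%:C%C) i1.
have -> : `|z| * cabs (psi z) = cabs (`|z|%:C%C * psi z).
  by rewrite cabsM cabs_real normr_id.
rewrite /psi -[X in cabs X](cintZ _ i1).
have a2 : 0 <= 1 + 2 * a by rewrite addr_ge0// mulr_ge0// ltW.
apply: (cabs_cint_bounded_mul _ annulus_integrable i2) => [|w]; first by rewrite mulr_ge0.
rewrite mulrA cabsM; have [Aw|nAw] := pselect (A w); last first.
  by rewrite /cindic indicE memNset// cabs0 !mulr0.
rewrite ler_wpM2r ?cabs_ge0// cabsM cabs_real normr_id.
have /andP[_ wa] := Aw.
have zw : `|z| <= `|w - z| + 2 * a.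
  by rewrite (le_trans _ (lerD (lexx _) (ltW wa)))// distrC -{1}(subrK w z) ler_normD.
rewrite (le_trans (ler_wpM2r (cabs_ge0 _) zw))// mulrDl mulrDr mulr1.
apply: lerD; first exact: norm_Phi_le.
by rewrite mulrC ler_wpM2r ?mulr_ge0 ?(ltW a0)// (Phi_le HC).
Qed.


(** One dyadic increment of the truncated logarithm: [ln 2] if [|z|] is below the scale
    [D * 2 ^ i], zero if it is above the next one. *)
Definition log_step (D : R) i z : R :=
  ln (Num.max `|z| (D * 2 ^+ i.+1)) - ln (Num.max `|z| (D * 2 ^+ i)).

(** The logarithm of [|z|] truncated below at [D] and above at [D * 2 ^ n], up to
    sign and an additive constant. *)
Definition log_trunc (D : R) n z : R :=
  ln (Num.max `|z| (D * 2 ^+ n)) - ln (Num.max `|z| D).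

Lemma log_trunc_sum (D : R) n z : log_trunc D n z = \sum_(0 <= i < n) log_step D i z.
Proof. by rewrite /log_step telescope_sumr// expr0 mulr1. Qed.

Lemma log_step_inner (D : R) i z : 0 < D -> `|z| <= D * 2 ^+ i -> log_step D i z = ln 2.
Proof.
move=> D0 zD; have p0 : 0 < D * 2 ^+ i by rewrite mulr_gt0// pow2_gt0.
rewrite /log_step !max_r//; last first.
  by rewrite (le_trans zD)// ler_pM2l// ler_weXn2l// ler1n.
have -> : D * 2 ^+ i.+1 = 2 * (D * 2 ^+ i) by rewrite exprS mulrCA.
by rewrite lnM ?posrE// addrK.
Qed.

Lemma log_step_outer (D : R) i z : 0 < D -> D * 2 ^+ i.+1 <= `|z| -> log_step D i z = 0.
Proof.
move=> D0 zD; rewrite /log_step !max_l ?subrr//.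
by rewrite (le_trans _ zD)// ler_pM2l// ler_weXn2l// ler1n.
Qed.

Lemma log_step_bounds (D : R) i z : 0 < D -> 0 <= log_step D i z <= ln 2.
Proof.
move=> D0; have p0 : 0 < D * 2 ^+ i by rewrite mulr_gt0// pow2_gt0.
have [zD|Dz] := leP `|z| (D * 2 ^+ i).
  by rewrite log_step_inner// lexx ln_ge0// ler1n.
have z0 : 0 < `|z| by exact: lt_trans Dz.
have p1 : 0 < D * 2 ^+ i.+1 by rewrite mulr_gt0// pow2_gt0.
rewrite /log_step (max_l (ltW Dz)); apply/andP; split.
  by rewrite subr_ge0 ler_ln ?posrE ?lt_max ?z0// le_max lexx.
rewrite lerBlDr -lnM ?posrE// ler_ln ?posrE ?lt_max ?z0 ?mulr_gt0//.
rewrite ge_max; apply/andP; split; first by rewrite ler_peMl// ler1n.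
by rewrite exprS mulrCA ler_pM2l// ltW.
Qed.

Lemma log_trunc_bounds (D : R) n z : 0 < D -> 0 <= log_trunc D n z <= n%:R * ln 2.
Proof.
move=> D0; rewrite log_trunc_sum; apply/andP; split.
  by apply: sumr_ge0 => i _; have /andP[] := log_step_bounds i z D0.
rewrite mulr_natl -[n in X in _ <= X]subn0 -sumr_const_nat.
by apply: ler_sum => i _; have /andP[] := log_step_bounds i z D0.
Qed.

(** The constant in the comparison of [psi] with a dyadic increment. *)
Definition term_const : R := C * (1 + 2 * a) * lA + 2 * cabs kappa.

Lemma term_const_ge0 : 0 <= term_const.
Proof.
rewrite addr_ge0// ?mulr_ge0 ?cabs_ge0 ?L1n_ge0//.
by rewrite addr_ge0// mulr_ge0// ltW.
Qed.

Lemma ln2_gt0 : 0 < ln (2 : R).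
Proof. by rewrite ln_gt0// ltr1n. Qed.

Lemma term_le (D : R) i z : 0 < D ->
  cabs (psi ((D * 2 ^+ i)^-1 *: z) - kappa * (log_step D i z / ln 2)%:C%C) <=
  term_const * hat (`|z| / D / 2 ^+ i).
Proof.
move=> D0; have p0 : 0 < D * 2 ^+ i by rewrite mulr_gt0// pow2_gt0.
have l2 := ln2_gt0; pose w := (D * 2 ^+ i)^-1 *: z.
have wE : `|z| / D / 2 ^+ i = `|w|.
  by rewrite normrZ ger0_norm ?invr_ge0 ?(ltW p0)// invfM [RHS]mulrC mulrA.
rewrite wE -/w.
have k1 : 0 <= 2 * cabs kappa by rewrite mulr_ge0// cabs_ge0.
have k2 : C * lA <= term_const.
  rewrite /term_const ler_wpDr// ler_wpM2r ?L1n_ge0// ler_peMr// lerDl mulr_ge0//.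
  exact: ltW.
have zw : `|z| = `|w| * (D * 2 ^+ i).
  by rewrite -wE; field; rewrite gt_eqF//= gt_eqF// pow2_gt0.
rewrite /hat; have [w1|w1] := leP `|w| 1.
  rewrite log_step_inner//; last by rewrite zw ler_piMl// ltW.
  rewrite divff ?gt_eqF// mulr1 (le_trans (psi_sub_kappa _))//.
  by rewrite mulrAC ler_wpM2r.
have w0 : 0 < `|w| by exact: lt_trans w1.
have d1 : cabs (psi w) <= C * (1 + 2 * a) * lA * `|w|^-1.
  by rewrite ler_pdivlMr// mulrC psi_decay.
have -> : term_const / `|w| = C * (1 + 2 * a) * lA / `|w| + 2 * cabs kappa / `|w|.
  exact: mulrDl.
apply: (le_trans (cabsB _ _)); apply: lerD; first exact: d1.
rewrite cabsM cabs_real; have [w2|w2] := leP 2 `|w|.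
  rewrite log_step_outer ?mul0r ?normr0 ?mulr0//.
    by rewrite mulr_ge0// invr_ge0.
  by rewrite zw exprS mulrCA ler_pM2r.
have /andP[h1 h2] := log_step_bounds i z D0.
rewrite [2 * _]mulrC -mulrA ler_wpM2l ?cabs_ge0//.
rewrite ger0_norm ?divr_ge0 ?(ltW l2)//.
apply: (@le_trans _ _ 1); first by rewrite ler_pdivrMr// mul1r.
by rewrite ler_pdivlMr// mul1r ltW.
Qed.

(** The sum of [psi] over [n] dyadic scales: [kappa / ln 2] times a truncated logarithm
    up to an error that is bounded independently of [n]. *)
Definition kern (D : R) n z : R[i] := \sum_(0 <= i < n) psi ((D * 2 ^+ i)^-1 *: z).

Lemma kern_log_trunc (D : R) n z : 0 < D ->
  cabs (kern D n z - kappa * (log_trunc D n z / ln 2)%:C%C) <= term_const * 4.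
Proof.
move=> D0; rewrite log_trunc_sum mulr_suml rmorph_sum mulr_sumr -sumrB.
apply: (le_trans (cabs_sum _ _ _)).
apply: (@le_trans _ _ (\sum_(0 <= i < n) term_const * hat (`|z| / D / 2 ^+ i))).
  by apply: ler_sum => i _; exact: term_le.
rewrite -mulr_sumr ler_wpM2l ?term_const_ge0// sum_hat_le//.
by rewrite divr_ge0// ltW.
Qed.

End log_kernel_pairing.

Section pairing_bound.
Context {R : realType} {N : nat}.
Notation V := 'rV[R]_N.
Notation leb := (lebesgue_rV (R := R) N).
Implicit Types (x y z : V) (f : V -> R[i]).
Variables (Phi : V -> R[i]) (C : R).
Hypothesis HC : kernel_bounds C Phi.
Variable a : R.
Hypothesis a0 : 0 < a.

Let C_ge0 : 0 <= C. Proof. by case: HC. Qed.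

Notation u s f := (convol (dilate s Phi) f).
Notation A := (annulus a (2 * a)).
Notation psi := (psi Phi a).

(** The indicator of the annulus of inner radius [s a] centred at [x]. *)
Definition annulus_at (s : R) x y : R[i] := cindic A (s^-1 *: (y - x)).

Lemma annulus_at_meas (s : R) x : cmeas (annulus_at s x).
Proof.
apply: (cmeas_comp (h := fun y : V => s^-1 *: (y - x)) (f := cindic A)).
  apply: (measurableT_comp (f := fun y : V => s^-1 *: y)); first exact: measurable_scaleV.
  exact: (measurable_shiftV (- x)).
by apply: cmeas_real; apply: measurable_indic; exact: measurable_annulus.
Qed.

Lemma cindic_le1 (B : set V) x : cabs (cindic B x) <= 1.
Proof.
by rewrite /cindic cabs_real indicE; case: (_ \in _); rewrite ?normr1 ?normr0.
Qed.

Lemma annulus_at_le1 (s : R) x y : cabs (annulus_at s x y) <= 1.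
Proof. exact: cindic_le1. Qed.

Lemma annulus_at_section (s : R) x f : cintegrable f -> cintegrable (fun y => f y * annulus_at s x y).
Proof.
move=> fi; apply: (@cintegrable_bounded_mul _ _ _ _ _ _ 1) => //.
  exact: annulus_at_meas.
exact: annulus_at_le1.
Qed.

Lemma psi_dilate (s : R) x z : 0 < s ->
  psi (s^-1 *: (z - x)) = cint (fun y => dilate s Phi (y - z) * annulus_at s x y).
Proof.
move=> s0; have [di _] := dilate_integrable s0 (Phi_integrable HC).
have gi := annulus_at_section s x (cint_shift (- z) di).1.
have [_ E] := cint_affine x s0 gi.
have sn : s != 0 by rewrite gt_eqF.
have E1 : (fun w : V => dilate s Phi (s *: w + x - z) * annulus_at s x (s *: w + x)) =
   (fun w => (s ^- N)%:C%C * (Phi (w - s^-1 *: (z - x)) * cindic A w)).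
  apply/funext => w; rewrite /annulus_at addrK scalerA mulVf// scale1r /dilate -mulrA.
  congr (_ * (Phi _ * _)).
  by rewrite -addrA scalerDr scalerA mulVf// scale1r -(opprB z x) scalerN.
rewrite E1 in E.
have := cintZ (s ^- N)%:C%C (psi_section HC a (s^-1 *: (z - x))).
rewrite [X in X = _]E => /mulfI -> //.
by rewrite fmorph_eq0 invr_eq0 expf_neq0.
Qed.

(** The integral of [u s f] over an annulus of size [s] is an integral of [f] against
    [psi]. *)
Lemma pairing_term (s : R) x f : 0 < s -> cintegrable f ->
  cint (fun y => u s f y * annulus_at s x y) = cint (fun z => f z * psi (s^-1 *: (z - x))).
Proof.
move=> s0 fi; have [di _] := dilate_integrable s0 (Phi_integrable HC).
pose F (p : V * V) : R[i] := (dilate s Phi (p.1 - p.2) * f p.2) * annulus_at s x p.1.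
have Fi : cintegrable_on (leb \x leb)%E F.
  apply: (@cintegrable_bounded_mul _ _ _ _ _ _ 1).
  - exact: cintegrable_conv_prod.
  - exact: (cmeas_fst (annulus_at_meas s x)).
  - by move=> p; exact: annulus_at_le1.
transitivity (cint (fun y => cint (fun z => F (y, z)))).
  apply: (@eq_cint _ _ _ leb) => y; rewrite /F/= mulrC.
  rewrite -[LHS](cintZ _ (dilPhi_section HC y s0 fi)).
  by apply: (@eq_cint _ _ _ leb) => z; rewrite mulrC.
rewrite [LHS](cfubini Fi); apply: (@eq_cint _ _ _ leb) => z; rewrite psi_dilate//.
rewrite -[RHS](cintZ _ (annulus_at_section s x (cint_shift (- z) di).1)).
by apply: (@eq_cint _ _ _ leb) => y; rewrite /F/=; ring.
Qed.

Lemma annulus_at_disjoint (D : R) x y i j : 0 < D -> i != j ->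
  annulus_at (D * 2 ^+ i) x y != 0 -> annulus_at (D * 2 ^+ j) x y = 0.
Proof.
move=> D0 ij; have p k : 0 < D * 2 ^+ k by rewrite mulr_gt0// pow2_gt0.
have E k : `|(D * 2 ^+ k)^-1 *: (y - x)| = `|y - x| / (D * 2 ^+ k).
  by rewrite normrZ ger0_norm ?invr_ge0 ?(ltW (p k))// mulrC.
have mem k : annulus_at (D * 2 ^+ k) x y != 0 ->
    a * (D * 2 ^+ k) <= `|y - x| < 2 * a * (D * 2 ^+ k).
  rewrite /annulus_at /cindic indicE.
  case: (boolP (_ \in A)) => [|_ /eqP//]; rewrite inE /annulus/= E.
  by rewrite ler_pdivlMr// ltr_pdivrMr.
move=> ri; apply/eqP/negPn/negP => rj.
have key m n : (m < n)%N -> ~~ (a * (D * 2 ^+ n) < 2 * a * (D * 2 ^+ m)).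
  move=> mn; rewrite -leNgt [2 * a]mulrC -mulrA ler_pM2l// mulrCA -exprS ler_pM2l//.
  by rewrite ler_weXn2l// ler1n.
have /andP[i1 i2] := mem _ ri; have /andP[j1 j2] := mem _ rj.
move: ij; rewrite neq_ltn => /orP[/key|/key]; apply/negP; rewrite negbK.
  exact: le_lt_trans j1 i2.
exact: le_lt_trans i1 j2.
Qed.

Lemma annuli_le_maximal (D : R) n x f y : 0 < D ->
  ((cabs (\sum_(0 <= i < n) u (D * 2 ^+ i) f y * annulus_at (D * 2 ^+ i) x y))%:E <=
   maximal_fun Phi f y)%E.
Proof.
move=> D0; have p k : 0 < D * 2 ^+ k by rewrite mulr_gt0// pow2_gt0.
rewrite big_mkord.
have [/existsP[i ri]|none] := boolP [exists i : 'I_n, annulus_at (D * 2 ^+ i) x y != 0].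
  rewrite (bigD1 i)//= big1 ?addr0 => [|j ji]; last first.
    by rewrite (annulus_at_disjoint D0 _ ri) ?mulr0// eq_sym.
  apply: le_trans (u_le_maximal Phi f y (p i)); rewrite lee_fin cabsM.
  by rewrite ler_piMr ?cabs_ge0// annulus_at_le1.
rewrite big1 ?cabs0 ?maximal_ge0// => i _.
move: none; rewrite negb_exists => /forallP/(_ i); rewrite negbK => /eqP ->.
by rewrite mulr0.
Qed.

Notation lA := (L1n (cindic A : V -> R[i])).

Lemma psi_lipschitz : clipschitz (C * lA) psi.
Proof.
move=> y z; have i1 := psi_section HC a y; have i2 := psi_section HC a z.
have i3 := cintegrableB i1 i2.
rewrite /psi -[X in cabs X](cintB i1 i2) mulrAC.
apply: (cabs_cint_bounded_mul _ (annulus_integrable a0) i3) => [|w]; first by rewrite mulr_ge0.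
rewrite -mulrBl cabsM ler_wpM2r ?cabs_ge0//; have [_ _ L _] := HC.
apply: (le_trans (L _ _)); rewrite (_ : w - y - (w - z) = z - y) ?(distrC z)//.
by rewrite opprB addrC addrA subrK.
Qed.

Lemma psi_le z : cabs (psi z) <= C * lA.
Proof.
apply: (cabs_cint_bounded_mul _ (annulus_integrable a0) (psi_section HC a z)) => // w.
by rewrite cabsM ler_wpM2r ?cabs_ge0// (Phi_le HC).
Qed.

Lemma psi_term_section (s : R) x f : cintegrable f ->
  cintegrable (fun z => f z * psi (s^-1 *: (z - x))).
Proof.
move=> fi; apply: (@cintegrable_bounded_mul _ _ _ _ _ _ (C * lA)) => //.
  apply: (cmeas_comp (h := fun z : V => s^-1 *: (z - x))).
    apply: (measurableT_comp (f := fun y : V => s^-1 *: y)); first exact: measurable_scaleV.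
    exact: (measurable_shiftV (- x)).
  exact: clipschitz_meas psi_lipschitz.
by move=> z; exact: psi_le.
Qed.

Lemma kern_section (D : R) n x f : cintegrable f ->
  cintegrable (fun z => f z * kern Phi a D n (z - x)) /\
  cint (fun z => f z * kern Phi a D n (z - x)) =
  \sum_(0 <= i < n) cint (fun z => f z * psi ((D * 2 ^+ i)^-1 *: (z - x))).
Proof.
move=> fi; rewrite /kern.
have E : (fun z => f z * \sum_(0 <= i < n) psi ((D * 2 ^+ i)^-1 *: (z - x))) =
  (fun z => \sum_(0 <= i < n) f z * psi ((D * 2 ^+ i)^-1 *: (z - x))).
  by apply/funext => z; rewrite mulr_sumr.
rewrite E; split; first by apply: cintegrable_sum => i; exact: psi_term_section.
by rewrite -[RHS]cint_sum// => i; exact: psi_term_section.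
Qed.

(** One scale per annulus, and disjoint annuli: the sum of the integrals is at most the
    integral of the maximal function. *)
Lemma kern_pairing_le (D : R) n x f : 0 < D -> cintegrable f ->
  ((cabs (cint (fun z => f z * kern Phi a D n (z - x))))%:E <= Hnorm Phi f)%E.
Proof.
move=> D0 fi; have p k : 0 < D * 2 ^+ k by rewrite mulr_gt0// pow2_gt0.
have ui k : cintegrable (fun y => u (D * 2 ^+ k) f y * annulus_at (D * 2 ^+ k) x y).
  apply: annulus_at_section.
  exact: (cintegrable_convol (dilate_integrable (p k) (Phi_integrable HC)).1 fi).1.
have [_ ->] := kern_section D n x fi.
have -> : \sum_(0 <= i < n) cint (fun z => f z * psi ((D * 2 ^+ i)^-1 *: (z - x))) =
    cint (fun y => \sum_(0 <= i < n) u (D * 2 ^+ i) f y * annulus_at (D * 2 ^+ i) x y).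
  rewrite [RHS](cint_sum (mu := leb))//; apply: eq_bigr => i _.
  by rewrite -pairing_term.
have si := cintegrable_sum (index_iota 0 n) ui.
apply: (le_trans (cabs_cint si)); rewrite HnormE.
apply: ge0_le_integral; first exact: measurableT.
- by move=> y _; rewrite lee_fin cabs_ge0.
- exact: cmeas_cabse (cintegrable_meas si).
- exact: (measurable_maximal HC fi).
- by move=> y _; exact: annuli_le_maximal.
Qed.

Lemma measurable_log_trunc (D : R) n : measurable_fun setT (log_trunc D n : V -> R).
Proof.
apply: measurable_funB; apply: (measurableT_comp (@measurable_ln R));
  by apply: measurable_maxr => //; exact: measurable_rV_norm.
Qed.

Lemma log_trunc_section (D : R) n x f : 0 < D -> cintegrable f ->
  cintegrable (fun z => f z * (log_trunc D n (z - x))%:C%C).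
Proof.
move=> D0 fi; apply: (@cintegrable_bounded_mul _ _ _ _ _ _ (n%:R * ln 2)) => //.
  apply: cmeas_real; apply: (measurableT_comp (measurable_log_trunc D n)).
  exact: (measurable_shiftV (- x)).
by move=> z; have /andP[h1 h2] := log_trunc_bounds n (z - x) D0; rewrite cabs_real ger0_norm.
Qed.

Lemma log_trunc_pairing_le (D : R) n x f : 0 < D -> cintegrable f ->
  ((cabs (kappa Phi a) / ln 2 *
     cabs (cint (fun z => f z * (log_trunc D n (z - x))%:C%C)))%:E <=
   Hnorm Phi f + (term_const Phi C a * 4 * L1n f)%:E)%E.
Proof.
move=> D0 fi; have [ki _] := kern_section D n x fi.
have li := log_trunc_section n x D0 fi.
have l2 : 0 < ln (2 : R) by exact: ln2_gt0.
pose k : R[i] := kappa Phi a * ((ln 2)^-1)%:C%C.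
have ji := cintegrableZ k li.
have di := cintegrableB ki ji.
have -> : cabs (kappa Phi a) / ln 2 *
     cabs (cint (fun z => f z * (log_trunc D n (z - x))%:C%C)) =
  cabs (cint (fun z => f z * kern Phi a D n (z - x)) -
    cint (fun z => f z * kern Phi a D n (z - x) - k * (f z * (log_trunc D n (z - x))%:C%C))).
  rewrite [X in _ - X](cintB ki ji) subKr [X in _ = cabs X](cintZ k li).
  rewrite [RHS]cabsM [X in _ = X * _]cabsM cabs_real.
  by rewrite ger0_norm// invr_ge0 ltW.
apply: (@le_trans _ _ (cabs (cint (fun z => f z * kern Phi a D n (z - x))) +
   term_const Phi C a * 4 * L1n f)%:E); last first.
  by rewrite EFinD; apply: leeD => //; exact: kern_pairing_le.
rewrite lee_fin; apply: (le_trans (cabsB _ _)); rewrite lerD2l.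
apply: (cabs_cint_bounded_mul _ fi di) => [|z].
  by rewrite mulr_ge0// (term_const_ge0 HC).
rewrite mulrCA -mulrBr cabsM mulrC ler_wpM2r ?cabs_ge0//.
have := kern_log_trunc HC a0 n (z - x) D0; rewrite /k.
by rewrite -[_ * _%:C%C * _]mulrA -rmorphM/= [_^-1 * _]mulrC.
Qed.

End pairing_bound.

(** * Cancellation and the logarithmic bound on the Hardy space *)

Section hardy_log.
Context {R : realType} {N : nat}.
Notation V := 'rV[R]_N.
Notation leb := (lebesgue_rV (R := R) N).
Implicit Types (x y z : V) (f : V -> R[i]).
Variables (Phi : V -> R[i]) (C : R).
Hypothesis HC : kernel_bounds C Phi.
Hypothesis Phi1 : cint Phi = 1.
Hypothesis N0 : (0 < N)%N.


(** The pairing with truncated logarithms is bounded on the Hardy space, uniformly in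
    the truncation. *)
Lemma log_trunc_hardy : exists2 K : R, 0 <= K & forall f, hardy Phi f ->
  forall x (D : R) n, 0 < D ->
  cabs (cint (fun z => f z * (log_trunc D n (z - x))%:C%C)) <= K * hardy_norm Phi f.
Proof.
have [a a0 ka] := exists_annulus HC Phi1 N0.
have k0 : 0 < cabs (kappa Phi a).
  rewrite lt_neqAle cabs_ge0 andbT eq_sym; apply: contra ka => /eqP/cabs0_eq0 h.
  exact/eqP.
have l2 := @ln2_gt0 R.
have k2 : 0 < cabs (kappa Phi a) / ln 2 by rewrite divr_gt0.
have T0 := term_const_ge0 HC a0.
exists ((1 + term_const Phi C a * 4) / (cabs (kappa Phi a) / ln 2)).
  by rewrite divr_ge0 ?(ltW k2)// addr_ge0// mulr_ge0.
move=> f fh x D n D0; have [fi _] := fh.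
rewrite mulrAC ler_pdivlMr// mulrC -lee_fin.
apply: (le_trans (log_trunc_pairing_le HC a0 n x D0 fi)).
rewrite (hardy_normE HC fh) -EFinD lee_fin [leRHS]mulrDl mul1r lerD2l ler_wpM2l//.
  by rewrite mulr_ge0.
exact: (L1n_le_hardy_norm HC Phi1 fh).
Qed.

(** Divided by [n ln 2], the truncated logarithm tends to one. *)
Lemma log_trunc_tends z (e : R) : 0 < e -> exists n0, forall n, (n0 <= n)%N ->
  1 - log_trunc 1 n z / (n%:R * ln 2) <= e.
Proof.
move=> e0; have l2 := @ln2_gt0 R.
pose m : R := Num.max `|z| 1; have m1 : 1 <= m by rewrite le_max lexx orbT.
have [n1 Hn1] := exists_pow2_gt m.
exists (maxn n1 (Num.truncn (ln m / (e * ln 2))).+1) => n; rewrite geq_max => /andP[n1n n2n].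
have mn : m <= 2 ^+ n.
  by rewrite (le_trans (ltW Hn1))// ler_weXn2l// ler1n.
have nn : 0 < (n%:R : R) by rewrite ltr0n (leq_trans _ n2n).
have -> : log_trunc 1 n z = n%:R * ln 2 - ln m.
  rewrite /log_trunc mul1r max_r; last by rewrite (le_trans _ mn)// le_max lexx.
  by rewrite lnXn// mulr_natl.
rewrite mulrBl divff ?mulf_neq0 ?gt_eqF// subKr ler_pdivrMr ?mulr_gt0//.
rewrite (_ : e * (n%:R * ln 2) = n%:R * (e * ln 2)); last by ring.
rewrite -ler_pdivrMr ?mulr_gt0//; apply: ltW; apply: lt_le_trans (truncnS_gt _) _.
by rewrite ler_nat.
Qed.

(** Functions of the Hardy space have mean zero: pairings with the truncated logarithms
    stay bounded, while these tend to one after division by [n ln 2]. *)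
Lemma hardy_mean0 f : hardy Phi f -> cint f = 0.
Proof.
move=> fh; have [fi _] := fh; have [K K0 HK] := log_trunc_hardy.
have l2 := @ln2_gt0 R.
apply: cabs0_eq0; apply/eqP; rewrite eq_le cabs_ge0 andbT; apply/ler_addgt0Pr => e e0.
rewrite add0r; have e2 : 0 < e / 2 by rewrite divr_gt0.
pose q n z : R := 1 - log_trunc 1 n z / (n%:R * ln 2).
have q01 n z : (0 < n)%N -> 0 <= q n z <= 1.
  move=> n0; have nl : 0 < n%:R * ln (2 : R) by rewrite mulr_gt0// ltr0n.
  have /andP[h1 h2] := log_trunc_bounds n z (@ltr01 R).
  by rewrite /q subr_ge0 ler_pdivrMr// mul1r h2/= gerBl divr_ge0// ltW.
have mq n : measurable_fun setT (q n).
  apply: measurable_funB => //; apply: measurable_funM => //.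
  exact: measurable_log_trunc.
have [n0 Hn0] : exists n0, forall n, (n0 <= n)%N ->
    (\int[leb]_z (cabs (f z) * q n.+1 z)%:E <= (e / 2)%:E)%E.
  apply: (dominated_small (F := fun n z => (cabs (f z) * q n.+1 z)%:E)
    (G := fun z => (cabs (f z))%:E)) => //.
  - move=> n; apply/measurable_EFinP; apply: measurable_funM => //.
    exact/cmeas_cabs/(cintegrable_meas fi).
  - move=> n z; have /andP[h1 h2] := q01 n.+1 z (ltn0Sn _).
    by rewrite !lee_fin mulr_ge0 ?cabs_ge0//= ler_piMr// cabs_ge0.
  - exact: cintegrable_cabs.
  apply: aeW => z d d0; have c1 : 0 < cabs (f z) + 1 by rewrite ltr_wpDl ?cabs_ge0.
  have [n1 H] := log_trunc_tends z (divr_gt0 d0 c1); exists n1 => n n1n.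
  have := H n.+1 (leq_trans n1n (leqnSn _)); rewrite -/(q _ _) => h.
  rewrite lee_fin (le_trans (ler_wpM2l (cabs_ge0 _) h))// mulrCA ler_piMr ?(ltW d0)//.
  by rewrite ler_pdivrMr// mul1r lerDl.
(* for this [n] the bounded pairing divided by [n ln 2] is at most [e / 2] *)
pose n := maxn n0 (Num.truncn (K * hardy_norm Phi f / (e / 2 * ln 2))).
have nn : 0 < (n.+1%:R * ln 2 : R) by rewrite mulr_gt0.
have lt := log_trunc_section n.+1 0 (@ltr01 R) fi.
rewrite (_ : (fun z => _) = (fun z => f z * (log_trunc 1 n.+1 z)%:C%C)) in lt; last first.
  by apply/funext => z; rewrite subr0.
pose k : R[i] := ((n.+1%:R * ln 2)^-1)%:C%C.
have lk := cintegrableZ k lt; have di := cintegrableB fi lk.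
have E : cint f = k * cint (fun z => f z * (log_trunc 1 n.+1 z)%:C%C) +
   cint (fun z => f z - k * (f z * (log_trunc 1 n.+1 z)%:C%C)).
  by rewrite [X in _ = _ + X](cintB fi lk) [X in _ + (_ - X)](cintZ k lt) addrC subrK.
rewrite E (_ : e = e / 2 + e / 2); last by field.
apply: (le_trans (cabsD _ _)); apply: lerD.
  rewrite cabsM /k cabs_real ger0_norm ?invr_ge0 ?(ltW nn)// mulrC ler_pdivrMr//.
  have := HK f fh 0 1 n.+1 (@ltr01 R).
  rewrite (_ : (fun z => _) = (fun z => f z * (log_trunc 1 n.+1 z)%:C%C)); last first.
    by apply/funext => z; rewrite subr0.
  move=> /le_trans; apply; rewrite mulrCA -ler_pdivrMr ?mulr_gt0//.
  apply: ltW; apply: (lt_le_trans (truncnS_gt _)); rewrite ler_nat ltnS; exact: leq_maxr.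
rewrite -lee_fin; apply: le_trans (Hn0 n (leq_maxl _ _)).
apply: (cabs_cint_le di) => [|z].
  by apply: measurable_funM => //; exact/cmeas_cabs/(cintegrable_meas fi).
rewrite mulrCA -[X in cabs (X - _)]mulr1 -mulrBr cabsM ler_wpM2l ?cabs_ge0//.
rewrite /k -(rmorphM (real_complex R)) -(rmorph1 (real_complex R)) [leLHS]cabs_realB.
have /andP[h1 _] := q01 n.+1 z (ltn0Sn _).
by rewrite mulrC ger0_norm.
Qed.

Lemma hardy_dense_support f : hardy_dense f ->
  exists2 r : R, 0 <= r & forall z, r < `|z| -> f z = 0.
Proof.
move=> [_ _ [r Hr] _]; exists `|r| => // z rz; apply: Hr.
by apply: le_lt_trans (ler_norm r) _; apply: lt_le_trans rz (norm_le_enorm z).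
Qed.

Lemma integrable_ln_ball :
  leb.-integrable setT (fun w : V => (`|ln `|w| | * \1_(ball (0 : V) 1) w)%:E).
Proof.
apply/integrableP; split.
  apply/measurable_EFinP; apply: measurable_funM.
    apply: (measurableT_comp (@normr_measurable R setT)).
    exact: (measurableT_comp (@measurable_ln R) measurable_rV_norm).
  by apply: measurable_indic; exact: measurable_rV_ball.
apply: (@le_lt_trans _ _ (4 ^+ N * 2)%:E); last exact: ltry.
apply: le_trans (integral_ln_ball N0); rewrite le_eqVlt; apply/orP; left; apply/eqP.
by apply: eq_integral => w _; rewrite gee0_abs// lee_fin mulr_ge0.
Qed.

(** The logarithm has small integral on small balls. *)
Lemma ln_ball_small (e : R) : 0 < e -> exists2 D : R, 0 < D <= 1 &
  (\int[leb]_w (`|ln `|w| | * \1_(ball (0 : V) D) w)%:E <= e%:E)%E.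
Proof.
move=> e0; have d1 n : 0 < (n.+1%:R^-1 : R) <= 1.
  by rewrite invr_gt0 ltr0n/= invf_le1// ler1n.
have [n0 H] : exists n0, forall n, (n0 <= n)%N ->
   (\int[leb]_w (`|ln `|w| | * \1_(ball (0 : V) n.+1%:R^-1) w)%:E <= e%:E)%E; last first.
  by exists (n0.+1%:R^-1); [exact: d1|exact: (H n0 (leqnn _))].
apply: (dominated_small (F := fun n (w : V) => (`|ln `|w| | * \1_(ball (0 : V) n.+1%:R^-1) w)%:E)
  _ _ integrable_ln_ball _ e0).
- move=> n; apply/measurable_EFinP; apply: measurable_funM.
    apply: (measurableT_comp (@normr_measurable R setT)).
    exact: (measurableT_comp (@measurable_ln R) measurable_rV_norm).
  by apply: measurable_indic; exact: measurable_rV_ball.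
- move=> n w; rewrite !lee_fin mulr_ge0//= ler_wpM2l// !indicE.
  have [wn|wn] := pselect (ball (0 : V) n.+1%:R^-1 w); last by rewrite memNset.
  rewrite (mem_set wn) mem_set// ball0E; rewrite ball0E in wn.
  by apply: lt_le_trans wn _; have /andP[] := d1 n.
apply: aeW => w d d0; have [->|w0] := eqVneq w 0.
  by exists 0%N => n _; rewrite normr0 ln0// normr0 mul0r lee_fin ltW.
have wp : 0 < `|w| by rewrite normr_gt0.
exists (Num.truncn `|w|^-1) => n wn; rewrite indicE memNset ?mulr0 ?lee_fin ?(ltW d0)//.
rewrite ball0E; apply/negP; rewrite -leNgt -[leRHS]invrK lef_pV2 ?posrE ?invr_gt0//.
by apply: (le_trans (ltW (truncnS_gt _))); rewrite ler_nat.
Qed.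

Lemma ae_neq x : {ae leb, forall z : V, z != x}.
Proof.
apply: negligibleS (hyperplane_negligible (Ordinal N0) (x ord0 (Ordinal N0))).
by move=> z /= /negP; rewrite negbK => /eqP ->.
Qed.

Lemma ln_le_norm (t : R) : 0 <= t -> `|ln t| <= `|ln t| * \1_(`]-oo, 1[%classic) t + t.
Proof.
move=> t0; have [t1|t1] := ltP t 1.
  by rewrite indicE mem_set ?mulr1 ?lerDl//= in_itv.
rewrite indicE memNset ?mulr0 ?add0r; last by rewrite /= in_itv/= ltNge t1.
rewrite ger0_norm ?ln_ge0//.
have tp : 0 < t by exact: lt_le_trans t1.
by have := @le_ln1Dx R (t - 1); rewrite addrCA subrr addr0 => /(_ _)/le_trans; apply; lra.
Qed.

Lemma cmeas_ln_norm x : cmeas (fun z : V => (ln `|x - z|)%:C%C).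
Proof.
apply: cmeas_real; apply: (measurableT_comp (@measurable_ln R)).
exact: (measurableT_comp measurable_rV_norm (measurable_reflect x)).
Qed.

Lemma norm_log_section x f : hardy_dense f ->
  cintegrable (fun z => f z * (ln `|x - z|)%:C%C).
Proof.
move=> fd; have [r r0 Hr] := hardy_dense_support fd; have [fi [M HM] _ _] := fd.
have M0 : 0 <= M by rewrite (le_trans (cabs_ge0 _) (HM 0)).
have mL : measurable_fun setT (fun w : V => (`|ln `|w| | * \1_(ball (0 : V) 1) w)%:E).
  exact: (measurable_int leb integrable_ln_ball).
have L0 (w : V) : (0 <= (`|ln `|w| | * \1_(ball (0 : V) 1) w)%:E)%E.
  by rewrite lee_fin mulr_ge0.
have iL : leb.-integrable setT (fun z : V => (`|ln `|x - z| | * \1_(ball (0 : V) 1) (x - z))%:E).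
  apply/integrableP; split; first exact: (measurableT_comp mL (measurable_reflect x)).
  have /integrableP[_] := integrable_ln_ball; apply: le_lt_trans.
  rewrite le_eqVlt; apply/orP; left; apply/eqP.
  rewrite [RHS](eq_integral (fun w : V => (`|ln `|w| | * \1_(ball (0 : V) 1) w)%:E)); last first.
    by move=> w _; rewrite gee0_abs.
  rewrite -(ge0_integral_reflect x mL L0).
  by apply: eq_integral => w _; rewrite gee0_abs// L0.
apply: (le_cintegrable (g := fun z => M * (`|ln `|x - z| | * \1_(ball (0 : V) 1) (x - z)) +
    (`|x| + r) * cabs (f z))).
- by apply: cmeasM; [exact: cintegrable_meas fi|exact: cmeas_ln_norm].
- have := integrableD measurableT (integrableZl measurableT M iL)
    (integrableZl measurableT (`|x| + r) (cintegrable_cabs fi)).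
  by apply: eq_integrable => // z _; rewrite /= EFinD !EFinM.
move=> z; rewrite cabsM cabs_real; have [rz|zr] := ltP r `|z|.
  by rewrite (Hr z rz) cabs0 mul0r mulr0 addr0 mulr_ge0// mulr_ge0.
apply: (le_trans (ler_wpM2l (cabs_ge0 _) (ln_le_norm (normr_ge0 (x - z))))).
rewrite mulrDr; apply: lerD.
  apply: ler_pM => //; first exact: cabs_ge0.
  rewrite ler_wpM2l// !indicE; have [h|] := boolP (`|x - z| \in _); last by rewrite ler0n.
  by move: h; rewrite inE /= in_itv/= => h; rewrite mem_set// ball0E.
rewrite mulrC ler_wpM2r ?cabs_ge0// (le_trans (ler_normB _ _))// lerD2l.
exact: zr.
Qed.

End hardy_log.

Section log_pairing.
Context {R : realType} {N : nat}.
Notation V := 'rV[R]_N.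
Notation leb := (lebesgue_rV (R := R) N).
Implicit Types (x y z : V) (f : V -> R[i]).
Variables (Phi : V -> R[i]) (C : R).
Hypothesis HC : kernel_bounds C Phi.
Hypothesis Phi1 : cint Phi = 1.
Hypothesis N0 : (0 < N)%N.


(** On compactly supported functions of mean zero the upper truncation is immaterial. *)
Lemma ln_max_pairing x (D : R) f : 0 < D -> hardy_dense f -> exists n,
  cintegrable (fun z => f z * (ln (Num.max `|x - z| D))%:C%C) /\
  cint (fun z => f z * (ln (Num.max `|x - z| D))%:C%C) =
  - cint (fun z => f z * (log_trunc D n (z - x))%:C%C).
Proof.
move=> D0 fd; have [r r0 Hr] := hardy_dense_support fd; have [fi _ _ f0] := fd.
have [n Hn] := exists_pow2_gt ((r + `|x|) / D); exists n.
have {}Hn : r + `|x| <= D * 2 ^+ n by rewrite mulrC -ler_pdivrMr// ltW.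
have E : (fun z => f z * (ln (Num.max `|x - z| D))%:C%C) =
  (fun z => (ln (D * 2 ^+ n))%:C%C * f z - f z * (log_trunc D n (z - x))%:C%C).
  apply/funext => z; have [rz|zr] := ltP r `|z|; first by rewrite Hr// !mul0r mulr0 subr0.
  rewrite [_%:C%C * _]mulrC -mulrBr -(rmorphB (real_complex R)); congr (_ * _%:C%C).
  have zn : Num.max `|z - x| (D * 2 ^+ n) = D * 2 ^+ n.
    by apply: max_r; apply: le_trans Hn; apply: le_trans (ler_normB _ _) _; rewrite lerD2r.
  by rewrite /log_trunc zn (distrC x) subKr.
have i1 := cintegrableZ (ln (D * 2 ^+ n))%:C%C fi.
have i2 := log_trunc_section n x D0 fi.
rewrite E; split; first exact: cintegrableB.
by rewrite [LHS](cintB i1 i2) [X in X - _](cintZ _ fi) [X in _ * X]f0 mulr0 sub0r.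
Qed.

(** The lower truncation is removed by local integrability of the logarithm. *)
Lemma norm_log_bound : exists2 K : R, 0 <= K & forall f, hardy_dense f -> hardy Phi f ->
  forall x, cabs (cint (fun z => f z * (ln `|x - z|)%:C%C)) <= K * hardy_norm Phi f.
Proof.
have [K K0 HK] := log_trunc_hardy HC Phi1 N0.
exists K => // f fd fh x; have [fi [M HM] _ _] := fd.
have M0 : 0 <= M by rewrite (le_trans (cabs_ge0 _) (HM 0)).
have M1 : 0 < M + 1 by rewrite ltr_wpDl.
apply/ler_addgt0Pr => e e0.
have [D /andP[D0 D1] HD] := ln_ball_small N0 (divr_gt0 e0 M1).
have [n [i1 E1]] := ln_max_pairing x D0 fd.
have i2 := norm_log_section N0 x fd.
have i3 := cintegrableB i2 i1.
have -> : cint (fun z => f z * (ln `|x - z|)%:C%C) =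
  cint (fun z => f z * (ln (Num.max `|x - z| D))%:C%C) +
  cint (fun z => f z * (ln `|x - z|)%:C%C - f z * (ln (Num.max `|x - z| D))%:C%C).
  by rewrite [X in _ = _ + X](cintB i2 i1) addrC subrK.
apply: (le_trans (cabsD _ _)); apply: lerD; first by rewrite E1 cabsN; exact: HK.
have mL : measurable_fun setT (fun w : V => (`|ln `|w| | * \1_(ball (0 : V) D) w)%:E).
  apply/measurable_EFinP; apply: measurable_funM.
    apply: (measurableT_comp (@normr_measurable R setT)).
    exact: (measurableT_comp (@measurable_ln R) measurable_rV_norm).
  by apply: measurable_indic; exact: measurable_rV_ball.
have L0 (w : V) : (0 <= (`|ln `|w| | * \1_(ball (0 : V) D) w)%:E)%E.
  by rewrite lee_fin mulr_ge0.
have mLx := measurableT_comp mL (measurable_reflect x).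
rewrite -lee_fin; apply: (le_trans (cabs_cint i3)).
apply: (@le_trans _ _ (\int[leb]_z (M%:E *
   (`|ln `|x - z| | * \1_(ball (0 : V) D) (x - z))%:E))%E).
  apply: ae_ge0_le_integral; first exact: measurableT.
  - by move=> z _; rewrite lee_fin cabs_ge0.
  - exact: cmeas_cabse (cintegrable_meas i3).
  - by move=> z _; rewrite -EFinM lee_fin mulr_ge0// mulr_ge0.
  - by apply: emeasurable_funM; [exact: measurable_cst|exact: mLx].
  (* at [z = x] the value [ln 0 = 0] would break the bound *)
  apply: filterS (ae_neq N0 x) => z zx _.
  rewrite -mulrBr -EFinM lee_fin cabsM.
  apply: ler_pM; [exact: cabs_ge0|exact: cabs_ge0|exact: HM|].
  rewrite cabs_realB; have xz : 0 < `|x - z| by rewrite normr_gt0 subr_eq0 eq_sym.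
  have [xD|Dx] := ltP `|x - z| D; last first.
    by rewrite subrr normr0 mulr_ge0.
  rewrite indic_ball1// mulr1.
  have h1 : ln `|x - z| <= ln D by rewrite ler_ln ?posrE// ltW.
  have h2 : ln D <= 0 by rewrite -ln1 ler_ln ?posrE.
  by rewrite !ler0_norm ?subr_le0// ?(le_trans h1)//; lra.
rewrite ge0_integralZl_EFin; [|exact: measurableT|by move=> z _; exact: L0|exact: mLx|exact: M0].
have := ge0_integral_reflect x mL L0; rewrite /reflect_at => ->.
apply: le_trans (lee_wpmul2l _ HD) _; first by rewrite lee_fin.
rewrite -EFinM lee_fin mulrCA ler_piMr ?(ltW e0)// ler_pdivrMr// mul1r.
by rewrite lerDl.
Qed.

(** Euclidean and max norm are comparable, so their logarithms differ by a bounded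
    amount. *)
Lemma ln_enorm_near (w : V) : `|ln (enorm w) - ln `|w| | <= ln N%:R.
Proof.
have N1 : 1 <= (N%:R : R) by rewrite ler1n.
have [->|w0] := eqVneq w 0.
  have e0 : enorm (0 : V) = 0.
    by apply/eqP; rewrite eq_le enorm_ge0 andbT (le_trans (enorm_le_norm _))// normr0 mulr0.
  by rewrite e0 normr0 subrr normr0 ln_ge0.
have p0 : 0 < `|w| by rewrite normr_gt0.
have p1 : 0 < enorm w by exact: lt_le_trans (norm_le_enorm w).
have n0 : 0 < (N%:R : R) by rewrite ltr0n.
rewrite ger0_norm; last by rewrite subr_ge0 ler_ln ?posrE// norm_le_enorm.
rewrite lerBlDr -lnM ?posrE// ler_ln ?posrE ?mulr_gt0//.
exact: enorm_le_norm.
Qed.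

Lemma measurable_enorm : measurable_fun setT (@enorm R N).
Proof.
apply: (measurableT_comp (f := @Num.sqrt R)).
  by apply: continuous_measurable_fun; exact: sqrt_continuous.
apply: measurable_sum => i.
by apply: measurable_funX; exact: measurable_coord.
Qed.

Lemma cmeas_log_kernel (c : R) x : cmeas (fun z => log_kernel c (x - z)).
Proof.
apply: cmeas_real; apply: measurable_funM; first exact: measurable_cst.
apply: (measurableT_comp (@measurable_ln R)).
exact: (measurableT_comp measurable_enorm (measurable_reflect x)).
Qed.

Lemma log_kernel_section (c : R) x f : hardy_dense f ->
  cintegrable (fun z => f z * log_kernel c (x - z)) /\
  cabs (cint (fun z => f z * log_kernel c (x - z))) <=
  `|c| * (cabs (cint (fun z => f z * (ln `|x - z|)%:C%C)) + ln N%:R * L1n f).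
Proof.
move=> fd; have [fi _ _ _] := fd.
pose d z : R[i] := (ln (enorm (x - z)))%:C%C - (ln `|x - z|)%:C%C.
have dle z : cabs (d z) <= ln N%:R by rewrite cabs_realB ln_enorm_near.
have md : cmeas d.
  apply: cmeasB; last exact: cmeas_ln_norm.
  have := cmeas_log_kernel 1 x; congr cmeas; apply/funext => z.
  by rewrite /log_kernel mul1r.
have i1 := norm_log_section N0 x fd.
have i2 : cintegrable (fun z => f z * d z).
  exact: (@cintegrable_bounded_mul _ _ _ _ _ _ (ln N%:R)).
have i3 := cintegrableD i1 i2.
have -> : (fun z => f z * log_kernel c (x - z)) =
  (fun z => c%:C%C * (f z * (ln `|x - z|)%:C%C + f z * d z)).
  apply/funext => z; rewrite /d -mulrDr addrCA subrr addr0 /log_kernel rmorphM/=.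
  by rewrite mulrCA.
split; first exact: cintegrableZ.
rewrite [X in cabs X](cintZ _ i3) cabsM cabs_real ler_wpM2l//.
rewrite [X in cabs X](cintD i1 i2) (le_trans (cabsD _ _))// lerD2l.
apply: (cabs_cint_bounded_mul _ fi i2) => [|z]; first by rewrite ln_ge0// ler1n.
by rewrite cabsM mulrC ler_wpM2r ?cabs_ge0.
Qed.

(** The pairing with the translated logarithmic kernel is bounded on the dense class by
    the Hardy norm, uniformly in the translation. *)
Lemma log_kernel_bound (c : R) : exists2 K : R, 0 <= K &
  forall f, hardy_dense f -> hardy Phi f -> forall x,
  cabs (cint (fun z => f z * log_kernel c (x - z))) <= K * hardy_norm Phi f.
Proof.
have [K K0 HK] := norm_log_bound; have lN : 0 <= ln (N%:R : R) by rewrite ln_ge0// ler1n.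
exists (`|c| * (K + ln N%:R)); first by rewrite mulr_ge0// addr_ge0.
move=> f fd fh x; have [_ H] := log_kernel_section c x fd.
apply: (le_trans H); rewrite -mulrA ler_wpM2l// mulrDl; apply: lerD; first exact: HK.
by rewrite ler_wpM2l//; exact: (L1n_le_hardy_norm HC Phi1 fh).
Qed.

End log_pairing.

(** * Atoms belong to the Hardy space *)

Section atoms.
Context {R : realType} {N : nat}.
Notation V := 'rV[R]_N.
Notation leb := (lebesgue_rV (R := R) N).
Implicit Types (x y z : V) (f g : V -> R[i]).
Variables (Phi : V -> R[i]) (C : R).
Hypothesis HC : kernel_bounds C Phi.

Let C_ge0 : 0 <= C. Proof. by case: HC. Qed.

Notation u s f := (convol (dilate s Phi) f).

Lemma L1n_reflect x f : cmeas f -> L1n (fun y => f (x - y)) = L1n f.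
Proof.
move=> mf; rewrite /L1n /L1e.
rewrite -(ge0_integral_reflect x (cmeas_cabse mf))// => w.
by rewrite lee_fin cabs_ge0.
Qed.

Lemma maximal_bounded f (M : R) x : 0 <= M -> cintegrable f -> (forall y, cabs (f y) <= M) ->
  (maximal_fun Phi f x <= (M * L1n Phi)%:E)%E.
Proof.
move=> M0 fi fM; apply: maximal_le => s s0; rewrite lee_fin.
have [di _] := dilate_integrable s0 (Phi_integrable HC).
rewrite -(L1n_dilate s0 (Phi_meas HC)) -(L1n_reflect x (cintegrable_meas di)).
apply: (cabs_cint_bounded_mul M0 (cint_reflect x di).1 (dilPhi_section HC x s0 fi)) => y.
by rewrite cabsM mulrC ler_wpM2r ?cabs_ge0.
Qed.

(** The [s ^ - N] of the dilation and the decay of order [N + 1] combine into a bound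
    that is uniform in the scale. *)
Lemma dilPhi_increment (s : R) x y : 0 < s -> 2 * `|y| <= `|x| -> 1 <= `|x| ->
  cabs (dilate s Phi (x - y) - dilate s Phi x) <=
  C * `|y| * (2 ^+ N.+1 * weight N.+1 x).
Proof.
move=> s0 yx x1; have s1 : 0 <= s^-1 by rewrite invr_ge0 ltW.
have sN : 0 <= s ^- N by rewrite invr_ge0 exprn_ge0// ltW.
rewrite /dilate -mulrBr cabsM cabs_real ger0_norm//.
have [_ _ _ H] := HC.
have hs : 2 * `|- (s^-1 *: y)| <= `|s^-1 *: x|.
  by rewrite normrN !normrZ ger0_norm// mulrCA ler_wpM2l.
have := H _ _ hs; rewrite -scalerBr => /(ler_wpM2l sN)/le_trans; apply.
rewrite normrN normrZ ger0_norm// /weight normrZ ger0_norm//.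
have x0 : 0 < `|x| by exact: lt_le_trans x1.
have E : s ^- N * (C * (s^-1 * `|y|) * (1 + s^-1 * `|x|) ^- N.+1) =
   C * `|y| * (s + `|x|) ^- N.+1.
  have -> : s + `|x| = s * (1 + s^-1 * `|x|) by field; rewrite gt_eqF.
  have p0 : 1 + s^-1 * `|x| != 0 by rewrite gt_eqF// ltr_wpDr// mulr_ge0.
  rewrite exprMn (exprS s); field.
  by rewrite !expf_neq0// gt_eqF.
rewrite E ler_wpM2l ?mulr_ge0//.
have a1 : 0 < 1 + `|x| by rewrite addr_gt0.
have a2 : 0 < s + `|x| by rewrite addr_gt0.
rewrite -[2 ^+ N.+1]invrK -invfM lef_pV2 ?posrE ?mulr_gt0 ?exprn_gt0 ?invr_gt0//.
rewrite -exprVn -exprMn lerXn2r ?nnegrE ?mulr_ge0 ?(ltW a1) ?(ltW a2)//.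
lra.
Qed.

(** Cancellation against a smooth kernel gives decay of order [N + 1]. *)
Lemma hardy_dense_hardy f : hardy_dense f -> hardy Phi f.
Proof.
move=> fd; have [r0 r00 Hr0] := hardy_dense_support fd; have [fi [M HM] _ f0] := fd.
have M0 : 0 <= M by rewrite (le_trans (cabs_ge0 _) (HM 0)).
pose r := r0 + 1; have r1 : 1 <= r by rewrite lerDr.
have Hr z : r < `|z| -> f z = 0.
  by move=> rz; apply: Hr0; rewrite (lt_trans _ rz)// ltrDl.
(* [K1] serves near the support and [K2] far from it *)
pose K1 := M * L1n Phi * (1 + 2 * r) ^+ N.+1.
pose K2 := C * r * 2 ^+ N.+1 * L1n f.
have r0' : 0 <= r by exact: le_trans r1.
have K10 : 0 <= K1 by rewrite !mulr_ge0 ?exprn_ge0 ?L1n_ge0// addr_ge0// mulr_ge0.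
have K20 : 0 <= K2 by rewrite !mulr_ge0 ?exprn_ge0 ?L1n_ge0.
have Mle x : (maximal_fun Phi f x <= ((K1 + K2) * weight N.+1 x)%:E)%E.
  have [xr|rx] := ltP `|x| (2 * r).
    apply: (le_trans (maximal_bounded x M0 fi HM)); rewrite lee_fin mulrDl.
    apply: ler_wpDr; first by rewrite mulr_ge0// weight_ge0.
    have a0 : 0 < 1 + `|x| by rewrite ltr_pwDl.
    rewrite /K1 -mulrA ler_peMr ?mulr_ge0 ?L1n_ge0// /weight ler_pdivlMr ?exprn_gt0//.
    rewrite mul1r lerXn2r ?nnegrE ?(ltW a0) ?addr_ge0 ?mulr_ge0//.
    by rewrite lerD2l ltW.
  apply: maximal_le => s s0; rewrite lee_fin mulrDl.
  apply: ler_wpDl; first by rewrite mulr_ge0// weight_ge0.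
  have i1 := dilPhi_section HC x s0 fi.
  have i2 := cintegrableZ (dilate s Phi x) fi.
  have i3 := cintegrableB i1 i2.
  have -> : u s f x = cint (fun y => dilate s Phi (x - y) * f y - dilate s Phi x * f y).
    by rewrite [RHS](cintB i1 i2) [X in _ - X](cintZ _ fi) [X in _ * X]f0 mulr0 subr0.
  rewrite /K2 mulrAC.
  apply: (cabs_cint_bounded_mul _ fi i3) => [|y].
    by rewrite !mulr_ge0 ?exprn_ge0 ?weight_ge0.
  rewrite -mulrBl cabsM; have [ry|yr] := ltP r `|y|.
    by rewrite (Hr _ ry) cabs0 !mulr0.
  rewrite ler_wpM2r ?cabs_ge0//.
  have x1 : 1 <= `|x| by rewrite (le_trans _ rx)// (le_trans r1)// ler_peMl// ler1n.
  have yx : 2 * `|y| <= `|x| by rewrite (le_trans _ rx)// ler_pM2l.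
  apply: (le_trans (dilPhi_increment s0 yx x1)).
  rewrite mulrA ler_wpM2r ?weight_ge0// ler_wpM2r ?exprn_ge0// ler_wpM2l//.
apply/(hardyP HC); split; first exact: fi.
rewrite HnormE.
have wi : leb.-integrable setT (fun x : V => ((K1 + K2) * weight N.+1 x)%:E).
  exact: (integrableZl _ (K1 + K2) integrable_weight).
have W0 (x : V) : (0 <= ((K1 + K2) * weight N.+1 x)%:E)%E.
  by rewrite lee_fin mulr_ge0 ?weight_ge0// addr_ge0.
have /integrableP[mw] := wi; apply: le_lt_trans.
apply: ge0_le_integral; first exact: measurableT.
- by move=> x _; exact: maximal_ge0.
- exact: (measurable_maximal HC fi).
- by apply: measurableT_comp.
- by move=> x _; rewrite gee0_abs.
Qed.

(** The integral of a convolution. *)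
Lemma cint_convol f g : cintegrable f -> cintegrable g ->
  cint (convol f g) = cint f * cint g.
Proof.
move=> fi gi; have cp := cintegrable_conv_prod fi gi.
rewrite [LHS](cfubini cp) -[RHS](cintZ _ gi); apply: (@eq_cint _ _ _ leb) => y.
have [i <-] := cint_shift (- y) fi; rewrite mulrC -[RHS](cintZ _ i).
by apply: (@eq_cint _ _ _ leb) => x; rewrite mulrC.
Qed.

End atoms.

(** * Density of Lipschitz functions with compact support and mean zero *)

Section bump.
Context {R : realType} {N : nat}.
Notation V := 'rV[R]_N.
Notation leb := (lebesgue_rV (R := R) N).
Implicit Types (x y z : V) (f g : V -> R[i]).

(** A Lipschitz function of integral one supported in the unit ball. *)
Definition unit_bump (L : R) (eta : V -> R[i]) : Prop :=
  [/\ 0 <= L, cint eta = 1, clipschitz L eta, forall x, cabs (eta x) <= L &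
      forall x, 1 <= `|x| -> eta x = 0].

(** An unnormalised Lipschitz bump. *)
Definition tent x : R := Num.max 0 (1 - `|x|).

Lemma tent_ge0 x : 0 <= tent x.
Proof. by rewrite le_max lexx. Qed.

Lemma tent_le1 x : tent x <= 1.
Proof. by rewrite ge_max ler01/= gerBl. Qed.

Lemma tent_far x : 1 <= `|x| -> tent x = 0.
Proof. by move=> x1; rewrite /tent max_l// subr_le0. Qed.

Lemma tent_lipschitz x y : `|tent x - tent y| <= `|x - y|.
Proof.
have /ler_normlP[h1 h2] := ler_dist_dist x y; rewrite opprB in h1.
by rewrite /tent; case: (leP 0 (1 - `|x|)) => ?; case: (leP 0 (1 - `|y|)) => ?; rewrite ler_norml;
  apply/andP; split; have := normr_ge0 (x - y); lra.
Qed.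

Lemma measurable_tent : measurable_fun setT tent.
Proof.
apply: continuous_measurable_rV; apply: (@lipschitz_continuous _ _ _ 1) => x y.
by rewrite mul1r tent_lipschitz.
Qed.

Lemma tent_integrable : leb.-integrable setT (EFin \o tent).
Proof.
apply/integrableP; split; first by apply/measurable_EFinP; exact: measurable_tent.
apply: (@le_lt_trans _ _ (\int[leb]_x (1 * \1_(ball (0 : V) 1) x)%:E)%E); last first.
  by rewrite integral_indic_ball// ltry.
apply: ge0_le_integral => //.
- apply: measurableT_comp => //; apply/measurable_EFinP; exact: measurable_tent.
- exact: measurable_indic_ball.
move=> x _; rewrite /= lee_fin ger0_norm ?tent_ge0// mul1r.
have [x1|x1] := ltP `|x| 1; first by rewrite indic_ball1// tent_le1.
by rewrite tent_far.
Qed.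

Lemma tent_mass_gt0 : 0 < \int[leb]_x tent x.
Proof.
have h2 : 0 < (2^-1 : R) by rewrite invr_gt0.
apply: (@lt_le_trans _ _ 2^-1) => //.
rewrite -lee_fin /Rintegral fineK; last exact: (integrable_fin_num _ tent_integrable).
apply: (@le_trans _ _ (\int[leb]_x (2^-1 * \1_(ball (0 : V) 2^-1) x)%:E)%E).
  by rewrite integral_indic_ball ?(ltW h2)// -(mulr_natr 2^-1 2) mulVf// expr1n mulr1.
apply: ge0_le_integral => //.
- exact: measurable_indic_ball.
- apply/measurable_EFinP; exact: measurable_tent.
move=> x _; rewrite lee_fin; have [x1|x1] := ltP `|x| 2^-1.
  by rewrite indic_ball1// mulr1 /tent le_max; apply/orP; right; lra.
rewrite indicE memNset ?mulr0 ?tent_ge0// ball0E; apply/negP; by rewrite -leNgt.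
Qed.

Lemma exists_unit_bump : exists L eta, unit_bump L eta.
Proof.
have m0 := tent_mass_gt0; set m := Rintegral _ _ _ in m0.
have ti := cintegrable_real tent_integrable.
exists m^-1, (fun x => (m^-1)%:C%C * (tent x)%:C%C); split.
- by rewrite invr_ge0 ltW.
- rewrite [LHS](cintZ _ ti) [X in _ * X]cint_real -/m -rmorphM/= mulVf ?gt_eqF//.
- move=> x y; rewrite -mulrBr cabsM cabs_realB cabs_real ger0_norm ?invr_ge0 ?(ltW m0)//.
  by rewrite ler_wpM2l ?tent_lipschitz// invr_ge0 ltW.
- move=> x; rewrite cabsM !cabs_real ger0_norm ?invr_ge0 ?(ltW m0)//.
  by rewrite ger0_norm ?tent_ge0// ler_piMr ?tent_le1// invr_ge0 ltW.
- by move=> x x1; rewrite tent_far// mulr0.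
Qed.

Lemma unit_bump_integrable L eta : unit_bump L eta -> cintegrable eta.
Proof.
move=> [L0 _ Le be se].
apply: (le_cintegrable (g := fun x => L * \1_(ball (0 : V) 1) x)).
- exact: clipschitz_meas Le.
- apply/integrableP; split; first exact: measurable_indic_ball.
  rewrite (eq_integral (fun x => (L * \1_(ball (0 : V) 1) x)%:E)).
    by rewrite integral_indic_ball// ltry.
  by move=> x _; rewrite /= ger0_norm// mulr_ge0.
- move=> x; have [x1|x1] := ltP `|x| 1; first by rewrite indic_ball1// mulr1.
  by rewrite se// cabs0 mulr_ge0.
Qed.

End bump.

Section density.
Context {R : realType} {N : nat}.
Notation V := 'rV[R]_N.
Notation leb := (lebesgue_rV (R := R) N).
Implicit Types (x y z : V) (f g : V -> R[i]).
Variables (Phi : V -> R[i]) (C : R).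
Hypothesis HC : kernel_bounds C Phi.
Hypothesis Phi1 : cint Phi = 1.
Hypothesis N0 : (0 < N)%N.
Variables (L : R) (eta : V -> R[i]).
Hypothesis He : unit_bump L eta.

Let L0 : 0 <= L. Proof. by case: He. Qed.
Let ei : cintegrable eta := unit_bump_integrable He.
Let me : cmeas eta := cintegrable_meas ei.

Notation u s f := (convol (dilate s Phi) f).
Notation E := (L1n eta).

Lemma dil_bump_integrable (t : R) : 0 < t ->
  cintegrable (dilate t eta) /\ cint (dilate t eta) = 1.
Proof. by move=> t0; have [h1 h2] := dilate_integrable t0 ei; case: He => _ <-. Qed.

Lemma dil_bump_L1e (t : R) : 0 < t -> L1e (dilate t eta) = E%:E.
Proof. by move=> t0; rewrite L1e_dilate// L1eE. Qed.

Lemma dil_bump_le (t : R) x : 0 < t -> cabs (dilate t eta x) <= t ^- N * L.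
Proof. by move=> t0; apply: cabs_dilate_le => //; case: He. Qed.

Lemma dil_bump_support (t : R) x : 0 < t -> t <= `|x| -> dilate t eta x = 0.
Proof.
move=> t0 tx; rewrite /dilate; case: He => _ _ _ _ ->; first by rewrite mulr0.
by rewrite normrZ ger0_norm ?invr_ge0 ?(ltW t0)// mulrC ler_pdivlMr// mul1r.
Qed.

Lemma dil_bump_lipschitz (t : R) : 0 < t -> clipschitz (t ^- N * (L * t^-1)) (dilate t eta).
Proof.
move=> t0 x y; rewrite /dilate -mulrBr cabsM cabs_real ger0_norm; last first.
  by rewrite invr_ge0 exprn_ge0// ltW.
rewrite -!mulrA ler_wpM2l ?invr_ge0 ?exprn_ge0 ?(ltW t0)//.
case: He => _ _ Le _ _; rewrite (le_trans (Le _ _))// ler_wpM2l//.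
by rewrite -scalerBr normrZ ger0_norm// invr_ge0 ltW.
Qed.

Lemma dil_bump_section (t : R) f x : 0 < t -> cintegrable f ->
  cintegrable (fun y => dilate t eta (x - y) * f y).
Proof.
move=> t0 fi; apply: convol_section_integrable fi; first exact: dilate_meas.
by move=> y; exact: dil_bump_le.
Qed.

Lemma bump_conv_integrable (t : R) f : 0 < t -> cintegrable f ->
  cintegrable (convol (dilate t eta) f).
Proof. by move=> t0 fi; exact: (cintegrable_convol (dil_bump_integrable t0).1 fi).1. Qed.

Lemma cabs_cint_le_econv g (H : V -> R[i]) (F : V -> \bar R) x :
  cmeas g -> cintegrable (fun w => H (x - w) * g w) -> measurable_fun setT F ->
  (forall y, (cabs (H y))%:E <= F y)%E ->
  ((cabs (cint (fun w => H (x - w) * g w)))%:E <= econv g F x)%E.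
Proof.
move=> mg Hi mF HF; apply: (le_trans (cabs_cint Hi)).
apply: ge0_le_integral; first exact: measurableT.
- by move=> w _; rewrite lee_fin cabs_ge0.
- exact: cmeas_cabse (cintegrable_meas Hi).
- apply: emeasurable_funM; first exact: cmeas_cabse mg.
  exact: (measurableT_comp mF (measurable_reflect x)).
- by move=> w _; rewrite cabsM mulrC EFinM lee_wpmul2l ?lee_fin ?cabs_ge0.
Qed.

(** Away from the origin an average over a small ball only sees the tail. *)
Lemma econv_far (t r : R) (F : V -> \bar R) x : 0 < t -> measurable_fun setT F ->
  (forall y, 0 <= F y)%E -> r + t <= `|x| ->
  (econv (dilate t eta) F x <= econv (dilate t eta) (fun y => F y * (\1_(far r) y)%:E) x)%E.
Proof.
move=> t0 mF F0 rx; apply: (le_econv (dilate_meas _ me) mF) => //.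
  by apply: measurable_mul_indic => //; exact: measurable_far.
move=> w w0; rewrite indicE mem_set ?mule1// /far/=.
have wt : `|w| < t.
  by rewrite ltNge; apply: contra w0 => /(dil_bump_support t0) ->.
have := ler_normD (x - w) w; rewrite subrK; lra.
Qed.

Lemma integral_econv_bump (t : R) (F : V -> \bar R) : 0 < t -> measurable_fun setT F ->
  (forall y, 0 <= F y)%E ->
  (\int[leb]_x econv (dilate t eta) F x = E%:E * \int[leb]_x F x)%E.
Proof.
by move=> t0 mF F0; rewrite integral_econv ?dil_bump_L1e//; exact: dilate_meas.
Qed.

(** Bound for the increments of the bump dilated by [t], up to the factor [t ^ - N]. *)
Definition flat (t : R) y : R := Num.min (2 * L) (L * `|y| / t).

Lemma flat_bounds (t : R) y : 0 < t -> 0 <= flat t y <= 2 * L.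
Proof.
by move=> t0; rewrite le_min ge_min lexx !mulr_ge0//= invr_ge0 ltW.
Qed.

Lemma measurable_flat (t : R) : measurable_fun setT (flat t).
Proof.
apply: measurable_minr => //; apply: measurable_funM => //.
by apply: measurable_funM => //; exact: measurable_rV_norm.
Qed.

(** Cancellation makes averages at scale [t] smaller than [t ^ -N]. *)
Lemma bump_conv_le (t : R) f x : 0 < t -> cintegrable f -> cint f = 0 ->
  ((cabs (convol (dilate t eta) f x))%:E <=
   (t ^- N)%:E * \int[leb]_y (flat t y * cabs (f y))%:E)%E.
Proof.
move=> t0 fi f0; have tN : 0 <= t ^- N by rewrite invr_ge0 exprn_ge0// ltW.
have i1 := dil_bump_section x t0 fi.
have i2 := cintegrableZ (dilate t eta x) fi.
have i3 := cintegrableB i1 i2.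
have -> : convol (dilate t eta) f x =
    cint (fun y => dilate t eta (x - y) * f y - dilate t eta x * f y).
  by rewrite [RHS](cintB i1 i2) [X in _ - X](cintZ _ fi) [X in _ * X]f0 mulr0 subr0.
have mF : measurable_fun setT (fun y => flat t y * cabs (f y)).
  by apply: measurable_funM; [exact: measurable_flat|exact/cmeas_cabs/(cintegrable_meas fi)].
rewrite -ge0_integralZl_EFin; [|exact: measurableT| |exact/measurable_EFinP|exact: tN]; last first.
  by move=> y _; have /andP[h _] := flat_bounds y t0; rewrite lee_fin mulr_ge0// cabs_ge0.
apply: (@le_trans _ _ (\int[leb]_y (t ^- N * (flat t y * cabs (f y)))%:E)%E).
  apply: (cabs_cint_le i3) => [|y]; first exact: measurable_funM.
  rewrite -mulrBl cabsM mulrA ler_wpM2r ?cabs_ge0//.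
  rewrite /flat minr_pMr//; rewrite le_min; apply/andP; split.
    apply: (le_trans (cabsB _ _)); rewrite mulrCA mulr_natl mulr2n.
    by apply: lerD; exact: dil_bump_le.
  apply: (le_trans (dil_bump_lipschitz t0 _ _)).
  rewrite (_ : x - y - x = - y) ?normrN; last by rewrite addrAC subrr add0r.
  by rewrite -!mulrA [t^-1 * _]mulrC.
by rewrite le_eqVlt; apply/orP; left; apply/eqP; apply: eq_integral => y _; rewrite EFinM.
Qed.

(** Averages at large scales are small in the Hardy space: in the ball of radius [2 * t]
    by cancellation, outside it by the tail of the maximal function. *)
Lemma Hnorm_bump_conv_small f : hardy Phi f -> forall e : R, 0 < e ->
  exists2 t : R, 0 < t & (Hnorm Phi (convol (dilate t eta) f) <= e%:E)%E.
Proof.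
move=> fh e e0; have [fi Mi] := fh; have f0 := hardy_mean0 HC Phi1 N0 fh.
have mM := measurable_maximal HC fi.
have M0 x : (0 <= maximal_fun Phi f x)%E by exact: maximal_ge0.
pose K := 4 ^+ N * L1n Phi + E + 1.
have K0 : 0 < K by rewrite ltr_wpDl// addr_ge0 ?L1n_ge0// mulr_ge0 ?L1n_ge0 ?exprn_ge0.
have e1 : 0 < e / K by rewrite divr_gt0.
have [n1 H1] : exists n0, forall n, (n0 <= n)%N ->
    (\int[leb]_y (flat n.+1%:R y * cabs (f y))%:E <= (e / K)%:E)%E.
  apply: (dominated_small (F := fun n y => (flat n.+1%:R y * cabs (f y))%:E)
    (G := fun y => ((2 * L) * cabs (f y))%:E)) => //.
  - move=> n; apply/measurable_EFinP; apply: measurable_funM; first exact: measurable_flat.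
    exact/cmeas_cabs/(cintegrable_meas fi).
  - move=> n y; have /andP[h1 h2] := flat_bounds y (ltr0Sn R n).
    by rewrite !lee_fin mulr_ge0 ?cabs_ge0//= ler_wpM2r ?cabs_ge0.
  - exact: (integrableZl _ (2 * L) (cintegrable_cabs fi)).
  apply: aeW => y d d0; exists (Num.truncn (L * `|y| * cabs (f y) / d)) => n nd.
  rewrite lee_fin; apply: (@le_trans _ _ (L * `|y| / n.+1%:R * cabs (f y))).
    by rewrite ler_wpM2r ?cabs_ge0// ge_min lexx orbT.
  rewrite mulrAC ler_pdivrMr// -ler_pdivrMl// [leLHS]mulrC.
  by apply: ltW; apply: (lt_le_trans (truncnS_gt _)); rewrite ler_nat.
have [n2 H2] := far_integral_small M0 Mi e1.
pose n := maxn n1 n2; pose t : R := n.+1%:R.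
have {}H1 := H1 n (leq_maxl _ _).
have {}H2 := H2 n.+1 (leq_trans (leq_maxr _ _) (leqnSn _)).
have t0 : 0 < t by [].
have tN : 0 <= t ^- N by rewrite invr_ge0 exprn_ge0.
exists t => //.
pose A : R := t ^- N * (e / K) * L1n Phi.
have A0 : 0 <= A by rewrite mulr_ge0 ?L1n_ge0// mulr_ge0// ltW.
pose F y : \bar R := (maximal_fun Phi f y * (\1_(far t) y)%:E)%E.
have mF : measurable_fun setT F by apply: measurable_mul_indic => //; exact: measurable_far.
have F0 y : (0 <= F y)%E by have /andP[] := mul_indic_ge0 (far t) (M0 y).
have mE : measurable_fun setT (econv (dilate t eta) F).
  by apply: measurable_econv => //; exact: dilate_meas.
have E0 x : (0 <= econv (dilate t eta) F x)%E by exact: econv_ge0.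
have ci := bump_conv_integrable t0 fi.
have Mle x : (maximal_fun Phi (convol (dilate t eta) f) x <=
    (A * \1_(ball (0 : V) (2 * t)) x)%:E + econv (dilate t eta) F x)%E.
  have [xt|tx] := ltP `|x| (2 * t).
    rewrite indic_ball1// mulr1; apply: le_trans (leeDl _ (E0 x)).
    apply: (maximal_bounded HC x _ ci) => [|y]; first by rewrite mulr_ge0 ?(ltW e1).
    rewrite -lee_fin; apply: (le_trans (bump_conv_le y t0 fi f0)).
    by rewrite [leRHS]EFinM lee_wpmul2l ?lee_fin.
  have A1 : (0 <= (A * \1_(ball (0 : V) (2 * t)) x)%:E)%E by rewrite lee_fin mulr_ge0.
  apply: le_trans (leeDr _ A1).
  apply: le_trans (econv_far (r := t) t0 mM M0 _); last by rewrite -mulr2n -mulr_natl.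
  apply: (maximal_convol HC x (dil_bump_integrable t0).1 fi) => y.
  exact: dil_bump_section.
rewrite HnormE; apply: (@le_trans _ _ (\int[leb]_x
   ((A * \1_(ball (0 : V) (2 * t)) x)%:E + econv (dilate t eta) F x))%E).
  apply: ge0_le_integral; first exact: measurableT.
  - by move=> x _; exact: maximal_ge0.
  - exact: (measurable_maximal HC ci).
  - by apply: emeasurable_funD => //; exact: measurable_indic_ball.
  - by move=> x _; exact: Mle.
rewrite ge0_integralD; [|exact: measurableT|by move=> x _; rewrite lee_fin mulr_ge0|
  exact: measurable_indic_ball|by move=> x _; exact: E0|exact: mE].
rewrite integral_indic_ball ?mulr_gt0// (integral_econv_bump t0 mF F0).
apply: (@le_trans _ _ ((4 ^+ N * L1n Phi * (e / K))%:E + (E * (e / K))%:E)%E).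
  apply: leeD; last by rewrite EFinM lee_wpmul2l ?lee_fin ?L1n_ge0.
  rewrite lee_fin le_eqVlt; apply/orP; left; apply/eqP.
  rewrite (_ : (2 * t) *+ 2 = 4 * t); last by rewrite -mulr_natl mulrA -natrM.
  by rewrite /A exprMn; field; rewrite (gt_eqF K0) expf_neq0// gt_eqF.
rewrite -EFinD lee_fin -mulrDl mulrCA ler_piMr ?(ltW e0)// ler_pdivrMr// mul1r.
by rewrite lerDl.
Qed.

End density.

Lemma sub_telescope1 (T : comPzRingType) (a b c d e : T) :
  (a - b) * e - ((a - c) * e - (b - d) * e) = (c - d) * e.
Proof. by ring. Qed.

Lemma sub_telescope2 (T : comPzRingType) (a b c d e : T) :
  (a - c) * e = (a - b) * e - (c - d) * e + (b - d) * e.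
Proof. by ring. Qed.

Section density_hardy.
Context {R : realType} {N : nat}.
Notation V := 'rV[R]_N.
Notation leb := (lebesgue_rV (R := R) N).
Implicit Types (x y z : V) (f g : V -> R[i]).
Variables (Phi : V -> R[i]) (C : R).
Hypothesis HC : kernel_bounds C Phi.
Hypothesis Phi1 : cint Phi = 1.
Hypothesis N0 : (0 < N)%N.
Variables (L : R) (eta : V -> R[i]).
Hypothesis He : unit_bump L eta.

Let C_ge0 : 0 <= C. Proof. by case: HC. Qed.
Let ei : cintegrable eta := unit_bump_integrable He.
Let me : cmeas eta := cintegrable_meas ei.

Notation u s f := (convol (dilate s Phi) f).
Notation E := (L1n eta).
Notation eta_ t := (dilate t eta).

(** Averages of [f - eta_t * f] as averages of differences of translates. *)
Lemma u_sub_bump (s t : R) f x : 0 < s -> 0 < t -> cintegrable f ->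
  cintegrable (fun w => (u s f x - u s f (x - w)) * eta_ t w) /\
  u s (fun x => f x - convol (eta_ t) f x) x =
  cint (fun w => (u s f x - u s f (x - w)) * eta_ t w).
Proof.
move=> s0 t0 fi; have [di d1] := dil_bump_integrable He t0.
have ci := bump_conv_integrable He t0 fi.
have K y : cabs (dilate s Phi y) <= s ^- N * C by exact: (dilPhi_le HC).
have i1 := cintegrableZ (u s f x) di.
have i2 : cintegrable (fun w => u s f (x - w) * eta_ t w).
  under eq_fun do rewrite mulrC.
  apply: (@cintegrable_bounded_mul _ _ _ _ _ _ (s ^- N * C * L1n f)) => //.
    exact: cmeas_reflect (clipschitz_meas (u_lipschitz HC s0 fi)).
  by move=> w; exact: (cabs_convol_bounded _ (dilPhi_meas HC s)).
have Ef : (fun w => (u s f x - u s f (x - w)) * eta_ t w) =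
   (fun w => u s f x * eta_ t w - u s f (x - w) * eta_ t w).
  by apply/funext => w; rewrite mulrBl.
rewrite Ef; split; first exact: cintegrableB.
rewrite [RHS](cintB i1 i2) [X in X - _](cintZ _ di) [X in _ * X - _]d1 mulr1.
have ni := cintegrableN ci.
rewrite [LHS](uD HC x s0 fi ni); congr (_ + _).
have -> : (fun y => - convol (eta_ t) f y) = (fun y => -1 * convol (eta_ t) f y).
  by apply/funext => y; rewrite mulN1r.
rewrite (uZ HC _ x s0 ci) mulN1r; congr (- _).
apply: (convolA x (dilPhi_meas HC s) K di fi) => y.
exact: (dil_bump_section He).
Qed.

Lemma u_sub_bump_le (s t : R) f x (Ls : R) : 0 < s -> 0 < t -> cintegrable f -> 0 <= Ls ->
  clipschitz Ls (u s f) ->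
  cabs (u s (fun x => f x - convol (eta_ t) f x) x) <= Ls * t * E.
Proof.
move=> s0 t0 fi Ls0 uL; have [i ->] := u_sub_bump x s0 t0 fi.
have [di _] := dil_bump_integrable He t0.
rewrite -(L1n_dilate t0 me).
apply: (cabs_cint_bounded_mul _ di i) => [|w]; first by rewrite mulr_ge0// ltW.
rewrite cabsM; have [tw|wt] := leP t `|w|.
  by rewrite (dil_bump_support He t0 tw) cabs0 !mulr0.
rewrite ler_wpM2r ?cabs_ge0// (le_trans (uL _ _))// ler_wpM2l//.
by rewrite opprB addrC subrK ltW.
Qed.

(** The maximal function of [f - eta_t * f]: the scales below [d] are controlled by
    the oscillation, the larger ones by equicontinuity near the origin and by the tail
    of the maximal function of [f] elsewhere. *)
Lemma maximal_sub_bump_le (d t r : R) f x : 0 < d -> 0 < t -> t <= 1 -> cintegrable f ->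
  (maximal_fun Phi (fun x => f x - convol (eta_ t) f x)%R x <=
   E%:E * osc Phi d f x + econv (eta_ t) (osc Phi d f) x +
   (((d / 2) ^- N * (C * (d / 2)^-1) * L1n f * t * E * \1_(ball (0 : V) r) x)%:E +
    (maximal_fun Phi f x * (\1_(far r) x)%:E +
     econv (eta_ t) (fun y => maximal_fun Phi f y * (\1_(far (r - 1)%R) y)%:E) x)))%E.
Proof.
move=> d0 t0 t1 fi; pose b := d / 2; have b0 : 0 < b by rewrite divr_gt0.
have bd : b < d by rewrite ltr_pdivrMr// ltr_pMr// ltr1n.
have mO := measurable_osc HC d fi; have mM := measurable_maximal HC fi.
have O0 y : (0 <= osc Phi d f y)%E by exact: osc_ge0.
have M0 y : (0 <= maximal_fun Phi f y)%E by exact: maximal_ge0.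
have [di _] := dil_bump_integrable He t0.
set h := (fun x => f x - convol (eta_ t) f x).
set K := b ^- N * (C * b^-1) * L1n f * t * E.
have K0 : 0 <= K.
  rewrite mulr_ge0 ?L1n_ge0// mulr_ge0 ?(ltW t0)// mulr_ge0 ?L1n_ge0// mulr_ge0//.
    by rewrite invr_ge0 exprn_ge0// ltW.
  by rewrite mulr_ge0// invr_ge0 ltW.
set P := (_ + econv _ _ _)%E; set Q := (X in (_ <= P + X)%E).
have P0 : (0 <= P)%E.
  by rewrite adde_ge0 ?mule_ge0 ?lee_fin ?L1n_ge0//; exact: econv_ge0.
have FM0 y : (0 <= maximal_fun Phi f y * (\1_(far (r - 1)%R) y)%:E)%E.
  by have /andP[] := mul_indic_ge0 (far (r - 1)) (M0 y).
have R1 : (0 <= maximal_fun Phi f x * (\1_(far r) x)%:E)%E.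
  by have /andP[] := mul_indic_ge0 (far r) (M0 x).
have R2 := econv_ge0 (eta_ t) x FM0.
have R3 : (0 <= (K * \1_(ball (0 : V) r) x)%:E)%E by rewrite lee_fin mulr_ge0.
have Q0 : (0 <= Q)%E by rewrite adde_ge0// adde_ge0.
have large s : b <= s -> ((cabs (u s h x))%:E <= Q)%E.
  move=> bs; have s0 : 0 < s by exact: lt_le_trans bs.
  have [xr|rx] := ltP `|x| r.
    apply: (@le_trans _ _ (K * \1_(ball (0 : V) r) x)%:E); last by rewrite leeDl// adde_ge0.
    rewrite lee_fin indic_ball1// mulr1.
    apply: (u_sub_bump_le x s0 t0 fi) => [|y z].
      by rewrite !mulr_ge0 ?invr_ge0 ?exprn_ge0 ?L1n_ge0 ?(ltW b0).
    apply: (le_trans (u_lipschitz HC s0 fi y z)); rewrite ler_wpM2r// ler_wpM2r ?L1n_ge0//.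
    have h1 : s ^- N <= b ^- N.
      by rewrite lef_pV2 ?posrE ?exprn_gt0// lerXn2r ?nnegrE ?(ltW b0) ?(ltW s0).
    have h2 : s^-1 <= b^-1 by rewrite lef_pV2 ?posrE.
    apply: ler_pM => //; first by rewrite invr_ge0 exprn_ge0// ltW.
      by rewrite mulr_ge0// invr_ge0 ltW.
    by rewrite ler_wpM2l.
  apply: (@le_trans _ _ (maximal_fun Phi f x * (\1_(far r) x)%:E +
     econv (eta_ t) (fun y => maximal_fun Phi f y * (\1_(far (r - 1)%R) y)%:E) x)%E); last first.
    exact: leeDr.
  have ci := bump_conv_integrable He t0 fi.
  have ni := cintegrableN ci.
  have -> : u s h x = u s f x - u s (convol (eta_ t) f) x.
    rewrite [LHS](uD HC x s0 fi ni); congr (_ + _).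
    have -> : (fun y => - convol (eta_ t) f y) = (fun y => -1 * convol (eta_ t) f y).
      by apply/funext => y; rewrite mulN1r.
    by rewrite (uZ HC _ x s0 ci) mulN1r.
  apply: (@le_trans _ _ ((cabs (u s f x))%:E + (cabs (u s (convol (eta_ t) f) x))%:E)%E).
    by rewrite -EFinD lee_fin cabsB.
  apply: leeD.
    by rewrite indicE mem_set// mule1; exact: u_le_maximal.
  apply: (le_trans (u_le_maximal Phi _ x s0)).
  apply: le_trans (econv_far He (r := r - 1) t0 mM M0 _); last first.
    by apply: le_trans rx; lra.
  apply: (maximal_convol HC x di fi) => y; exact: (dil_bump_section He).
apply: maximal_le => s s0.
(* smaller scales are compared with the fixed scale [b] *)
have [bs|sb] := leP b s; first by apply: le_trans (large s bs) _; exact: leeDr.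
have sd : 0 < s < d by rewrite s0 (lt_trans sb).
have bd' : 0 < b < d by rewrite b0.
have [i1 ->] := u_sub_bump x s0 t0 fi.
have [i2 E2] := u_sub_bump x b0 t0 fi.
have i3 := cintegrableB i1 i2.
pose G y : R[i] := u s f y - u b f y.
have mG : cmeas G.
  by apply: cmeasB; [exact: clipschitz_meas (u_lipschitz HC s0 fi)|
    exact: clipschitz_meas (u_lipschitz HC b0 fi)].
have Gle y : ((cabs (G y))%:E <= osc Phi d f y)%E by exact: le_osc.
have iG1 : cintegrable (fun w => G x * eta_ t w) by exact: cintegrableZ.
have iG2 : cintegrable (fun w => G (x - w) * eta_ t w).
  have := cintegrableB iG1 i3; congr cintegrable; apply/funext => w.
  exact: sub_telescope1.
have -> : cint (fun w => (u s f x - u s f (x - w)) * eta_ t w) =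
   (cint (fun w => G x * eta_ t w) - cint (fun w => G (x - w) * eta_ t w)) + u b h x.
  rewrite [X in _ + X]E2 -[X in _ = X + _](cintB iG1 iG2).
  have i4 := cintegrableB iG1 iG2.
  rewrite -[RHS](cintD i4 i2); apply: (@eq_cint _ _ _ leb) => w.
  exact: sub_telescope2.
apply: (@le_trans _ _ ((cabs (cint (fun w => G x * eta_ t w)))%:E +
   (cabs (cint (fun w => G (x - w) * eta_ t w)))%:E + (cabs (u b h x))%:E)%E).
  by rewrite -!EFinD lee_fin (le_trans (cabsD _ _))// lerD2r cabsB.
apply: leeD; last by exact: large.
apply: leeD; last by apply: (cabs_cint_le_econv (dilate_meas _ me) iG2 mO).
rewrite [X in cabs X](cintZ _ di) cabsM mulrC EFinM.
apply: lee_pmul; rewrite ?lee_fin ?cabs_ge0//.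
by rewrite -(L1n_dilate t0 me); exact: cabs_cint_le_L1n.
Qed.

End density_hardy.

Section density_hardy_concl.
Context {R : realType} {N : nat}.
Notation V := 'rV[R]_N.
Notation leb := (lebesgue_rV (R := R) N).
Implicit Types (x y z : V) (f g : V -> R[i]).
Variables (Phi : V -> R[i]) (C : R).
Hypothesis HC : kernel_bounds C Phi.
Hypothesis Phi1 : cint Phi = 1.
Hypothesis N0 : (0 < N)%N.
Variables (L : R) (eta : V -> R[i]).
Hypothesis He : unit_bump L eta.

Let C_ge0 : 0 <= C. Proof. by case: HC. Qed.
Let L0 : 0 <= L. Proof. by case: He. Qed.
Let ei : cintegrable eta := unit_bump_integrable He.
Let me : cmeas eta := cintegrable_meas ei.

Notation u s f := (convol (dilate s Phi) f).
Notation E := (L1n eta).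
Notation eta_ t := (dilate t eta).

(** Mollification converges in the Hardy space. *)
Lemma Hnorm_sub_bump_small f : hardy Phi f -> forall e : R, 0 < e ->
  exists2 t : R, 0 < t & (Hnorm Phi (fun x => f x - convol (eta_ t) f x)%R <= e%:E)%E.
Proof.
move=> fh e e0; have [fi Mi] := fh.
have mM := measurable_maximal HC fi.
have M0 x : (0 <= maximal_fun Phi f x)%E by exact: maximal_ge0.
have E0 : 0 <= E by exact: L1n_ge0.
pose K := 3 * E + 2; have K0 : 0 < K by rewrite ltr_wpDl// mulr_ge0.
have e1 : 0 < e / K by rewrite divr_gt0.
have [d d0 Hd] := osc_small HC Phi1 fh e1.
have [n Hn] := far_integral_small M0 Mi e1.
pose b := d / 2; have b0 : 0 < b by rewrite divr_gt0.
pose A := b ^- N * (C * b^-1) * L1n f.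
have A0 : 0 <= A.
  by rewrite mulr_ge0 ?L1n_ge0// mulr_ge0 ?invr_ge0 ?exprn_ge0 ?(ltW b0)// mulr_ge0// invr_ge0 ltW.
pose r : R := n.+1%:R; have r0 : 0 < r by [].
pose B := A * E * (r *+ 2) ^+ N.
have B0 : 0 <= B by apply: mulr_ge0; [exact: mulr_ge0|rewrite exprn_ge0// mulrn_wge0].
pose t := Num.min 1 (e / K / (B + 1)).
have B1 : 0 < B + 1 by rewrite ltr_wpDl.
have t0 : 0 < t by rewrite lt_min ltr01 divr_gt0.
have t1 : t <= 1 by rewrite ge_min lexx.
have tB : t * B <= e / K.
  have : t <= e / K / (B + 1) by rewrite ge_min lexx orbT.
  rewrite ler_pdivlMr//; apply: le_trans; rewrite ler_wpM2l ?(ltW t0)// lerDl//.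
exists t => //.
have mO := measurable_osc HC d fi.
have O0 y : (0 <= osc Phi d f y)%E by exact: osc_ge0.
have [di _] := dil_bump_integrable He t0.
have ci := bump_conv_integrable He t0 fi.
have hi := cintegrableB fi ci.
have mt : cmeas (eta_ t) by exact: dilate_meas.
pose F1 x := (E%:E * osc Phi d f x)%E.
pose F2 := econv (eta_ t) (osc Phi d f).
pose F3 x := (A * t * E * \1_(ball (0 : V) r) x)%:E.
pose FM (q : R) x := (maximal_fun Phi f x * (\1_(far q) x)%:E)%E.
pose F5 := econv (eta_ t) (FM (r - 1)).
have mFM q : measurable_fun setT (FM q).
  by apply: measurable_mul_indic => //; exact: measurable_far.
have FM0 q y : (0 <= FM q y)%E by have /andP[] := mul_indic_ge0 (far q) (M0 y).
have m1 : measurable_fun setT F1 by apply: emeasurable_funM.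
have m2 : measurable_fun setT F2 by exact: measurable_econv.
have m3 : measurable_fun setT F3 by exact: measurable_indic_ball.
have m5 : measurable_fun setT F5 by exact: measurable_econv.
have p1 x : (0 <= F1 x)%E by rewrite mule_ge0// lee_fin.
have p2 x : (0 <= F2 x)%E by exact: econv_ge0.
have AtE : 0 <= A * t * E by apply: mulr_ge0 => //; apply: mulr_ge0 => //; exact: ltW.
have p3 x : (0 <= F3 x)%E by rewrite lee_fin mulr_ge0.
have p5 x : (0 <= F5 x)%E by exact: econv_ge0.
have m45 : measurable_fun setT (fun x => FM r x + F5 x)%E by exact: emeasurable_funD.
have p45 x : (0 <= FM r x + F5 x)%E by exact: adde_ge0.
rewrite HnormE; apply: (@le_trans _ _ (\int[leb]_x
  ((F1 x + F2 x) + (F3 x + (FM r x + F5 x))))%E).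
  apply: ge0_le_integral; first exact: measurableT.
  - by move=> x _; exact: maximal_ge0.
  - exact: (measurable_maximal HC hi).
  - by apply: emeasurable_funD; exact: emeasurable_funD.
  - by move=> x _; exact: (maximal_sub_bump_le HC He r x d0 t0 t1 fi).
rewrite ge0_integralD; [|exact: measurableT|by move=> x _; exact: adde_ge0|
  exact: emeasurable_funD|by move=> x _; exact: adde_ge0|exact: emeasurable_funD].
rewrite ge0_integralD; [|exact: measurableT|by move=> x _|exact: m1|by move=> x _|exact: m2].
rewrite [X in (_ + X)%E]ge0_integralD; [|exact: measurableT|by move=> x _|exact: m3|by move=> x _|
  exact: m45].
rewrite [X in (_ + (_ + X))%E]ge0_integralD; [|exact: measurableT|by move=> x _|exact: mFM|
  by move=> x _|exact: m5].
rewrite [X in (X + _ + _)%E]ge0_integralZl_EFin; [|exact: measurableT|by move=> x _; exact: O0|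
  exact: mO|exact: E0].
rewrite [X in (_ + X + _)%E](integral_econv_bump He t0 mO O0).
rewrite [X in (_ + (X + _))%E]integral_indic_ball//.
rewrite [X in (_ + (_ + (_ + X)))%E](integral_econv_bump He t0 (mFM (r - 1)) (FM0 (r - 1))).
have r1 : r - 1 = n%:R by rewrite /r -natr1 addrK.
have hE (X : \bar R) : (X <= (e / K)%:E)%E -> (E%:E * X <= (E * (e / K))%:E)%E.
  by move=> HX; rewrite EFinM lee_wpmul2l// lee_fin.
apply: (@le_trans _ _ (((E * (e / K))%:E + (E * (e / K))%:E) +
   ((e / K)%:E + ((e / K)%:E + (E * (e / K))%:E)))%E).
  apply: leeD; apply: leeD; [exact: hE|exact: hE| |apply: leeD].
  - by rewrite lee_fin; apply: le_trans tB; rewrite /B (_ : A * t * E * _ = t * (A * E * (r *+ 2) ^+ N))//; ring.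
  - exact: (Hn n.+1 (leqnSn _)).
  - by apply: hE; rewrite r1; exact: (Hn n (leqnn _)).
rewrite -!EFinD lee_fin (_ : _ + _ = (3 * E + 2) * (e / K)); last by ring.
by rewrite -/K mulrCA divff ?mulr1// gt_eqF.
Qed.

(** The difference of two averages of integral one has mean zero. *)
Lemma bump_diff_dense (s t : R) : 0 < s -> 0 < t ->
  hardy_dense (fun x => eta_ s x - eta_ t x).
Proof.
move=> s0 t0; have [i1 E1] := dil_bump_integrable He s0.
have [i2 E2] := dil_bump_integrable He t0; split.
- exact: cintegrableB.
- exists (s ^- N * L + t ^- N * L) => x; apply: (le_trans (cabsB _ _)).
  by apply: lerD; exact: (dil_bump_le He).
- exists (N%:R * Num.max s t) => x xst.
  have x1 : Num.max s t <= `|x|.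
    have n0 : 0 < (N%:R : R) by rewrite ltr0n.
    rewrite -(ler_pM2l n0); apply: ltW; apply: lt_le_trans xst _; exact: enorm_le_norm.
  by move: x1; rewrite ge_max => /andP[sx tx]; rewrite !(dil_bump_support He)// subrr.
- by rewrite [LHS](cintB i1 i2) [X in X - _]E1 [X in _ - X]E2 subrr.
Qed.

(** Lipschitz functions with compact support and mean zero are dense in the Hardy
    space: mollify at a small scale, subtract the average at a large scale, and
    truncate. *)
Lemma hardy_density f : hardy Phi f -> forall e : R, 0 < e ->
  exists g, [/\ hardy_dense g, exists Lg : R, 0 <= Lg /\ clipschitz Lg g &
    (Hnorm Phi (fun x => f x - g x)%R <= e%:E)%E].
Proof.
move=> fh e e0; have e3 : 0 < e / 3 by rewrite divr_gt0.
have [fi Mi] := fh.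
have [s s0 Hs] := Hnorm_sub_bump_small fh e3.
have [t t0 Ht] := Hnorm_bump_conv_small HC Phi1 N0 He fh e3.
(* the approximants are convolutions with [phi], which is itself in the Hardy space *)
pose phi x := eta_ s x - eta_ t x.
have phid : hardy_dense phi by exact: bump_diff_dense.
have phih : hardy Phi phi by exact: (hardy_dense_hardy HC phid).
have [phii [Mp HMp] _ phi0] := phid.
have Mp0 : 0 <= Mp by rewrite (le_trans (cabs_ge0 _) (HMp 0)).
have H0 := hardy_norm_ge0 Phi phi; have He1 := hardy_normE HC phih.
have H1 : 0 < hardy_norm Phi phi + 1 by rewrite ltr_wpDl.
have ce : 0 < e / 3 / (hardy_norm Phi phi + 1) by rewrite divr_gt0.
have [n /(_ n (leqnn _)) Hn] := far_integral_small
  (fun x => cabs_ge0 _ : 0 <= (cabs (f x))%:E)%E (cintegrable_cabs fi) ce.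
(* [f1] is the part of [f] in a large ball and [f2] the remainder *)
pose f1 x := f x * cindic (~` far n%:R) x.
pose f2 x := f x * cindic (far n%:R) x.
have i1 : cintegrable f1.
  by apply: cintegrable_indic => //; apply: measurableC; exact: measurable_far.
have i2 : cintegrable f2 by apply: cintegrable_indic => //; exact: measurable_far.
have f12 x : f x = f1 x + f2 x.
  rewrite /f1 /f2 -mulrDr /cindic -rmorphD/= !indicE in_setC.
  by case: (_ \in _); rewrite /= ?add0r ?addr0 mulr1.
have sec h y : cintegrable h -> cintegrable (fun z => phi (y - z) * h z).
  move=> hi; apply: (@convol_section_integrable _ _ phi h Mp) => //.
  exact: cintegrable_meas phii.
have phiL : clipschitz (s ^- N * (L * s^-1) + t ^- N * (L * t^-1)) phi.
  move=> x y; rewrite /phi opprB_ACA mulrDl; apply: (le_trans (cabsB _ _)).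
  by apply: lerD; exact: (dil_bump_lipschitz He).
set Lp := _ + _ in phiL.
have Lp0 : 0 <= Lp.
  by rewrite addr_ge0// mulr_ge0 ?mulr_ge0// invr_ge0 ?exprn_ge0// ltW.
pose g := convol phi f1.
have gi : cintegrable g by exact: (cintegrable_convol phii i1).1.
exists g; split.
- split => //.
  + by exists (Mp * L1n f1) => x; apply: cabs_convol_bounded => //; exact: cintegrable_meas phii.
  + have [r r0 Hr] := hardy_dense_support phid.
    exists (N%:R * (r + n%:R)) => x xr.
    have {}xr : r + n%:R < `|x|.
      have n0 : 0 < (N%:R : R) by rewrite ltr0n.
      rewrite -(ltr_pM2l n0); apply: lt_le_trans xr _; exact: enorm_le_norm.
    rewrite /g /convol -[RHS](cint0 leb); apply: (@eq_cint _ _ _ leb) => y.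
    have [ny|yn] := leP n%:R `|y|.
      by rewrite /f1 /cindic indicE memNset ?mulr0// => /(_ ny).
    rewrite Hr ?mul0r//.
    by have := ler_normD (x - y) y; rewrite subrK; lra.
  + by rewrite [LHS](cint_convol phii i1) [X in X * _]phi0 mul0r.
- exists (Lp * L1n f1); split; first by rewrite mulr_ge0// L1n_ge0.
  move=> x y; rewrite /g /convol.
  have j1 := sec f1 x i1; have j2 := sec f1 y i1; have j3 := cintegrableB j1 j2.
  rewrite -[X in cabs X](cintB j1 j2) mulrAC.
  apply: (cabs_cint_bounded_mul _ i1 j3) => [|z]; first by rewrite mulr_ge0.
  rewrite -mulrBl cabsM ler_wpM2r ?cabs_ge0//; apply: (le_trans (phiL _ _)).
  by rewrite opprB addrA subrK.
- have cs := bump_conv_integrable He s0 fi; have ct := bump_conv_integrable He t0 fi.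
  pose a1 x := f x - convol (eta_ s) f x; pose a2 := convol (eta_ t) f.
  pose a3 := convol phi f2.
  have a1i : cintegrable a1 by exact: cintegrableB.
  have a3i : cintegrable a3 by exact: (cintegrable_convol phii i2).1.
  have -> : (fun x => f x - g x) = (fun x => a1 x + (a2 x + a3 x)).
    apply/funext => x.
    have Eg : g x + a3 x = convol (eta_ s) f x - convol (eta_ t) f x.
      rewrite /g /a3 /convol -[LHS](cintD (sec f1 x i1) (sec f2 x i2)).
      rewrite -[RHS](cintB (dil_bump_section He x s0 fi) (dil_bump_section He x t0 fi)).
      by apply: (@eq_cint _ _ _ leb) => y; rewrite -mulrDr -f12 /phi mulrBl.
    have {}Eg : g x = convol (eta_ s) f x - a2 x - a3 x by rewrite -Eg addrK.
    by rewrite Eg /a1 !opprB [a2 x + _]addrC !addrA; ring.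
  have a23i : cintegrable (fun x => a2 x + a3 x) by exact: cintegrableD.
  apply: (le_trans (HnormD HC a1i a23i)).
  have -> : e = e / 3 + (e / 3 + e / 3) by field.
  rewrite EFinD; apply: leeD; first exact: Hs.
  apply: (le_trans (HnormD HC ct a3i)).
  rewrite EFinD; apply: leeD; first exact: Ht.
  have -> : a3 = convol f2 phi.
    by apply/funext => x; rewrite /a3; apply: convolC_at; exact: sec.
  have sec' y : cintegrable (fun z => f2 (y - z) * phi z).
    have := (cint_reflect y (sec f2 y i2)).1; congr cintegrable; apply/funext => z.
    by rewrite /= subKr mulrC.
  apply: (le_trans (Hnorm_convol HC i2 phii sec')).
  rewrite He1.
  apply: (@le_trans _ _ ((e / 3 / (hardy_norm Phi phi + 1))%:E * (hardy_norm Phi phi)%:E)%E).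
    apply: lee_wpmul2r; first by rewrite lee_fin.
    apply: le_trans Hn; rewrite le_eqVlt; apply/orP; left; apply/eqP.
    apply: eq_integral => x _; rewrite /f2 cabsM /cindic cabs_real EFinM.
    by congr (_ * _)%E; rewrite ger0_norm// indicE ler0n.
  rewrite -EFinM lee_fin mulrAC ler_pdivrMr// ler_wpM2l ?(ltW e3)//.
  by rewrite lerDl.
Qed.

End density_hardy_concl.

(** * The logarithmic potential *)

Section potential.
Context {R : realType} {N : nat}.
Notation V := 'rV[R]_N.
Notation leb := (lebesgue_rV (R := R) N).
Implicit Types (x y z : V) (f g h : V -> R[i]).
Variables (Phi : V -> R[i]) (C : R).
Hypothesis HC : kernel_bounds C Phi.
Hypothesis Phi1 : cint Phi = 1.
Hypothesis N0 : (0 < N)%N.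
Variable c : R.

(** The pairing of [g] with the logarithmic kernel centred at [x]. *)
Definition log_pot g x : R[i] := cint (fun z => g z * log_kernel c (x - z)).

Lemma log_section g x : hardy_dense g -> cintegrable (fun z => g z * log_kernel c (x - z)).
Proof. by move=> gd; have [] := log_kernel_section N0 c x gd. Qed.

Lemma hardy_dense_lin (a : R[i]) f g : hardy_dense f -> hardy_dense g ->
  hardy_dense (fun x => a * f x + g x).
Proof.
move=> [fi [Mf HMf] [rf Hrf] f0] [gi [Mg HMg] [rg Hrg] g0].
have ai := cintegrableZ a fi; split.
- exact: cintegrableD.
- exists (cabs a * Mf + Mg) => x; apply: (le_trans (cabsD _ _)); rewrite cabsM.
  by apply: lerD => //; rewrite ler_wpM2l ?cabs_ge0.
- exists (Num.max rf rg) => x; rewrite gt_max => /andP[xf xg].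
  by rewrite Hrf// Hrg// mulr0 addr0.
- by rewrite [LHS](cintD ai gi) [X in X + _](cintZ a fi) [X in _ * X + _]f0 [X in _ + X]g0 mulr0 addr0.
Qed.

Lemma log_pot_lin (a : R[i]) f g x : hardy_dense f -> hardy_dense g ->
  log_pot (fun x => a * f x + g x) x = a * log_pot f x + log_pot g x.
Proof.
move=> fd gd; have i1 := log_section x fd; have i2 := log_section x gd.
have i3 := cintegrableZ a i1.
rewrite -[X in X + _](cintZ a i1) -[RHS](cintD i3 i2); apply: (@eq_cint _ _ _ leb) => z.
by rewrite mulrDl mulrA.
Qed.

Lemma hardy_dense0 : hardy_dense (fun _ : V => 0 : R[i]).
Proof.
split; [exact: cintegrable0|by exists 0 => x; rewrite cabs0|by exists 0|exact: cint0].
Qed.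

Lemma hardyB f g : hardy Phi f -> hardy Phi g -> hardy Phi (fun x => f x - g x).
Proof.
move=> fh gh; have := hardyD HC fh (hardyZ HC (-1) gh); congr (hardy Phi).
by apply/funext => x; rewrite mulN1r.
Qed.

Lemma hardy_norm0 : hardy_norm Phi (fun _ : V => 0) = 0.
Proof.
apply/eqP; rewrite eq_le hardy_norm_ge0 andbT.
have := hardy_normZ HC 0 (hardy_dense_hardy HC hardy_dense0).
have -> : (fun _ : V => 0 * 0 : R[i]) = (fun=> 0) by apply/funext => x; rewrite mul0r.
by rewrite cabs0 mul0r.
Qed.

Lemma hardy_norm_tri f g h : hardy Phi f -> hardy Phi g -> hardy Phi h ->
  hardy_norm Phi (fun x => g x - h x) <=
  hardy_norm Phi (fun x => f x - g x) + hardy_norm Phi (fun x => f x - h x).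
Proof.
move=> fh gh hh; have fgh := hardyB fh gh; have fhh := hardyB fh hh.
have mh := hardyZ HC (-1) fgh.
have -> : (fun x => g x - h x) = (fun x => -1 * (f x - g x) + (f x - h x)).
  by apply/funext => x; ring.
apply: (le_trans (hardy_normD HC mh fhh)); rewrite lerD2r.
by apply: (le_trans (hardy_normZ HC (-1) fgh)); rewrite cabsN (cabs_real 1) normr1 mul1r.
Qed.

(** Approximation in the norm, by elements of the dense class that are moreover
    Lipschitz. *)
Lemma hardy_approx f : hardy Phi f -> forall e : R, 0 < e ->
  exists g, [/\ hardy_dense g, exists Lg : R, 0 <= Lg /\ clipschitz Lg g &
    hardy_norm Phi (fun x => f x - g x) <= e].
Proof.
move=> fh e e0; have [L [eta He]] := exists_unit_bump (R := R) (N := N).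
have [g [gd gL ge]] := hardy_density HC Phi1 N0 He fh e0.
exists g; split; [exact: gd|exact: gL|].
by have := ge; rewrite (hardy_normE HC (hardyB fh (hardy_dense_hardy HC gd))) lee_fin.
Qed.

(** An intermediate value between families of lower and upper bounds. *)
Lemma between (I : Type) (P : I -> Prop) (a b : I -> R) : (exists i, P i) ->
  (forall i j, P i -> P j -> a i - b i <= a j + b j) ->
  exists v, forall i, P i -> `|v - a i| <= b i.
Proof.
move=> [i0 Pi0] H; pose A := [set a i - b i | i in [set i | P i]].
have A0 : A !=set0 by exists (a i0 - b i0), i0.
have Aub j : P j -> ubound A (a j + b j) by move=> Pj _ [i Pi <-]; exact: H.
exists (sup A) => i Pi; rewrite ler_norml; apply/andP; split.
  rewrite lerBrDl; apply: sup_upper_bound; last by exists i.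
  by split=> //; exists (a i + b i); exact: Aub.
rewrite lerBlDl; apply: ge_sup => //; exact: Aub.
Qed.

Lemma log_pot_bound : exists2 K : R, 0 <= K & forall f g x,
  hardy_dense f -> hardy_dense g ->
  cabs (log_pot f x - log_pot g x) <= K * hardy_norm Phi (fun x => f x - g x).
Proof.
have [K K0 HK] := log_kernel_bound HC Phi1 N0 c; exists K => // f g x fd gd.
have E : (fun x => f x - g x) = (fun x => -1 * g x + f x).
  by apply/funext => z; rewrite mulN1r addrC.
have hd : hardy_dense (fun x => f x - g x) by rewrite E; exact: hardy_dense_lin.
have -> : log_pot f x - log_pot g x = log_pot (fun x => f x - g x) x.
  by rewrite E log_pot_lin// mulN1r addrC.
exact: (HK _ hd (hardy_dense_hardy HC hd)).
Qed.

Lemma cross_le (p q r t : R) : p - q <= r + t -> p - r <= q + t.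
Proof. by lra. Qed.

(** The values [v] that the extension of the pairing may take at [f]: those compatible
    with all approximations of [f] by the dense class. *)
Definition pot_value (K : R) f x (v : R[i]) : Prop := forall g, hardy_dense g ->
  cabs (v - log_pot g x) <= K * hardy_norm Phi (fun z => f z - g z).

Lemma exists_pot_value : exists2 K : R, 0 <= K &
  forall f x, hardy Phi f -> exists v, pot_value K f x v.
Proof.
(* the factor two comes from treating real and imaginary parts separately *)
have [K K0 HK] := log_pot_bound; exists (2 * K); first by rewrite mulr_ge0.
move=> f x fh.
have key g h : hardy_dense g -> hardy_dense h -> cabs (log_pot g x - log_pot h x) <=
    K * hardy_norm Phi (fun z => f z - g z) + K * hardy_norm Phi (fun z => f z - h z).
  move=> gd hd; rewrite -mulrDr; apply: (le_trans (HK g h x gd hd)); rewrite ler_wpM2l//.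
  exact: (hardy_norm_tri fh (hardy_dense_hardy HC gd) (hardy_dense_hardy HC hd)).
have ne : exists g, hardy_dense g by exists (fun=> 0); exact: hardy_dense0.
have [v1 H1] : exists v, forall g, hardy_dense g ->
    `|v - complex.Re (log_pot g x)| <= K * hardy_norm Phi (fun z => f z - g z).
  apply: between ne _ => g h gd hd; apply: cross_le; rewrite -ReN -ReD.
  exact: le_trans (le_trans (ler_norm _) (Re_le_cabs _)) (key g h gd hd).
have [v2 H2] : exists v, forall g, hardy_dense g ->
    `|v - complex.Im (log_pot g x)| <= K * hardy_norm Phi (fun z => f z - g z).
  apply: between ne _ => g h gd hd; apply: cross_le; rewrite -ImN -ImD.
  exact: le_trans (le_trans (ler_norm _) (Im_le_cabs _)) (key g h gd hd).
exists (v1 +i* v2)%C => g gd; apply: (le_trans (cabs_le_ReIm _)).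
rewrite ReD ImD ReN ImN -mulrA mulr_natl mulr2n; apply: lerD; [exact: H1|exact: H2].
Qed.

Lemma sub_lin (a p q r s t : R[i]) :
  p - (a * q + r) = (p - (a * s + t)) - (a * (q - s) + (r - t)).
Proof. by ring. Qed.

Section functional.
Variables (K : R).
Hypothesis K0 : 0 <= K.
Hypothesis HK : forall f x, hardy Phi f -> exists v, pot_value K f x v.

(** The extension of the pairing to the Hardy space. *)
Definition pot_ext x f : R[i] := xget 0 [set v | pot_value K f x v].

Lemma pot_extP f x g : hardy Phi f -> hardy_dense g ->
  cabs (pot_ext x f - log_pot g x) <= K * hardy_norm Phi (fun z => f z - g z).
Proof. by move=> fh gd; exact: (xgetPex 0 (HK x fh) g gd). Qed.

Lemma pot_ext_dense f x : hardy_dense f -> pot_ext x f = log_pot f x.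
Proof.
move=> fd; have := pot_extP x (hardy_dense_hardy HC fd) fd.
have -> : (fun z => f z - f z) = (fun=> 0) by apply/funext => z; rewrite subrr.
rewrite hardy_norm0 mulr0 => h; apply/eqP; rewrite -subr_eq0; apply/eqP/cabs0_eq0/eqP.
by rewrite eq_le h cabs_ge0.
Qed.

Lemma pot_ext_functional x :
  is_dual_functional Phi (fun y => log_kernel c (x - y)) (pot_ext x).
Proof.
split; last by move=> f fd; exact: (pot_ext_dense x fd).
- move=> a f h fh hh; set l := fun z => a * f z + h z.
  have lh : hardy Phi l by exact: (hardyD HC (hardyZ HC a fh) hh).
  apply/eqP; rewrite -subr_eq0; apply/eqP/cabs0_eq0/eqP; rewrite eq_le cabs_ge0 andbT.
  apply/ler_addgt0Pr => e e0; rewrite add0r.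
  pose A := 2 * K * (cabs a + 1) + 1.
  have a0 : 0 <= cabs a by exact: cabs_ge0.
  have A0 : 0 < A by rewrite ltr_wpDl// mulr_ge0 ?mulr_ge0 ?addr_ge0.
  have d0 : 0 < e / A by rewrite divr_gt0.
  have [g1 [g1d _ H1]] := hardy_approx fh d0; have [g2 [g2d _ H2]] := hardy_approx hh d0.
  have g1h := hardyB fh (hardy_dense_hardy HC g1d).
  have g2h := hardyB hh (hardy_dense_hardy HC g2d).
  have gd := hardy_dense_lin a g1d g2d; have P := pot_extP x lh gd.
  rewrite log_pot_lin// in P.
  have P1 := pot_extP x fh g1d; have P2 := pot_extP x hh g2d.
  have Hl : hardy_norm Phi (fun z => l z - (a * g1 z + g2 z)) <= (cabs a + 1) * (e / A).
    have -> : (fun z => l z - (a * g1 z + g2 z)) = (fun z => a * (f z - g1 z) + (h z - g2 z)).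
      by apply/funext => z; rewrite /l; ring.
    apply: (le_trans (hardy_normD HC (hardyZ HC a g1h) g2h)).
    rewrite mulrDl mul1r; apply: lerD H2; apply: (le_trans (hardy_normZ HC a g1h)).
    exact: (ler_wpM2l a0 H1).
  rewrite [X in cabs X](sub_lin _ _ _ _ (log_pot g1 x) (log_pot g2 x)).
  apply: (le_trans (cabsB _ _)).
  apply: (@le_trans _ _ (K * ((cabs a + 1) * (e / A)) +
     (cabs a * (K * (e / A)) + K * (e / A)))).
    apply: lerD; first exact: (le_trans P (ler_wpM2l K0 Hl)).
    apply: (le_trans (cabsD _ _)); apply: lerD; last exact: (le_trans P2 (ler_wpM2l K0 H2)).
    rewrite cabsM; exact: (ler_wpM2l a0 (le_trans P1 (ler_wpM2l K0 H1))).
  have -> : K * ((cabs a + 1) * (e / A)) + (cabs a * (K * (e / A)) + K * (e / A)) =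
     (2 * K * (cabs a + 1)) * (e / A) by ring.
  by rewrite mulrCA ler_piMr ?(ltW e0)// ler_pdivrMr// mul1r lerDl.
- exists K => f fh; have := pot_extP x fh hardy_dense0.
  have -> : log_pot (fun=> 0) x = 0.
    rewrite -[RHS](cint0 leb); apply: (@eq_cint _ _ _ leb) => z; by rewrite mul0r.
  by rewrite subr0 (_ : (fun z => f z - 0) = f)//; apply/funext => z; rewrite subr0.
Qed.

Lemma Lambda_inv_functional x :
  is_dual_functional Phi (fun y => log_kernel c (x - y)) (fun f => Lambda_inv Phi c f x).
Proof.
by apply: (xgetPex (fun=> 0)); exists (pot_ext x); exact: pot_ext_functional.
Qed.

(** The functional in the definition is the extension by density. *)
Lemma Lambda_inv_pot_ext f x : hardy Phi f -> Lambda_inv Phi c f x = pot_ext x f.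
Proof.
move=> fh; have [lin [B HB] dns] := Lambda_inv_functional x.
apply/eqP; rewrite -subr_eq0; apply/eqP/cabs0_eq0/eqP; rewrite eq_le cabs_ge0 andbT.
apply/ler_addgt0Pr => e e0; rewrite add0r.
have A0 : 0 < `|B| + K + 1 by rewrite ltr_wpDl// addr_ge0.
have d0 : 0 < e / (`|B| + K + 1) by rewrite divr_gt0.
have [g [gd _ Hg]] := hardy_approx fh d0; have gh := hardy_dense_hardy HC gd.
have fgh := hardyB fh gh.
have E : Lambda_inv Phi c (fun z => f z - g z) x = Lambda_inv Phi c f x - log_pot g x.
  have := lin (-1) g f gh fh; rewrite (dns g gd).
  have -> : (fun z => -1 * g z + f z) = (fun z => f z - g z).
    by apply/funext => z; rewrite mulN1r addrC.
  by rewrite mulN1r addrC.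
have H1 : cabs (Lambda_inv Phi c f x - log_pot g x) <=
    `|B| * hardy_norm Phi (fun z => f z - g z).
  rewrite -E; apply: (le_trans (HB _ fgh)); rewrite ler_wpM2r ?ler_norm//.
  exact: hardy_norm_ge0.
have H2 := pot_extP x fh gd; rewrite cabsBC in H2.
apply: (le_trans (cabs_triangle (log_pot g x) _ _)).
apply: (le_trans (lerD H1 H2)); rewrite -mulrDl.
apply: (@le_trans _ _ ((`|B| + K) * (e / (`|B| + K + 1)))).
  by rewrite ler_wpM2l// addr_ge0.
by rewrite mulrCA ler_piMr ?(ltW e0)// ler_pdivrMr// mul1r lerDl.
Qed.

End functional.

End potential.

Section potential_regularity.
Context {R : realType} {N : nat}.
Notation V := 'rV[R]_N.
Notation leb := (lebesgue_rV (R := R) N).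
Implicit Types (x y z w : V) (f g h : V -> R[i]).
Hypothesis N0 : (0 < N)%N.
Variable c : R.

Lemma log_kernel_le w : cabs (log_kernel c w) <=
  `|c| * (`|ln `|w| | * \1_(ball (0 : V) 1) w + (`|w| + ln N%:R)).
Proof.
rewrite cabs_real normrM ler_wpM2l// addrA.
have h1 := ler_normD (ln (enorm w) - ln `|w|) (ln `|w|); rewrite subrK in h1.
have h2 := ln_enorm_near N0 w; have h3 := ln_le_norm (normr_ge0 w).
have h4 : `|ln `|w| | * \1_(`]-oo, 1[%classic) `|w| <= `|ln `|w| | * \1_(ball (0 : V) 1) w.
  rewrite ler_wpM2l//; have [w1|w1] := ltP `|w| 1.
    by rewrite indic_ball1// indicE; case: (_ \in _).
  by rewrite indicE memNset// /= in_itv/= ltNge w1.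
lra.
Qed.

Lemma log_kernel_ball_integrable (r : R) : 0 < r ->
  cintegrable (fun w => log_kernel c w * cindic (ball (0 : V) r) w).
Proof.
move=> r0; have lN : 0 <= ln (N%:R : R) by rewrite ln_ge0// ler1n.
have mk : cmeas (fun w : V => log_kernel c w).
  have := cmeas_reflect 0 (cmeas_log_kernel c (0 : V)).
  by congr cmeas; apply/funext => w; rewrite subKr.
apply: (le_cintegrable (g := fun w => `|c| * (`|ln `|w| | * \1_(ball (0 : V) 1) w) +
  (`|c| * (r + ln N%:R)) * \1_(ball (0 : V) r) w)).
- apply: cmeasM => //; apply: cmeas_real; apply: measurable_indic.
  exact: measurable_rV_ball.
- have i2 : leb.-integrable setT (fun w : V => ((`|c| * (r + ln N%:R)) * \1_(ball (0 : V) r) w)%:E).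
    apply/integrableP; split; first exact: measurable_indic_ball.
    rewrite (eq_integral (fun w : V => ((`|c| * (r + ln N%:R)) * \1_(ball (0 : V) r) w)%:E)).
      by rewrite integral_indic_ball ?ltry// mulr_ge0// addr_ge0// ltW.
    by move=> w _; rewrite /= ger0_norm// mulr_ge0// mulr_ge0// addr_ge0// ltW.
  have := integrableD measurableT (integrableZl measurableT `|c| (integrable_ln_ball N0)) i2.
  by apply: eq_integrable => // w _; rewrite /= EFinD !EFinM.
move=> w; rewrite cabsM; have [wr|rw] := ltP `|w| r; last first.
  rewrite /cindic indicE memNset ?cabs0 ?mulr0.
    by rewrite addr_ge0 ?mulr_ge0// ?mulr_ge0// addr_ge0// ltW.
  by rewrite ball0E; apply/negP; rewrite -leNgt.
rewrite (le_trans (ler_wpM2l (cabs_ge0 _) (cindic_le1 _ _)))// mulr1.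
apply: (le_trans (log_kernel_le w)); rewrite mulrDr lerD2l indic_ball1// mulr1.
by rewrite ler_wpM2l// lerD2r ltW.
Qed.

Lemma log_pot_reflect g x : hardy_dense g ->
  cintegrable (fun w => g (x - w) * log_kernel c w) /\
  log_pot c g x = cint (fun w => g (x - w) * log_kernel c w).
Proof.
move=> gd; have [i e] := cint_reflect x (log_section N0 c x gd).
have E : (fun w => g (x - w) * log_kernel c (x - (x - w))) =
  (fun w => g (x - w) * log_kernel c w) by apply/funext => w; rewrite subKr.
by rewrite E in i e; exact: (conj i (esym e)).
Qed.

(** The difference of translates falls on the Lipschitz factor. *)
Lemma log_pot_lipschitz g (L : R) x : hardy_dense g -> 0 <= L -> clipschitz L g ->
  exists2 B : R, 0 <= B & forall y, `|x - y| <= 1 ->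
    cabs (log_pot c g x - log_pot c g y) <= B * `|x - y|.
Proof.
move=> gd L0 gL; have [r r0 Hr] := hardy_dense_support gd.
pose q := `|x| + r + 2; have q0 : 0 < q by rewrite ltr_wpDl// addr_ge0.
have ki := log_kernel_ball_integrable q0.
exists (L * L1n (fun w => log_kernel c w * cindic (ball (0 : V) q) w)).
  by rewrite mulr_ge0// L1n_ge0.
move=> y xy; have [i1 ->] := log_pot_reflect x gd; have [i2 ->] := log_pot_reflect y gd.
have i3 := cintegrableB i1 i2.
rewrite -[X in cabs X](cintB i1 i2) mulrAC.
apply: (cabs_cint_bounded_mul _ ki i3) => [|w]; first by rewrite mulr_ge0.
rewrite -mulrBl !cabsM; have [wq|qw] := ltP `|w| q.
  have -> : cabs (cindic (ball (0 : V) q) w) = 1 by rewrite cabs_real indic_ball1// normr1.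
  rewrite mulr1 ler_wpM2r ?cabs_ge0//; apply: (le_trans (gL _ _)).
  by rewrite opprB addrA subrK.
have wx : r < `|x - w|.
  have := ler_normD (x - w) (- x); rewrite normrN addrAC subrr add0r normrN.
  by rewrite /q in qw; lra.
have wy : r < `|y - w|.
  have := ler_normD (y - w) (x - y); rewrite addrCA addrAC subrr add0r addrC => h.
  by have := ler_normD (x - w) (- x); rewrite normrN addrAC subrr add0r normrN;
    move: h; rewrite /q in qw *; rewrite addrC; lra.
by rewrite (Hr _ wx) (Hr _ wy) subrr cabs0 mul0r mulr_ge0 ?mulr_ge0 ?cabs_ge0.
Qed.

Lemma ln_sub_le (a b d : R) : 0 < b -> d <= 2^-1 -> `|a - b| <= d * b ->
  `|ln a - ln b| <= 2 * d.
Proof.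
move=> b0 d2 /ler_normlP[]; rewrite opprB => h1 h2.
have d0 : 0 <= d by rewrite -(pmulr_lge0 _ b0); lra.
have db : d * b <= 2^-1 * b by rewrite ler_wpM2r// ltW.
have a0 : 0 < a by lra.
have key (p q : R) : 0 < p -> 0 < q -> ln p - ln q <= (p - q) / q.
  move=> p0 q0; rewrite -ln_div ?posrE//.
  have := @le_ln1Dx R (p / q - 1); rewrite addrCA subrr addr0 => H.
  have pq : -1 < p / q - 1 by rewrite -subr_gt0 opprK subrK divr_gt0.
  by apply: (le_trans (H pq)); rewrite mulrBl divff// gt_eqF.
rewrite ler_norml; apply/andP; split.
  rewrite -lerN2 opprB opprK; apply: (le_trans (key _ _ b0 a0)).
  rewrite ler_pdivrMr//; have : d * b <= d * (2 * a) by rewrite ler_wpM2l//; lra.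
  lra.
apply: (le_trans (key _ _ a0 b0)); rewrite ler_pdivrMr//.
have : 0 <= d * b by rewrite mulr_ge0// ltW.
lra.
Qed.

Lemma log_kernel_increment (r : R) x z : 0 < r -> `|z| <= r -> 6 * N%:R * r <= `|x| ->
  cabs (log_kernel c (x - z) - log_kernel c x) <= `|c| * (3 * N%:R * r / `|x|).
Proof.
move=> r0 zr rx; have N1 : 1 <= (N%:R : R) by rewrite ler1n.
have x0 : 0 < `|x| by apply: lt_le_trans rx; rewrite !mulr_gt0// ltr0n.
have rx' : r <= `|x|.
  by apply: le_trans rx; rewrite ler_peMl ?(ltW r0)//; lra.
pose S y := \sum_(i < N) y ord0 i ^+ 2.
have S0 y : 0 <= S y by apply: sumr_ge0 => i _; exact: sqr_ge0.
have SE y : enorm y ^+ 2 = S y by exact: (sqr_sqrtr (S0 y)).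
have Sx : `|x| ^+ 2 <= S x.
  by rewrite -SE lerXn2r ?nnegrE ?enorm_ge0// norm_le_enorm.
have Sx0 : 0 < S x by apply: lt_le_trans Sx; rewrite exprn_gt0.
pose d := 3 * N%:R * r / `|x|.
have d2 : d <= 2^-1 by rewrite ler_pdivrMr//; lra.
have Sd : `|S (x - z) - S x| <= d * S x.
  apply: (@le_trans _ _ (3 * N%:R * r * `|x|)); last first.
    have -> : 3 * N%:R * r * `|x| = d * `|x| ^+ 2.
      by rewrite /d expr2; field; rewrite gt_eqF.
    by rewrite ler_wpM2l// divr_ge0 ?(ltW x0)// !mulr_ge0// ltW.
  rewrite /S -sumrB; apply: (le_trans (ler_norm_sum _ _ _)).
  apply: (@le_trans _ _ (\sum_(i < N) 3 * (r * `|x|))); last first.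
    rewrite sumr_const card_ord -mulr_natl le_eqVlt; apply/orP; left; apply/eqP; ring.
  apply: ler_sum => i _; rewrite !mxE.
  have -> : (x ord0 i - z ord0 i) ^+ 2 - x ord0 i ^+ 2 =
    z ord0 i ^+ 2 - 2 * (x ord0 i * z ord0 i) by ring.
  have zi := le_trans (rV_coord_le z i) zr; have xi := rV_coord_le x i.
  apply: (le_trans (ler_normB _ _)); rewrite normrX !normrM (ger0_norm (ler0n R 2)).
  have h1 : `|z ord0 i| ^+ 2 <= r * `|x|.
    by rewrite expr2 ler_pM// (le_trans zi).
  have h2 : `|x ord0 i| * `|z ord0 i| <= r * `|x| by rewrite mulrC ler_pM.
  lra.
have := ln_sub_le Sx0 d2 Sd; rewrite -!SE.
have e1 : 0 < enorm x by apply: lt_le_trans (norm_le_enorm x).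
have e2 : 0 < enorm (x - z).
  apply: lt_le_trans (norm_le_enorm _); rewrite normr_gt0 subr_eq0.
  apply: contraTneq rx => xz; rewrite -ltNge -xz in zr *; move: x0 zr; clear -r0 N1.
  move=> _ xr; have Nr : r <= N%:R * r by rewrite ler_peMl// ltW.
  lra.
rewrite !lnXn// !mulr2n => H.
rewrite /log_kernel cabs_realB -mulrBr normrM ler_wpM2l// -/d.
have E : ln (enorm (x - z)) + ln (enorm (x - z)) - (ln (enorm x) + ln (enorm x)) =
  2 * (ln (enorm (x - z)) - ln (enorm x)) by ring.
by move: H; rewrite E normrM (ger0_norm (ler0n R 2)); lra.
Qed.

(** By cancellation, since increments of the logarithm decay. *)
Lemma log_pot_decay g (e : R) : hardy_dense g -> 0 < e -> exists r : R,
  forall x, r < `|x| -> cabs (log_pot c g x) <= e.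
Proof.
move=> gd e0; have [r0 r00 Hr] := hardy_dense_support gd; have [gi _ _ g0] := gd.
pose r := r0 + 1; have rp : 0 < r by rewrite ltr_wpDl.
have {}Hr z : r < `|z| -> g z = 0.
  by move=> rz; apply: Hr; rewrite (lt_trans _ rz)// ltrDl.
pose A := `|c| * (3 * N%:R * r) * L1n g.
have A0 : 0 <= A by rewrite mulr_ge0 ?L1n_ge0// !mulr_ge0// ltW.
exists (6 * N%:R * r + A / e) => x xr.
have q0 : 0 <= 6 * N%:R * r by rewrite !mulr_ge0// ltW.
have Ae : 0 <= A / e by rewrite divr_ge0// ltW.
have x1 : 6 * N%:R * r <= `|x| by lra.
have x2 : A / e <= `|x| by lra.
have x0 : 0 < `|x| by apply: le_lt_trans xr; exact: addr_ge0.
have i1 := log_section N0 c x gd; have i2 := cintegrableZ (log_kernel c x) gi.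
have i3 := cintegrableB i1 i2.
have -> : log_pot c g x =
    cint (fun z => g z * log_kernel c (x - z) - log_kernel c x * g z).
  by rewrite [RHS](cintB i1 i2) [X in _ - X](cintZ _ gi) [X in _ * X]g0 mulr0 subr0.
apply: (@le_trans _ _ (`|c| * (3 * N%:R * r / `|x|) * L1n g)).
  apply: (cabs_cint_bounded_mul _ gi i3) => [|z].
    by rewrite mulr_ge0// divr_ge0 ?(ltW x0)// !mulr_ge0// ltW.
  rewrite [log_kernel c x * _]mulrC -mulrBr cabsM mulrC.
  have [rz|zr] := ltP r `|z|; first by rewrite Hr// cabs0 !mulr0.
  by rewrite ler_wpM2r ?cabs_ge0//; exact: log_kernel_increment.
have -> : `|c| * (3 * N%:R * r / `|x|) * L1n g = A / `|x|.
  by rewrite /A; field; rewrite gt_eqF.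
by rewrite ler_pdivrMr// mulrC -ler_pdivrMr.
Qed.

End potential_regularity.

Section limit.
Context {R : realType} {N : nat}.
Notation V := 'rV[R]_N.
Implicit Types (u : V -> R[i]) (x y : V).

(** Uniform limits preserve continuity. *)
Lemma cabs_continuous_uniform u (F : V -> R) :
  (forall x y, `|F x - F y| <= cabs (u x - u y)) ->
  (forall e : R, 0 < e -> exists w, (forall x, cabs (u x - w x) <= e) /\
     forall x, exists2 B : R, 0 <= B & forall y, `|x - y| <= 1 ->
       cabs (w x - w y) <= B * `|x - y|) ->
  continuous F.
Proof.
move=> Fu H x A /nbhs_ballP[e /= e0 eA].
have e4 : 0 < e / 4 by rewrite divr_gt0.
have [w [uw Hw]] := H _ e4; have [B B0 HB] := Hw x.
have B1 : 0 < B + 1 by rewrite ltr_wpDl.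
apply/nbhs_ballP; exists (Num.min 1 (e / 4 / (B + 1))).
  by rewrite /= lt_min ltr01 divr_gt0.
move=> y; rewrite -[ball x _ y]/(ball x _ y) -ball_normE /= lt_min => /andP[xy1 xyB].
apply: eA; rewrite -ball_normE /=.
have h1 := HB y (ltW xy1).
have h2 : B * `|x - y| <= e / 4.
  move: xyB; rewrite ltr_pdivlMr// => /ltW; apply: le_trans.
  by rewrite mulrC ler_wpM2l// lerDl.
have h3 := uw x; have h4 := uw y; rewrite cabsBC in h4.
have h5 := cabs_triangle (w x) (u x) (u y); have h6 := cabs_triangle (w y) (w x) (u y).
have h7 := Fu x y; lra.
Qed.

End limit.

Unset Implicit Arguments.

Theorem theorem9p3 (R : realType) (N : nat) (hN : (1 <= N)%N)
    (c : R) (hc : @is_log_constant R N c)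
    (Phi : 'rV[R]_N -> R[i]) (hPhi : schwartz Phi) (hPhi1 : cint Phi = 1) :
  (forall x : 'rV[R]_N,
     is_dual_functional Phi (fun y => log_kernel c (x - y))
       (fun f => Lambda_inv Phi c f x)) /\
  (forall f : 'rV[R]_N -> R[i], hardy Phi f -> C0 (Lambda_inv Phi c f)) /\
  (exists K : R, forall f : 'rV[R]_N -> R[i], hardy Phi f ->
     sup_norm (Lambda_inv Phi c f) <= K * hardy_norm Phi f).
Proof.
have [C HC] := schwartz_kernel_bounds hPhi.
have [K K0 HK] := exists_pot_value HC hPhi1 hN c.
have ext f x g : hardy Phi f -> hardy_dense g ->
    cabs (Lambda_inv Phi c f x - log_pot c g x) <= K * hardy_norm Phi (fun z => f z - g z).
  move=> fh gd; rewrite (Lambda_inv_pot_ext HC hPhi1 hN K0 HK x fh).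
  exact: (pot_extP HK x fh gd).
have approx f (e : R) : hardy Phi f -> 0 < e -> exists g, [/\ hardy_dense g,
    exists L : R, 0 <= L /\ clipschitz L g &
    forall x, cabs (Lambda_inv Phi c f x - log_pot c g x) <= e].
  move=> fh e0; have K1 : 0 < K + 1 by rewrite ltr_wpDl.
  have [g [gd gL Hg]] := hardy_approx HC hPhi1 hN fh (divr_gt0 e0 K1).
  exists g; split => // x; apply: (le_trans (ext f x g fh gd)).
  apply: (le_trans (ler_wpM2l K0 Hg)).
  by rewrite mulrCA ler_piMr ?(ltW e0)// ler_pdivrMr// mul1r lerDl.
split; first by move=> x; exact: (Lambda_inv_functional HC hPhi1 hN K0 HK x).
split=> [f fh|].
  have app (e : R) : 0 < e -> exists w, (forall x, cabs (Lambda_inv Phi c f x - w x) <= e) /\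
     forall x, exists2 B : R, 0 <= B & forall y, `|x - y| <= 1 ->
       cabs (w x - w y) <= B * `|x - y|.
    move=> e0; have [g [gd [L [L0 gL]] Hg]] := approx f e fh e0.
    exists (log_pot c g); split; first exact: Hg.
    by move=> x; exact: (log_pot_lipschitz hN c x gd L0 gL).
  split.
  - apply: (cabs_continuous_uniform (u := Lambda_inv Phi c f)) app => x y.
    by rewrite -ReN -ReD Re_le_cabs.
  - apply: (cabs_continuous_uniform (u := Lambda_inv Phi c f)) app => x y.
    by rewrite -ImN -ImD Im_le_cabs.
  - move=> e e0; have e4 : 0 < e / 4 by rewrite divr_gt0.
    have [g [gd _ Hg]] := approx f _ fh e4.
    have [r Hr] := log_pot_decay hN c gd e4.
    exists (N%:R * r) => x xr.
    have {}xr : r < `|x|.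
      have n0 : 0 < (N%:R : R) by rewrite ltr0n.
      rewrite -(ltr_pM2l n0); apply: lt_le_trans xr _; exact: enorm_le_norm.
    have h1 := Hr x xr; have h2 := Hg x.
    have := cabsD (Lambda_inv Phi c f x - log_pot c g x) (log_pot c g x).
    by rewrite subrK; lra.
exists K => f fh; apply: ge_sup.
  by exists (cabs (Lambda_inv Phi c f 0)); exists 0.
move=> _ [x _ <-]; have := ext f x _ fh hardy_dense0.
have -> : log_pot c (fun=> 0) x = 0.
  rewrite -[RHS](cint0 (lebesgue_rV N)); apply: (@eq_cint _ _ _ (lebesgue_rV N)) => z.
  by rewrite mul0r.
by rewrite subr0 (_ : (fun z => f z - 0) = f)//; apply/funext => z; rewrite subr0.
Qed.
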